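(* Let $(\mathcal E,\|\cdot\|)$ be a quadratically smoothable space with smoothness parameter $\kappa_{\mathcal E}$, let $T:\mathcal E\to\mathcal E$ be $\gamma$-Lipschitz with $\gamma\in(0,1]$ and with a fixed point $x_*$, let $\epsilon>0$, $\delta\in(0,1)$. Suppose the stochastic oracle satisfies $\mathbb E_{\xi\sim\mathcal D}[\tau(x;\xi)]=T(x)$ and $\mathbb E_{\xi\sim\mathcal D}[\|\tau(x;\xi)-T(x)\|^2]\le\sigma^2$ for all $x\in\mathcal E$, that it can be queried at two or more points with the same random seed $\xi$, and that for some $L\in(0,\infty)$, $\mathbb E_{\xi\sim\mathcal D}[\|\tau(x;\xi)-\tau(y;\xi)\|^2]\le L^2\|x-y\|^2$ for all $x,y\in\mathcal E$. Let $D_L:=\|x_*-x_0\|+\sigma+\sqrt{L^2+\gamma^2}$. Consider VR-GHAL (described in the context) invoked with $\bar\gamma=\gamma$, $\epsilon_0=\bar\lambda_0=1$, $\beta=1/2$, with the sample sizes $n_k$, $m_{k,j}$ and the number of epochs $K=K(\epsilon)$ specified in the context. Then, with probability at least $1-\delta$, the total number of samples it utilizes is $$\widetilde{\mathcal O}_{\kappa_{\mathcal E},\ln(1/\delta)}\Big(\frac{D_L^2}{\epsilon^2}+\min\Big\{\frac{D_L^6}{\epsilon^3},\ \frac{D_L^3}{(1-\gamma)^3}\Big\}\Big),$$ where the second term in the minimum is $+\infty$ if $\gamma=1$.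
   Context: $\widetilde{\mathcal O}_{\kappa_{\mathcal E},\ln(1/\delta)}$ hides polylogarithmic factors and factors depending on $\kappa_{\mathcal E}$ and $\ln(1/\delta)$. **Quadratically smoothable space.** $(\mathcal E,\|\cdot\|)$ is quadratically smoothable if it is a real separable Banach space and there are a norm $\|\cdot\|_+$ on $\mathcal E$ and constants $B,C\ge1$ such that, for all $x,y\in\mathcal E$, $\|x\|\le\|x\|_+\le C\|x\|$, the map $x\mapsto\|x\|_+^2$ is continuously Fréchet differentiable, and $\|x+y\|_+^2\le\|x\|_+^2+D(\|\cdot\|_+^2)(x)[y]+B\|y\|_+^2$ (here $D(\|\cdot\|_+^2)(x)[y]$ is the Fréchet derivative at $x$ in direction $y$). A witness $(\|\cdot\|_+,B,C)$ is fixed and $\kappa_{\mathcal E}:=BC^2$. Random elements are Bochner integrable. **Oracle.** $(x,\xi)\mapsto\tau(x;\xi)$ is jointly measurable; seeds $\xi\sim\mathcal D$ are drawn i.i.d. and independently of the past. $[m]:=\{1,\dots,m\}$. **MoME$(\epsilon',\delta',x)$** (median of means): with $n=\lceil27/\epsilon'^2\rceil$ and $q=\lceil18\ln(1/\delta')\rceil$, draw $nq$ fresh samples $\tau(x;\xi_i)$, split them into $q$ groups of size $n$, let $\hat\eta_1,\dots,\hat\eta_q$ be the group averages, let $r_i=\inf\{r\ge0:\#\{j\in[q]:\|\hat\eta_j-\hat\eta_i\|\le r\}>q/2\}$, and return $\hat\eta_{i_*}$ with $i_*$ the smallest minimizer of $r_i$. **VR-GHAL.** Parameters $x_0,\beta,\delta,\bar\gamma,K$.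 Set $\epsilon_0=1$, $\bar\lambda_0=1$, $\delta_0=(1-\beta)\delta/\beta$, and $\epsilon_k=\beta\epsilon_{k-1}$, $\bar\lambda_k=\beta\bar\lambda_{k-1}$, $\delta_k=\beta\delta_{k-1}$, $\lambda_k=\bar\lambda_k/(1+\bar\lambda_k)$, $J_k=\lceil\ln\beta/\ln((1-\lambda_k)\bar\gamma)\rceil$. Let $\hat x_0=x_0$, $\widetilde T_{0,0}=\mathrm{MoME}(\epsilon_1/2,\delta_1/2,\hat x_0)$. For epochs $k=1,\dots,K$: set $y_0=\hat x_{k-1}$; for $j=0,\dots,J_k-1$ set $y_{j+1}=\lambda_ky_0+(1-\lambda_k)\widetilde T_{k-1,j}$ and compute $\widetilde T_{k-1,j+1}$ (below); then set $\hat x_k=y_{J_k}$ and $\widetilde T_{k,0}=\mathrm{MoME}(\epsilon_{k+1}/2,\delta_{k+1}/2,\hat x_k)$. Output $\hat x_K$. **Clipped recursive estimator.** For $j\ge1$ and $\ell\in[n_k]$, draw i.i.d. copies (given the past) $\Delta_{k,j}^{(\ell)}=\frac1{m_{k,j}}\sum_{i=1}^{m_{k,j}}(\tau(y_j;\xi_i)-\tau(y_{j-1};\xi_i))$ with $\xi_i$ i.i.d. from $\mathcal D$ (the same seed is used at $y_j$ and $y_{j-1}$), and set $$\widetilde T_{k-1,j}=\widetilde T_{k-1,j-1}+\frac1{n_k}\sum_{\ell=1}^{n_k}\min\Big\{1,\frac{\bar\gamma\|y_j-y_{j-1}\|}{\|\Delta_{k,j}^{(\ell)}\|}\Big\}\Delta_{k,j}^{(\ell)}$$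 (a summand is $0$ when $\Delta_{k,j}^{(\ell)}=0$). **Sample sizes and number of epochs.** With $\widetilde R_{k-1}=\|\widetilde T_{k-1,0}-\hat x_{k-1}\|$ and $\rho_k=\bar\gamma(1-\lambda_k)$, $$n_k=\max\Big\{1,\Big\lceil\frac{2(1-\lambda_k)\bar\gamma\widetilde R_{k-1}\ln(4/\delta_k)}{3\epsilon_k}\Big\rceil\Big\},\qquad m_{k,j}=\Big\lceil\frac{4\widetilde R_{k-1}^2}{\epsilon_k^2(1-\rho_k)^2}\Big\rceil .$$ $K$ is the smallest positive integer with $K\ge\lceil\max_{p\in\{0,1,2,5/2\}}\{L_p+p\log_{1/\beta}L_p+c_\beta\}\rceil$, where $c_\beta$ is a suitable constant depending only on $\beta$ (chosen large enough that the output satisfies $\|T(\hat x_K)-\hat x_K\|\le\epsilon$ with probability at least $1-\delta$), $L_p=\max\{1,\log_{1/\beta}(8A_p/\epsilon)\}$, and $A_0=\|T(x_0)-x_0\|+\beta\epsilon_0\sqrt{\kappa_{\mathcal E}}\sigma/2$, $A_1=2\bar\lambda_0\|x_*-x_0\|+\beta\epsilon_0\sqrt{\kappa_{\mathcal E}}\sigma/2$, $A_2=\epsilon_0(C+\sqrt{\kappa_{\mathcal E}}\sigma/2+a_0)$, $A_{5/2}=(4\sqrt2/5)\epsilon_0a_1$, with $a_0=\sqrt{L^2+\gamma^2}\sqrt{\kappa_{\mathcal E}}\big(1+3\sqrt{2\kappa_{\mathcal E}}\sqrt{\ln(4/((1-\beta)\delta))}\big)$ and $a_1=3\kappa_{\mathcal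 E}\sqrt{2(L^2+\gamma^2)\ln(1/\beta)}$.
   Formalization: The hidden factor may also depend on a lower bound c>0 (arbitrary) for both D_L and D_L/ε; without it the bound fails: for T(x)=tx, x_0=x_*=0, σ=L=γ=t→0, ε=1, the rate tends to 0 but at least one sample is always drawn. *)

(* Defs.v *)
From HB Require Import structures.
From mathcomp Require Export all_boot all_order all_algebra.
From mathcomp Require Export all_classical all_reals all_analysis.

Set Implicit Arguments.
Unset Strict Implicit.
Unset Printing Implicit Defensive.

Import Order.TTheory GRing.Theory Num.Theory.
Import numFieldNormedType.Exports.

Local Open Scope classical_set_scope.
Local Open Scope ring_scope.

Definition borel {R : realType} (E : normedModType R) :=
  g_sigma_algebraType (@open E).

Definition separable_space (T : topologicalType) : Prop :=
  exists2 S : set T, countable S & dense S.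

Definition is_norm {R : realType} {E : normedModType R} (N : E -> R) : Prop :=
  [/\ forall x y, N (x + y) <= N x + N y,
      forall (a : R) x, N (a *: x) = `|a| * N x &
      forall x, N x = 0 -> x = 0].

Section FrechetC1.
Context {R : realType} {E : normedModType R}.
Implicit Type f : E -> R^o.

(* Continuity of the derivative is with respect to the operator norm. *)
Definition continuously_differentiable f : Prop :=
  (forall x, differentiable f x) /\
  (forall x (e : R), 0 < e ->
     \forall y \near x, forall h, `|'d f y h - 'd f x h| <= e * `|h|).

End FrechetC1.

Definition smoothable_by {R : realType} {E : completeNormedModType R}
    (N : E -> R) (B C : R) : Prop :=
  let sq : E -> R^o := fun x => N x ^+ 2 in
  [/\ is_norm N, 1 <= B, 1 <= C,
      forall x, `|x| <= N x <= C * `|x| &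
      continuously_differentiable sq /\
      forall x y, sq (x + y) <= sq x + 'd sq x y + B * sq y].

Section Bochner.
Context {d : measure_display} {T : measurableType d} {R : realType}.
Context {E : normedModType R}.
Variable mu : {measure set T -> \bar R}.

Definition simple_function (s : T -> E) : Prop :=
  finite_set (range s) /\ forall v, measurable (s @^-1` [set v]).

Definition simple_integral (s : T -> E) : E :=
  \sum_(v \in range s) fine (mu (s @^-1` [set v])) *: v.

(* Used for a probability [mu] and a separable [E], where Borel measurability
   is strong measurability. *)
Definition bochner_integral (f : T -> E) (v : E) : Prop :=
  measurable_fun setT (f : T -> borel E) /\
  exists s : nat -> T -> E,
    [/\ forall n, simple_function (s n),
        (fun n => \int[mu]_t (`|f t - s n t|)%:E)%E @ \oo --> 0%E &
        (fun n => simple_integral (s n)) @ \oo --> v].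

End Bochner.

Section Oracle.
Context {R : realType} {E : completeNormedModType R}.
Context {d : measure_display} {Xi : measurableType d}.

Definition jointly_measurable (tau : E -> Xi -> E) : Prop :=
  measurable_fun setT (fun p : borel E * Xi => tau p.1 p.2 : borel E).

Definition stochastic_oracle (D : probability Xi R) (tau : E -> Xi -> E)
    (T : E -> E) (sigma L : R) : Prop :=
  [/\ jointly_measurable tau,
      forall x, bochner_integral D (tau x) (T x),
      forall x, (\int[D]_xi (`|tau x xi - T x| ^+ 2)%:E <= (sigma ^+ 2)%:E)%E &
      forall x y, (\int[D]_xi (`|tau x xi - tau y xi| ^+ 2)%:E
                   <= (L ^+ 2 * `|x - y| ^+ 2)%:E)%E].

Definition iid_seeds {d'} {Omega : measurableType d'}
    (P : probability Omega R) (D : probability Xi R) (xi : nat -> Omega -> Xi) :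
    Prop :=
  [/\ forall i, measurable_fun setT (xi i),
      forall i A, measurable A -> P (xi i @^-1` A) = D A &
      forall (I : seq nat) (A : nat -> set Xi), uniq I ->
        (forall i, measurable (A i)) ->
        P (\bigcap_(i in [set` I]) (xi i @^-1` A i)) =
        (\prod_(i <- I) P (xi i @^-1` A i))%E].

End Oracle.

Definition ceiln {R : realType} (x : R) : nat :=
  absz (Num.max 0 (Num.ceil x)).

Definition shift {X : Type} (s : nat -> X) (n : nat) : nat -> X :=
  fun i => s (n + i)%N.

Section Schedule.
Context {R : realType}.
Variables beta delta gbar : R.
Implicit Types (k : nat) (Rt : R).

(* [eps_ 0 = lbar_ 0 = 1]. *)
Definition eps_ k : R := beta ^+ k.
Definition lbar_ k : R := beta ^+ k.
Definition delta_ k : R := beta ^+ k * ((1 - beta) * delta / beta).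
Definition lambda_ k : R := lbar_ k / (1 + lbar_ k).
Definition rho_ k : R := gbar * (1 - lambda_ k).
Definition J_ k : nat := ceiln (ln beta / ln ((1 - lambda_ k) * gbar)).

(* [Rt] is the norm of the estimated residual at the start of epoch [k]. *)
Definition n_ k Rt : nat :=
  maxn 1 (ceiln (2 * (1 - lambda_ k) * gbar * Rt * ln (4 / delta_ k)
                 / (3 * eps_ k))).
Definition m_ k Rt : nat :=
  ceiln (4 * Rt ^+ 2 / (eps_ k ^+ 2 * (1 - rho_ k) ^+ 2)).

End Schedule.

Section Algorithm.
Context {R : realType} {E : completeNormedModType R} {Xi : Type}.
Variable tau : E -> Xi -> E.
Implicit Types (x y : E) (s : nat -> Xi).

(* The algorithms are deterministic functions of a stream [s] of seeds, which
   they consume from the front. *)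

Definition mome_n (e : R) : nat := ceiln (27 / e ^+ 2).
Definition mome_q (dl : R) : nat := ceiln (18 * ln (1 / dl)).
Definition mome_cost (e dl : R) : nat := (mome_n e * mome_q dl)%N.

Definition mome (e dl : R) x s : E :=
  let n := mome_n e in
  let q := mome_q dl in
  let eta j := n%:R^-1 *: \sum_(i < n) tau x (s (j * n + i)%N) in
  let r i := inf [set t : R | 0 <= t /\
      (q < 2 * count (fun j => (`|eta j - eta i| <= t)%R) (iota 0 q))%N] in
  (* [find] returns the smallest minimizer of [r] *)
  eta (find (fun i => all (fun j => r i <= r j) (iota 0 q)) (iota 0 q)).

Definition clip (c : R) x : E := Num.min 1 (c / `|x|) *: x.

Definition mean_difference (m : nat) y y' s : E :=
  m%:R^-1 *: \sum_(i < m) (tau y (s i) - tau y' (s i)).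

Variables (x0 : E) (beta delta gbar : R).

(* [inner k z T0 n m s j] is the pair of the [j]-th iterate and the [j]-th
   estimate in epoch [k] started at [z] with estimate [T0]; each step takes
   [n * m] fresh seeds. *)
Fixpoint inner (k : nat) (z T0 : E) (n m : nat) s (j : nat) : E * E :=
  match j with
  | 0 => (z, T0)
  | i.+1 =>
    let: (y, t) := inner k z T0 n m s i in
    let y' := lambda_ beta k *: z + (1 - lambda_ beta k) *: t in
    (y', t + n%:R^-1 *: \sum_(l < n)
           clip (gbar * `|y' - y|)
                (mean_difference m y' y (shift s ((i * n + l) * m)%N)))
  end.

(* [st_seeds] counts the seeds drawn so far, [st_samples] the values
   [tau y xi] queried so far (two per seed in the inner loop). *)
Record state := State {
  st_x : E; st_T : E; st_seeds : nat; st_samples : nat }.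

Definition restart (k : nat) x s (seeds samples : nat) : state :=
  let e := eps_ beta k.+1 / 2 in
  let dl := delta_ beta delta k.+1 / 2 in
  State x (mome e dl x (shift s seeds))
    (seeds + mome_cost e dl) (samples + mome_cost e dl).

Definition epoch (k : nat) s (st : state) : state :=
  let Rt := `|st_T st - st_x st| in
  let n := n_ beta delta gbar k Rt in
  let m := m_ beta gbar k Rt in
  let J := J_ beta gbar k in
  let y := (inner k (st_x st) (st_T st) n m (shift s (st_seeds st)) J).1 in
  restart k y s (st_seeds st + J * (n * m)) (st_samples st + 2 * (J * (n * m))).

Fixpoint vr_ghal s (k : nat) : state :=
  match k with
  | 0 => restart 0 x0 s 0 0
  | i.+1 => epoch i.+1 s (vr_ghal s i)
  end.

End Algorithm.

Section Epochs.
Context {R : realType}.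
(* [res0] and [dist0] stand for [`|T x0 - x0|] and [`|xstar - x0|]. *)
Variables (beta cbeta delta epsilon gamma L sigma B C res0 dist0 : R).

Let kappa : R := B * C ^+ 2.

Definition a0 : R :=
  Num.sqrt (L ^+ 2 + gamma ^+ 2) * Num.sqrt kappa *
  (1 + 3 * Num.sqrt (2 * kappa) * Num.sqrt (ln (4 / ((1 - beta) * delta)))).
Definition a1 : R :=
  3 * kappa * Num.sqrt (2 * (L ^+ 2 + gamma ^+ 2) * ln (1 / beta)).
Definition A0 : R := res0 + beta * Num.sqrt kappa * sigma / 2.
Definition A1 : R := 2 * dist0 + beta * Num.sqrt kappa * sigma / 2.
Definition A2 : R := C + Num.sqrt kappa * sigma / 2 + a0.
Definition A52 : R := 4 * Num.sqrt 2 / 5 * a1.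

Definition logb (x : R) : R := ln x / ln (1 / beta).

(* For [A = 0] the library's [ln 0 = 0] gives [epochs_L 0 = 1], as does the
   convention [ln 0 = -oo]. *)
Definition epochs_L (A : R) : R := Num.max 1 (logb (8 * A / epsilon)).
Definition epochs_term (p A : R) : R :=
  epochs_L A + p * logb (epochs_L A) + cbeta.

Definition num_epochs : nat :=
  maxn 1 (ceiln
    (Num.max (Num.max (epochs_term 0 A0) (epochs_term 1 A1))
             (Num.max (epochs_term 2 A2) (epochs_term (5 / 2) A52)))).

End Epochs.

(* [cbeta] is large enough for the accuracy guarantee of the algorithm run with
   decay factor [beta] and clipping level [gamma], for every problem. *)
Definition sufficient_epochs_constant (R : realType) (beta cbeta : R) : Prop :=
  forall (E : completeNormedModType R) (N : E -> R) (B C : R)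
    (d : measure_display) (Xi : measurableType d) (D : probability Xi R)
    (T : E -> E) (tau : E -> Xi -> E) (x0 xstar : E)
    (gamma sigma L epsilon delta : R)
    (d' : measure_display) (Omega : measurableType d') (P : probability Omega R)
    (xi : nat -> Omega -> Xi),
  separable_space E -> smoothable_by N B C ->
  0 < gamma <= 1 -> gamma.-lipschitz T -> T xstar = xstar ->
  0 <= sigma -> 0 < L -> stochastic_oracle D tau T sigma L ->
  0 < epsilon -> 0 < delta < 1 ->
  iid_seeds P D xi ->
  let K := num_epochs beta cbeta delta epsilon gamma L sigma B C
             `|T x0 - x0| `|xstar - x0| in
  let xK w := st_x (vr_ghal tau x0 beta delta gamma (xi ^~ w) K) in
  ((1 - delta)%:E <= P [set w | (`|T (xK w) - xK w| <= epsilon)%R])%E.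

(* At [gamma = 1] the second term of the minimum is +oo. *)
Definition sample_rate {R : realType} (DL epsilon gamma : R) : R :=
  DL ^+ 2 / epsilon ^+ 2 +
  (if gamma == 1 then DL ^+ 6 / epsilon ^+ 3
   else Num.min (DL ^+ 6 / epsilon ^+ 3) (DL ^+ 3 / (1 - gamma) ^+ 3)).

(* Main.v *)
(* A clipped correction and the true increment of T both have norm at most
   gamma |y_j - y_{j-1}|, and quadratic smoothness makes the mean distance
   between them small.  Hence the norms of the errors made in one epoch are
   bounded variables with small conditional means, and a scalar exponential
   moment bound, iterated over the seeds, controls their sum: the triangle
   inequality suffices and no concentration of vector-valued martingales is
   needed.  With probability at least 1 - delta all estimates of epoch k are
   then accurate up to M eps_k, where M = O(D_L).

   On this event the lambda_k-averaging gives |x_k - x_*| <= |x_0 - x_*| + k M,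
   and since rho_k^{J_k} <= beta the estimated residual contracts, so that
   R_k <= 3 (k+1)^2 (|x_0 - x_*| + M) eps_k.  Therefore n_k = O(D_L k^3),
   m_k = O(D_L^2 k^4 / (1 - rho_k)^2) and J_k = O(1 / (1 - rho_k)), where
   1 / (1 - rho_k) <= min (2^(k+1), 1 / (1 - gamma)), while 2^K is at most
   D_L / epsilon up to logarithmic factors. *)

From HB Require Import structures.
(* Imported before [Defs] so that it does not shadow the [inE] of classical sets. *)
From mathcomp Require Import finmap.
Require Import Defs.
From mathcomp Require Import measurable_realfun lra ring zify.
Import Order.TTheory GRing.Theory Num.Theory.
Import numFieldNormedType.Exports.

Local Open Scope classical_set_scope.
Local Open Scope ring_scope.

Set Implicit Arguments.
Unset Strict Implicit.
Unset Printing Implicit Defensive.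

(** * Streams of independent seeds *)

(** The obstacle is that the sizes [n_] and [m_] depend on the random residual, so an epoch reads
    its seeds from a random position. The run is therefore studied as a function of one infinite
    stream of seeds. Replacing the tail of a stream by an independent copy ([splice]) turns
    conditioning on the past into Tonelli's theorem, and the seed counters of the run are stopping
    times, to which [strong_markov] applies. This asks for measurability of every quantity of the
    run; separability of [E] enters there. No conditional expectation is formed, and the law on
    streams is the image of [P].

    Each [delta_] is spent half on the median of means and half on the clipped steps; for beta = 1/2
    these budgets sum to less than delta.

    In the cost, [c] is a lower bound for D_L and for D_L / epsilon. Since D_L / c >= 1, every
    rounding and every additive constant becomes a multiple of D_L, and the logarithms stay bounded
    below. *)

Section Stream.
Context {d : measure_display} {Xi : measurableType d}.

Definition box (N : nat) (A : nat -> set Xi) : set (nat -> Xi) :=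
  [set s | forall i, (i < N)%N -> A i (s i)].

(** The finite-dimensional cylinders, a pi-system generating the product sigma-algebra of [stream]:
    measures are compared on it, and measurability into [stream] is checked on it. *)
Definition boxes : set (set (nat -> Xi)) :=
  [set C | exists N A, (forall i, measurable (A i)) /\ C = box N A].

Definition stream : measurableType boxes.-sigma :=
  [the measurableType _ of g_sigma_algebraType boxes].

Lemma measurable_box N A : (forall i, measurable (A i)) ->
  measurable (box N A : set stream).
Proof. by move=> mA; apply: sub_sigma_algebra; exists N, A. Qed.

Lemma boxT : box 0 (fun=> setT) = setT.
Proof. by apply/seteqP; split. Qed.

Lemma boxes_setI : setI_closed boxes.
Proof.
move=> _ _ [N [A [mA ->]]] [M [B [mB ->]]].
exists (maxn N M), (fun i => (if (i < N)%N then A i else setT) `&`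
                             (if (i < M)%N then B i else setT)); split.
  by move=> i; apply: measurableI; case: ifP.
apply/seteqP; split => [s [sA sB] i _|s sAB].
  by split; case: ifP => // ?; [exact: sA|exact: sB].
split=> i iN; have := sAB i; rewrite leq_max iN ?orbT => /(_ isT) [].
  by [].
by [].
Qed.

Lemma measurable_stream_coord i : measurable_fun [set: stream] (fun s => s i).
Proof.
move=> _ A mA; rewrite setTI.
have -> : (fun s : stream => s i) @^-1` A =
    box i.+1 (fun j => if j == i then A else setT).
  apply/seteqP; split => [s sA j _|s /(_ i (ltnSn i))]; last by rewrite eqxx.
  by case: eqP => // ->.
by apply: measurable_box => j; case: ifP.
Qed.

Lemma measurable_fun_stream {d'} {W : measurableType d'} (s : W -> stream) :
  (forall i, measurable_fun setT (fun w => s w i)) -> measurable_fun setT s.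
Proof.
move=> ms; apply: (@measurability _ _ W stream setT s boxes) => //.
move=> _ [_ [N [A [mA ->]]] <-]; rewrite setTI.
have -> : s @^-1` box N A = \bigcap_(i in `I_N) (s ^~ i @^-1` A i).
  by apply/seteqP; split => w h i; [apply: h|apply: h].
apply: bigcap_measurableType => i _; rewrite -[X in measurable X]setTI.
exact: ms.
Qed.

(** The past [s] up to time [n], continued by an independent future [s']: integrating over [s']
    alone is the conditional expectation given the first [n] seeds. *)
Definition splice (n : nat) (s s' : stream) : stream :=
  fun i => if (i < n)%N then s i else s' (i - n)%N.

Lemma shift_splice n s s' : shift (splice n s s') n = s'.
Proof.
by apply/funext => i; rewrite /shift /splice ltnNge leq_addr/= addKn.
Qed.

Lemma measurable_splice n :
  measurable_fun setT (fun p : stream * stream => splice n p.1 p.2).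
Proof.
apply: measurable_fun_stream => i; rewrite /splice; case: (i < n)%N => /=.
  exact: (measurableT_comp (measurable_stream_coord i) measurable_fst).
exact: (measurableT_comp (measurable_stream_coord _) measurable_snd).
Qed.

Lemma measurable_shift {d'} {W : measurableType d'} (s : W -> stream)
    (n : nat) : measurable_fun setT s ->
  measurable_fun setT (fun w => shift (s w) n : stream).
Proof.
move=> ms; apply: measurable_fun_stream => i.
exact: (measurableT_comp (measurable_stream_coord _) ms).
Qed.

Context {R : realType}.

(** The infinite product measure, characterized by its values on boxes; [stream_law] obtains such a
    [mu] from the seeds of the theorem. *)
Definition iid_law (D : probability Xi R) (mu : probability stream R) :=
  forall N A, (forall i, measurable (A i)) ->
    mu (box N A) = (\prod_(i < N) D (A i))%E.

Variables (D : probability Xi R) (mu : probability stream R).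
Hypothesis muD : iid_law D mu.

Lemma box_splice n N A (p : stream * stream) :
  box (n + N) A (splice n p.1 p.2) <->
  (box n A `*` box N (fun i => A (n + i)%N)) p.
Proof.
split=> [h|[h1 h2] i iN].
  split=> i iN /=.
    by have := h i (ltn_addr _ iN); rewrite /splice iN.
  have := h (n + i)%N; rewrite ltn_add2l => /(_ iN).
  by rewrite /splice ltnNge leq_addr/= addKn.
rewrite /splice; case: ltnP => ni; first exact: h1.
have := h2 (i - n)%N; rewrite /= subnKC//; apply.
by rewrite ltn_subLR.
Qed.

(** By uniqueness on the pi-system of boxes. A box of length [N] is padded to length [n + N], so
    that its preimage under [splice] is a product of two boxes, one for each stream. *)
Lemma splice_preserves n (B : set stream) : measurable B ->
  (mu \x mu)%E ((fun p => splice n p.1 p.2) @^-1` B) = mu B.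
Proof.
pose sp := fun p : stream * stream => splice n p.1 p.2.
have msp : measurable_fun setT sp := @measurable_splice n.
pose psp := [the {measure set stream -> \bar R} of
  pushforward (mu \x mu)%E sp].
have box0 (i : nat) : boxes ((fun=> setT) i : set stream).
  by exists 0%N, (fun=> setT); split => //; rewrite boxT.
have cov : \bigcup_(i : nat) ((fun=> setT) i) = [set: stream].
  by apply/seteqP; split => // s _; exists 0%N.
move=> mB; apply/esym.
refine (@measure_unique _ R stream boxes (fun=> setT) erefl boxes_setI box0 cov
  mu (psp msp) _ _ B mB).
- move=> _ [N [A [mA ->]]].
  pose A' i := if (i < N)%N then A i else setT.
  have mA' i : measurable (A' i) by rewrite /A'; case: ifP.
  have -> : box N A = box (n + N) A'.
    apply/seteqP; split => s h i.
      by rewrite /A'; case: ifP => // iN _; exact: h.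
    by move=> iN; have := h i (leq_trans iN (leq_addl _ _)); rewrite /A' iN.
  rewrite /psp/= /pushforward.
  have -> : sp @^-1` box (n + N) A' = box n A' `*` box N (fun i => A' (n + i)%N).
    by apply/seteqP; split => p /= /(box_splice n N A' p).
  rewrite product_measure1E; [|exact: measurable_box|exact: measurable_box].
  have e1 := muD (n + N)%N mA'; have e2 := muD n mA'.
  have e3 := muD N (fun i => mA' (n + i)%N).
  apply: etrans e1 _; rewrite big_split_ord/=.
  by apply: esym; apply: etrans (congr2 *%E e2 e3) _.
- move=> _; have e : mu setT = 1%E by exact: probability_setT.
  by apply: (eq_ind_r (fun x => x < +oo)%E _ e); exact: ltry.
Qed.

(** The tower property at time [n]. It is stated for nonnegative functions, so that Tonelli applies
    and no integrability has to be carried along. *)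
Lemma integral_splice n (f : stream -> \bar R) :
  measurable_fun setT f -> (forall s, 0 <= f s)%E ->
  (\int[mu]_s f s = \int[mu]_s \int[mu]_s' f (splice n s s'))%E.
Proof.
move=> mf f0.
have msp := @measurable_splice n.
rewrite -[RHS](fubini_tonelli1 (fun p => f (splice n p.1 p.2)))//; last first.
  exact: measurableT_comp.
rewrite -[RHS](@ge0_integral_pushforward _ _ _ _ _ _ msp _ setT f)//.
apply: eq_measure_integral => B mB _; exact/esym/splice_preserves.
Qed.

Lemma integral_head (f : Xi -> \bar R) :
  measurable_fun setT f -> (forall z, 0 <= f z)%E ->
  (\int[mu]_s f (s 0%N) = \int[D]_z f z)%E.
Proof.
move=> mf f0; have m0 := measurable_stream_coord 0.
rewrite -[LHS](@ge0_integral_pushforward _ _ _ _ _ _ m0 _ setT f)//.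
apply: eq_measure_integral => A mA _; rewrite /pushforward.
have e : (fun s : stream => s 0%N) @^-1` A = box 1 (fun=> A).
  by apply/seteqP; split => [s sA [|]//|s /(_ 0%N)]; exact.
transitivity (mu (box 1 (fun=> A))); first by congr (mu _).
by apply: etrans (muD 1 (fun=> mA)) _; rewrite big_ord1.
Qed.

End Stream.
Arguments stream {d} Xi.

(** The level sets of [g] form a countable partition. This handles random sample sizes, random seed
    positions and the group selected by [mome]. *)
Lemma measurable_fun_select {d d'} {W : measurableType d} {U : measurableType d'}
    (g : W -> nat) (h : nat -> W -> U) :
  measurable_fun setT g -> (forall n, measurable_fun setT (h n)) ->
  measurable_fun setT (fun w => h (g w) w).
Proof.
move=> mg mh _ A mA; rewrite setTI.
have -> : (fun w => h (g w) w) @^-1` A =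
    \bigcup_n ((g @^-1` [set n]) `&` (h n @^-1` A)).
  by apply/seteqP; split => [w wA|w [n _ [<-]]//]; exists (g w).
apply: bigcup_measurable => n _; apply: measurableI.
  by rewrite -[X in measurable X]setTI; exact: mg.
by rewrite -[X in measurable X]setTI; exact: mh.
Qed.

(** * Conditioning on the seeds already drawn *)

Section Freshness.
Context {d : measure_display} {Xi : measurableType d} {R : realType}.
Variables (D : probability Xi R) (mu : probability (stream Xi) R).
Hypothesis muD : iid_law D mu.
Local Notation stream := (stream Xi).

Definition agree (n : nat) (s s' : stream) := forall i, (i < n)%N -> s i = s' i.

Lemma agree_splice n s s' : agree n s (splice n s s').
Proof. by move=> i ni; rewrite /splice ni. Qed.

Arguments agree_splice : clear implicits.

Lemma agreeS m n s s' : (m <= n)%N -> agree n s s' -> agree m s s'.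
Proof. by move=> mn h i im; apply: h; exact: leq_trans mn. Qed.

Arguments agreeS {m n s s'} mn h : rename.

(** The supermartingale argument behind both tail bounds. Factor [p] reads the seeds below
    [p.+1 * m] and has conditional mean at most [c p] given those below [p * m]; splicing before the
    last block pulls out all earlier factors, however they depend on each other. *)
Lemma sequential_prod (g : nat -> stream -> R) (c : nat -> R) (m N : nat) :
  (forall p, measurable_fun setT (g p)) ->
  (forall p s, 0 <= g p s) -> (forall p, 0 <= c p) ->
  (forall p s s', agree (p.+1 * m) s s' -> g p s = g p s') ->
  (forall p s, (p < N)%N ->
    (\int[mu]_s' (g p (splice (p * m) s s'))%:E <= (c p)%:E)%E) ->
  (\int[mu]_s (\prod_(p < N) g p s)%:E <= (\prod_(p < N) c p)%:E)%E.
Proof.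
move=> mg g0 c0 gm gc.
have mprod n : measurable_fun setT (fun s => \prod_(p < n) g p s).
  elim: n => [|n IH].
    rewrite (_ : (fun s => _) = cst 1)//.
    by apply/funext => s; rewrite big_ord0.
  rewrite (_ : (fun s => _) = (fun s => (\prod_(p < n) g p s) * g n s)).
    exact: measurable_funM.
  by apply/funext => s; rewrite big_ord_recr.
have prod0 n s : 0 <= \prod_(p < n) g p s by apply: prodr_ge0.
elim: N gc => [|n IH] gc.
  under eq_integral do rewrite big_ord0.
  by rewrite integral_cst//= probability_setT mule1 big_ord0.
rewrite (integral_splice muD (n * m)); [|exact/measurable_EFinP|
  by move=> s; rewrite lee_fin].
have step s : (\int[mu]_s' (\prod_(p < n.+1) g p (splice (n * m) s s'))%:E <=
    (\prod_(p < n) g p s)%:E * (c n)%:E)%E.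
  have e s' : (\prod_(p < n.+1) g p (splice (n * m) s s'))%:E =
      ((\prod_(p < n) g p s)%:E * (g n (splice (n * m) s s'))%:E)%E.
    rewrite -EFinM big_ord_recr/=; congr (_ * _)%:E.
    apply: eq_bigr => p _; apply/esym/gm.
    apply: (agreeS _ (agree_splice (n * m) s s')); rewrite leq_mul2r.
    by rewrite (ltn_ord p) orbT.
  under eq_integral do rewrite e.
  rewrite ge0_integralZl_EFin//.
  - by apply: lee_wpmul2l; [rewrite lee_fin|exact: gc].
  - by move=> s' _; rewrite lee_fin.
  - apply/measurable_EFinP; apply: measurableT_comp => //.
    exact: (measurable_fun_pair2 s (@measurable_splice _ Xi (n * m))).
apply: (@le_trans _ _ (\int[mu]_s ((\prod_(p < n) g p s)%:E * (c n)%:E))%E).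
  apply: ge0_le_integral => //.
  - by move=> s _; apply: integral_ge0 => s' _; rewrite lee_fin.
  - apply: (measurable_fun_fubini_tonelli_F
      (fun p => (\prod_(q < n.+1) g q (splice (n * m) p.1 p.2))%:E)).
      by apply/measurable_EFinP; apply: (measurableT_comp (mprod n.+1));
         exact: measurable_splice.
    by move=> ?; rewrite lee_fin.
  - by apply: emeasurable_funM => //; exact/measurable_EFinP.
rewrite ge0_integralZr//; [|exact/measurable_EFinP|
  by move=> s _; rewrite lee_fin|by rewrite lee_fin].
rewrite big_ord_recr/= EFinM; apply: lee_wpmul2r; first by rewrite lee_fin.
by apply: IH => p s pn; apply: gc; exact: ltnW.
Qed.

(* [X] and [Nn] depend only on the first [Nn s] seeds, so the seeds drawn after
   the random time [Nn] are independent of [X]. *)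
Lemma strong_markov {dW} {W : measurableType dW} (X : stream -> W)
    (Nn : stream -> nat) (B : set (W * stream)) (q : R) :
  measurable_fun setT X -> measurable_fun setT Nn ->
  (forall s s', agree (Nn s) s s' -> X s' = X s /\ Nn s' = Nn s) ->
  measurable B -> (forall w, (mu (xsection B w) <= q%:E)%E) ->
  (mu [set s | B (X s, shift s (Nn s))] <= q%:E)%E.
Proof.
move=> mX mN stop mB Bq.
have q0 : 0 <= q.
  by rewrite -lee_fin; apply: le_trans (Bq point); exact: measure_ge0.
have mN1 n : measurable [set s | Nn s = n].
  by rewrite -[X in measurable X]setTI; exact: (mN measurableT [set n]).
have mXs n : measurable_fun setT (fun s => (X s, shift s n : stream)).
  by apply: measurable_fun_pair => //; exact: measurable_shift.
pose E n := [set s | Nn s = n] `&` [set s | B (X s, shift s n)].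
have mE n : measurable (E n).
  apply: measurableI => //; rewrite -[X in measurable X]setTI.
  exact: mXs.
have -> : [set s | B (X s, shift s (Nn s))] = \bigcup_n E n.
  by apply/seteqP; split => [s /= Bs|s [n _ [/= <-]]//]; exists (Nn s).
rewrite measure_semi_bigcup//; last 2 first.
  by apply/trivIsetP => i j _ _ ij; apply/seteqP; split => // s [[/= ei _] [/= ej _]];
    rewrite -ei -ej eqxx in ij.
  exact: bigcup_measurable.
(* On [E n] the shift is by the fixed amount [n]; after splicing at [n], the inner integral over the
   fresh part is the measure of a section of [B]. *)
have step n : (mu (E n) <= q%:E * mu [set s | Nn s = n])%E.
  rewrite -[X in (mu X <= _)%E](setIT (E n)) -integral_indic//.
  rewrite (integral_splice muD n); [|exact/measurable_EFinP/measurable_indic|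
    by move=> s; rewrite lee_fin].
  rewrite -[X in (_ <= _ * mu X)%E](setIT [set s | Nn s = n]) -integral_indic//.
  rewrite -ge0_integralZl_EFin//; last exact/measurable_EFinP/measurable_indic.
  apply: ge0_le_integral => //.
  - by move=> s _; apply: integral_ge0 => s' _; rewrite lee_fin.
  - apply: (measurable_fun_fubini_tonelli_F
      (fun p => (\1_(E n) (splice n p.1 p.2))%:E)).
      apply/measurable_EFinP.
      have mi : measurable_fun setT (\1_(E n) : _ -> R) by exact: measurable_indic.
      exact: (measurableT_comp mi (measurable_splice n)).
    by move=> ?; rewrite lee_fin.
  - apply: emeasurable_funM => //; exact/measurable_EFinP/measurable_indic.
  move=> s _; have [sn|sn] := pselect (Nn s = n).
    rewrite [X in (_ <= _ * X)%E](_ : _ = 1%E) ?mule1; last first.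
      by rewrite indicE mem_set.
    have -> : (\int[mu]_s' (\1_(E n) (splice n s s'))%:E)%E =
        mu (xsection B (X s)).
      rewrite -[in RHS](setIT (xsection _ _)) -integral_indic//; last first.
        exact: measurable_xsection.
      apply: eq_integral => s' _; rewrite !indicE; congr ((nat_of_bool _)%:R%:E).
      have [|eX eN] := stop s (splice n s s').
        by rewrite sn; exact: agree_splice.
      apply/idP/idP; rewrite !inE/= /xsection/= ?inE.
        by move=> [_ /=]; rewrite eX shift_splice.
      by move=> Bs; split => //=; rewrite ?eN ?eX ?shift_splice.
    exact: Bq.
  (* The first [n] seeds decide whether [Nn] equals [n], so no continuation of such an [s] lies in
     [E n]. *)
  rewrite integral0_eq; first by rewrite mule_ge0// lee_fin.
  move=> s' _; rewrite indicE.
  have [|] := boolP (splice n s s' \in E n); last by [].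
  rewrite inE => -[/= eN _]; exfalso; apply: sn.
  have [|_ ->] := stop (splice n s s') s; last exact: eN.
  by rewrite eN => i ni; rewrite -(agree_splice n s s' i ni).
apply: (@le_trans _ _ (\sum_(0 <= n <oo) (q%:E * mu [set s | Nn s = n]))%E).
  by apply: lee_nneseries => [n _ _|n _]; [exact: measure_ge0|exact: step].
rewrite nneseriesZl//.
have <- : mu (\bigcup_n [set s | Nn s = n]) =
    (\sum_(0 <= n <oo) mu [set s | Nn s = n])%E.
  rewrite measure_semi_bigcup//; last exact: bigcup_measurable.
  by apply/trivIsetP => i j _ _ ij; apply/seteqP; split => // s [/= ei /= ej];
    rewrite -ei -ej eqxx in ij.
rewrite -[leRHS]mule1; apply: lee_wpmul2l; first by rewrite lee_fin.
by apply: probability_le1; apply: bigcup_measurable.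
Qed.

End Freshness.

(** * Borel measurability of the run *)

(** Measurability tested on open sets. In this form it composes with continuous maps defined on
    products, such as addition, without naming a sigma-algebra on the product; [open_meas_pair] is
    where separability pays for this. *)
Definition open_meas {d} {W : measurableType d} {T : topologicalType}
  (f : W -> T) := forall U : set T, open U -> measurable (f @^-1` U).

Section OpenMeas.
Context {d : measure_display} {W : measurableType d} {R : realType}.

Lemma open_meas_comp {T T' : topologicalType} (f : W -> T) (phi : T -> T') :
  continuous phi -> open_meas f -> open_meas (fun w => phi (f w)).
Proof. by move=> /continuousP cphi mf U oU; exact: (mf _ (cphi _ oU)). Qed.

(** By separability, an open set of the product is a countable union of open rectangles with centres
    in the two dense sets. *)
Lemma open_meas_pair {T1 T2 : pseudoPMetricType R} (f : W -> T1) (g : W -> T2) :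
  separable_space T1 -> separable_space T2 ->
  open_meas f -> open_meas g -> open_meas (fun w => (f w, g w)).
Proof.
move=> [S1 cS1 dS1] [S2 cS2 dS2] mf mg U oU.
(* Interiors are taken because a [ball] of a pseudometric type is only a neighbourhood of its
   centre. *)
pose rect (p : T1 * T2 * nat) : set (T1 * T2) :=
  (ball p.1.1 p.2.+1%:R^-1)° `*` (ball p.1.2 p.2.+1%:R^-1)°.
pose I := [set p : T1 * T2 * nat | (S1 `*` S2) p.1 /\ rect p `<=` U].
have cI : countable I.
  apply: (@sub_countable _ _ _ ((S1 `*` S2) `*` [set: nat])).
    by apply: subset_card_le => p [].
  by apply: countableX; [exact: countableX|exact: countableP].
have -> : (fun w => (f w, g w)) @^-1` U =
    \bigcup_(p in I) ((f @^-1` (ball p.1.1 p.2.+1%:R^-1)°) `&`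
                      (g @^-1` (ball p.1.2 p.2.+1%:R^-1)°)).
  apply/seteqP; split => [w /= Uw|w [p [_ pU] [h1 h2]]]; last exact: pU.
  have /nbhs_ballP[e/= e0 eU] : nbhs (f w, g w) U by exact: open_nbhs_nbhs.
  have [n ne] : exists n : nat, n.+1%:R^-1 < e / 2.
    have e20 : 0 < e / 2 by rewrite divr_gt0.
    have [n _ /(_ n (leqnn n)) h] := near_infty_natSinv_lt (PosNum e20).
    by exists n.
  have near (T : pseudoPMetricType R) (S : set T) (x : T) : dense S ->
      exists2 a, S a & (ball a n.+1%:R^-1)° x /\ ball x n.+1%:R^-1 a.
    move=> dS.
    have hx : nbhs x (ball x (n.+1%:R^-1 / 2)).
      by apply: nbhsx_ballx; rewrite divr_gt0.
    have [a [/= ia Sa]] : ((ball x (n.+1%:R^-1 / 2))° `&` S) !=set0.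
      apply: dS; last exact: open_interior.
      by exists x.
    have xa : ball x (n.+1%:R^-1 / 2) a by exact: interior_subset ia.
    exists a => //; split; last first.
      by apply: le_ball xa; rewrite ler_pdivrMr// ler_pMr// ler1n.
    apply/nbhs_ballP; exists (n.+1%:R^-1 / 2) => /=; first by rewrite divr_gt0.
    by move=> y xy; apply: ball_split (ball_sym xa) _.
  have [a Sa [ia xa]] := near _ _ (f w) dS1.
  have [b Sb [ib xb]] := near _ _ (g w) dS2.
  exists (a, b, n) => //; split => // -[y z] [/= /interior_subset ay
    /interior_subset bz].
  apply: eU; split => /=.
    by apply: (@le_ball _ _ _ (n.+1%:R^-1 + n.+1%:R^-1));
      [rewrite [leRHS]splitr lerD// ltW|exact: ball_triangle xa ay].
  by apply: (@le_ball _ _ _ (n.+1%:R^-1 + n.+1%:R^-1));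
      [rewrite [leRHS]splitr lerD// ltW|exact: ball_triangle xb bz].
rewrite bigcup_set_type; apply: countable_bigcupT_measurable => [|p].
  by rewrite (eq_countable (card_setT _)).
by apply: measurableI; [apply: mf|apply: mg]; exact: open_interior.
Qed.

Lemma open_meas_realP (f : W -> R) : open_meas f <-> measurable_fun setT f.
Proof.
split=> [mf|mf U oU].
  apply: (measurability _ (RGenOpens.measurableE R)).
  by move=> _ [_ [a [b ->] <-]]; rewrite setTI; apply: mf; exact: interval_open.
by rewrite -[X in measurable X]setTI; apply: mf => //; exact: open_measurable.
Qed.

Lemma separable_real : separable_space R.
Proof.
exists (@ratr R @` setT); last exact: dense_rat.
by apply: (@sub_countable _ _ _ [set: rat]) => //; exact: card_image_le.
Qed.

Context {E : normedModType R}.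

Lemma borelP (f : W -> E) :
  open_meas f <-> measurable_fun setT (f : W -> borel E).
Proof.
split=> [mf|mf U oU].
  apply: (@measurability _ _ W (borel E) setT f (@open E)) => //.
  by move=> _ [U oU <-]; rewrite setTI; exact: mf.
rewrite -[X in measurable X]setTI; apply: mf => //.
exact: sub_sigma_algebra.
Qed.

End OpenMeas.

Section OpenMeasAlg.
Context {d : measure_display} {W : measurableType d} {R : realType}.
Context {E : completeNormedModType R}.
Hypothesis sepE : separable_space E.
Implicit Types f g : W -> E.

Lemma open_meas_cst (x : E) : open_meas (fun _ : W => x).
Proof. by apply/borelP; exact: measurable_cst. Qed.

Lemma open_measD f g :
  open_meas f -> open_meas g -> open_meas (fun w => f w + g w).
Proof.
move=> mf mg.
apply: (@open_meas_comp _ _ _ _ (fun w => (f w, g w)) (fun z => z.1 + z.2)).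
  exact: add_continuous.
exact: open_meas_pair.
Qed.

Lemma open_measZ (a : W -> R) f : measurable_fun setT a ->
  open_meas f -> open_meas (fun w => a w *: f w).
Proof.
move=> /open_meas_realP ma mf.
apply: (@open_meas_comp _ _ _ _ (fun w => (a w, f w))
  (fun z : R^o * E => z.1 *: z.2)).
  exact: scale_continuous.
apply: open_meas_pair => //; exact: separable_real.
Qed.

Lemma open_measB f g :
  open_meas f -> open_meas g -> open_meas (fun w => f w - g w).
Proof.
move=> mf mg; apply: open_measD => //.
apply: (@open_meas_comp _ _ _ _ g (fun x : E => - x)) => //.
exact: opp_continuous.
Qed.

Lemma open_meas_sum (n : nat) (h : nat -> W -> E) :
  (forall i, open_meas (h i)) -> open_meas (fun w => \sum_(i < n) h i w).
Proof.
move=> mh; elim: n => [|n IH].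
  rewrite (_ : (fun w => _) = cst 0); first exact: open_meas_cst.
  by apply/funext => w; rewrite big_ord0.
rewrite (_ : (fun w => _) = (fun w => \sum_(i < n) h i w + h n w)).
  exact: open_measD.
by apply/funext => w; rewrite big_ord_recr.
Qed.

Lemma measurable_norm f :
  open_meas f -> measurable_fun setT (fun w => `|f w|).
Proof.
move=> mf; apply/open_meas_realP.
apply: (@open_meas_comp _ _ _ _ f (fun x : E => `|x|)) => //.
exact: norm_continuous.
Qed.

Lemma open_meas_select (g : W -> nat) (h : nat -> W -> E) :
  measurable_fun setT g -> (forall n, open_meas (h n)) ->
  open_meas (fun w => h (g w) w).
Proof.
move=> mg mh; apply/borelP.
by apply: (@measurable_fun_select _ _ W (borel E)) => // n; exact/borelP.
Qed.

(** The inverse is rewritten as a real power, known to be measurable; at zero both take the value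
    zero, the convention under which [clip] sends 0 to 0. *)
Lemma measurable_inv (f : W -> R) : (forall w, 0 <= f w) ->
  measurable_fun setT f -> measurable_fun setT (fun w => (f w)^-1).
Proof.
move=> f0 mf; rewrite (_ : (fun w => _) = (fun w => f w `^ (-1))); last first.
  by apply/funext => w; rewrite powR_inv1.
exact: (measurableT_comp (measurable_powR (-1)) mf).
Qed.

Lemma open_meas_clip (c : W -> R) f : measurable_fun setT c ->
  open_meas f -> open_meas (fun w => clip (c w) (f w)).
Proof.
move=> mc mf; apply: open_measZ => //; apply: measurable_minr => //.
apply: measurable_funM => //; apply: measurable_inv => //.
exact: measurable_norm.
Qed.

Lemma measurable_count (P : nat -> W -> bool) (r : seq nat) :
  (forall j, measurable_fun setT (P j)) ->
  measurable_fun setT (fun w => count (P ^~ w) r).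
Proof.
move=> mP; elim: r => [|x r IH] /=; first exact: measurable_cst.
apply: measurable_fun_addn => //.
have mb : measurable_fun setT nat_of_bool by [].
exact: (measurableT_comp mb (mP x)).
Qed.

Lemma measurable_all (P : nat -> W -> bool) (r : seq nat) :
  (forall j, measurable_fun setT (P j)) ->
  measurable_fun setT (fun w => all (P ^~ w) r).
Proof.
move=> mP; elim: r => [|x r IH] /=; first exact: measurable_cst.
exact: measurable_and.
Qed.

Lemma measurable_find (P : nat -> W -> bool) (r : seq nat) :
  (forall j, measurable_fun setT (P j)) ->
  measurable_fun setT (fun w => find (P ^~ w) r).
Proof.
move=> mP; elim: r => [|x r IH] /=; first exact: measurable_cst.
apply: measurable_fun_ifT => //.
have mS : measurable_fun setT S by [].
exact: (measurableT_comp mS IH).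
Qed.

Lemma measurable_natP (g : W -> nat) :
  (forall n, measurable [set w | (g w <= n)%N]) -> measurable_fun setT g.
Proof.
move=> mg _ A _; rewrite setTI.
have -> : g @^-1` A = \bigcup_(n in A) (g @^-1` [set n]).
  by apply/seteqP; split => [w wA|w [n nA /= ->]//]; exists (g w).
apply: bigcup_measurable => -[|n] _.
  rewrite (_ : _ @^-1` _ = [set w | (g w <= 0)%N]) //.
  by apply/seteqP; split => w /=; [move=> ->|rewrite leqn0 => /eqP].
rewrite (_ : _ @^-1` _ = [set w | (g w <= n.+1)%N] `\` [set w | (g w <= n)%N]).
  exact: measurableD.
apply/seteqP; split => w /=.
  by move=> ->; split => //; rewrite ltnn.
by move=> [h /negP]; rewrite -ltnNge => h'; apply/eqP; rewrite eqn_leq h h'.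
Qed.

(** A Galois connection, valid for negative [x] thanks to the truncation at zero. It yields both the
    measurability of the sample sizes and every lower bound on them. *)
Lemma ceiln_le (x : R) n : (ceiln x <= n)%N = (x <= n%:R).
Proof.
rewrite /ceiln -lez_nat gez0_abs ?le_max ?lexx// ge_max le0z_nat/=.
exact: (@ceil_le_int R x n).
Qed.

Lemma measurable_ceiln (f : W -> R) : measurable_fun setT f ->
  measurable_fun setT (fun w => ceiln (f w)).
Proof.
move=> mf; apply: measurable_natP => n.
rewrite (_ : mkset _ = f @^-1` `]-oo, n%:R]); last first.
  by apply/seteqP; split => w /=; rewrite ceiln_le in_itv.
by rewrite -[X in measurable X]setTI; exact: mf.
Qed.

End OpenMeasAlg.

(** * The median selection rule *)

Section MedianIndex.
Context {R : realType} {E : completeNormedModType R}.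
Implicit Types (q : nat) (eta : nat -> E).

(** The selection rule of [mome], detached from sampling and stated for an arbitrary sequence [eta];
    the shapes are kept so that [momeE] holds by conversion. *)
Definition radius_set q eta i : set R := [set t : R | 0 <= t /\
  (q < 2 * count (fun j => (`|eta j - eta i| <= t)%R) (iota 0 q))%N].

Definition median_radius q eta i : R := inf (radius_set q eta i).

Definition median_index q eta : nat :=
  find (fun i => all (fun j => median_radius q eta i <= median_radius q eta j)
                     (iota 0 q)) (iota 0 q).

(** A minimum over finitely many radii is attained, so [find] stops inside the list. For [q = 0] it
    would return 0, outside the range. *)
Lemma median_indexP q eta : (0 < q)%N ->
  (median_index q eta < q)%N /\
  forall j, (j < q)%N ->
    median_radius q eta (median_index q eta) <= median_radius q eta j.
Proof.
move=> q0; pose Q := fun i => all (fun j =>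
  median_radius q eta i <= median_radius q eta j) (iota 0 q).
have hasQ : has Q (iota 0 q).
  pose i0 := Ordinal q0.
  case: (@Order.TotalTheory.arg_minP _ _ _ i0 predT
    (fun i : 'I_q => median_radius q eta i)) => // i _ imin.
  apply/hasP; exists (val i); first by rewrite mem_iota/= add0n.
  by apply/allP => j; rewrite mem_iota/= add0n => jq; apply: (imin (Ordinal jq)).
have lt : (median_index q eta < q)%N.
  by rewrite -[X in (_ < X)%N](size_iota 0 q) -has_find.
split=> // j jq; have /allP := nth_find 0%N hasQ.
rewrite -/(median_index q eta) nth_iota// => /(_ j); apply.
by rewrite mem_iota/= add0n.
Qed.

Lemma eq_median_radius q eta eta' i : (i < q)%N ->
  (forall j, (j < q)%N -> eta j = eta' j) ->
  median_radius q eta i = median_radius q eta' i.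
Proof.
move=> iq e; rewrite /median_radius; congr (inf _).
rewrite /radius_set; apply/funext => t /=.
rewrite (@eq_in_count _ _ (fun j => `|eta' j - eta' i| <= t)) // => j.
by rewrite mem_iota/= add0n => jq; rewrite !e.
Qed.

Lemma eq_median_index q eta eta' :
  (forall j, (j < q)%N -> eta j = eta' j) ->
  median_index q eta = median_index q eta'.
Proof.
move=> e; apply: eq_in_find => i; rewrite mem_iota/= add0n => iq.
apply: eq_in_all => j; rewrite mem_iota/= add0n => jq.
by rewrite !(@eq_median_radius q eta eta').
Qed.

Lemma radius_set_up q eta i t t' :
  t <= t' -> radius_set q eta i t -> radius_set q eta i t'.
Proof.
move=> tt' [t0 h]; split; first exact: le_trans tt'.
apply: leq_trans h _; rewrite leq_mul2l/=; apply: sub_count => j /= h.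
exact: le_trans tt'.
Qed.

Lemma radius_set_nonempty q eta i : (0 < q)%N -> radius_set q eta i !=set0.
Proof.
move=> q0; exists (\sum_(j < q) `|eta j - eta i|); split.
  by apply: sumr_ge0.
rewrite (@eq_in_count _ _ predT).
  by rewrite count_predT size_iota mul2n -addnn -[X in (X < _)%N]addn0 ltn_add2l.
move=> j; rewrite mem_iota/= add0n => jq.
by rewrite (bigD1 (Ordinal jq))//= lerDl sumr_ge0.
Qed.

(** A strict bound on the infimum becomes an existential statement, which upward closedness of
    [radius_set] later restricts to countably many rational radii. *)
Lemma median_radius_lt q eta i a : (0 < q)%N ->
  median_radius q eta i < a <-> exists2 t, radius_set q eta i t & t < a.
Proof.
move=> q0; split=> [|[t rt]].
  by apply: inf_lt; exact: radius_set_nonempty.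
by apply: le_lt_trans; apply: ge_inf => //; exists 0 => ? [].
Qed.

End MedianIndex.

Section MeasurableMedian.
Context {d : measure_display} {W : measurableType d} {R : realType}.
Context {E : completeNormedModType R}.
Hypothesis sepE : separable_space E.

Lemma measurable_median_radius q (eta : nat -> W -> E) i :
  (forall j, open_meas (eta j)) ->
  measurable_fun setT (fun w => median_radius q (eta ^~ w) i).
Proof.
(* Without groups the radius set is empty and the radius is the constant [inf set0]. *)
move=> meta; have [->|q0] := posnP q.
  rewrite (_ : (fun w => _) = cst (inf set0)); first exact: measurable_cst.
  apply/funext => w; rewrite /median_radius; congr (inf _).
  by apply/seteqP; split => // t [].
apply: (measurability _ (RGenInftyO.measurableE R)).
move=> _ [_ [a ->] <-]; rewrite setTI.
rewrite (_ : _ @^-1` _ = \bigcup_(z in [set: rat])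
   [set w | radius_set q (eta ^~ w) i (ratr z) /\ ratr z < a]); last first.
  apply/seteqP; split => w /=.
    rewrite in_itv/= => /(median_radius_lt _ _ _ q0)[t rt ta].
    have /rat_in_itvoo[z /itvP zz] := ta.
    exists z => //; split; last by rewrite zz.
    by apply: radius_set_up rt; rewrite ltW// zz.
  move=> [z _ [h1 h2]]; rewrite in_itv/=.
  by apply/median_radius_lt => //; exists (ratr z).
apply: bigcupT_measurable_rat => z.
have [za|za] := boolP (ratr z < a); last first.
  by rewrite (_ : mkset _ = set0)//; apply/seteqP; split => w // [].
have [z0|z0] := boolP (0 <= ratr z :> R); last first.
  rewrite (_ : mkset _ = set0)//; apply/seteqP; split => w // [[]].
  by rewrite (negbTE z0).
pose c w := count (fun j => `|eta j w - eta i w| <= ratr z) (iota 0 q).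
rewrite (_ : mkset _ = c @^-1` [set n | (q < 2 * n)%N]); last first.
  by apply/seteqP; split => w /= => [[[]]//|]; split => //; split.
rewrite -[X in measurable X]setTI.
have mc : measurable_fun setT c.
  apply: (@measurable_count _ W (fun j w => `|eta j w - eta i w| <= ratr z)).
  move=> j; apply: measurable_fun_ler; last exact: measurable_cst.
  by apply: measurable_norm => //; exact: open_measB.
exact: mc.
Qed.

Lemma measurable_median_index q (eta : nat -> W -> E) :
  (forall j, open_meas (eta j)) ->
  measurable_fun setT (fun w => median_index q (eta ^~ w)).
Proof.
move=> meta.
apply: (@measurable_find _ W (fun i w => all (fun j =>
  median_radius q (eta ^~ w) i <= median_radius q (eta ^~ w) j) (iota 0 q))).
move=> i; apply: (@measurable_all _ W (fun j w =>
  median_radius q (eta ^~ w) i <= median_radius q (eta ^~ w) j)).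
by move=> j; apply: measurable_fun_ler; exact: measurable_median_radius.
Qed.

End MeasurableMedian.

Section MeasurableAlgorithm.
Context {R : realType} {E : completeNormedModType R}.
Context {dX : measure_display} {Xi : measurableType dX}.
Context {d : measure_display} {W : measurableType d}.
Hypothesis sepE : separable_space E.
Variable tau : E -> Xi -> E.
Hypothesis mtau : jointly_measurable tau.
Local Notation stream := (stream Xi).

Lemma open_meas_tau (x : W -> E) (z : W -> Xi) :
  open_meas x -> measurable_fun setT z -> open_meas (fun w => tau (x w) (z w)).
Proof.
move=> /borelP mx mz; apply/borelP.
have mp : measurable_fun setT (fun w => (x w : borel E, z w)).
  exact: measurable_fun_pair.
exact: (@measurableT_comp _ _ _ _ _ _
  (fun p : borel E * Xi => tau p.1 p.2 : borel E) _ _ mtau mp).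
Qed.

Lemma measurable_coord (s : W -> stream) i : measurable_fun setT s ->
  measurable_fun setT (fun w => s w i).
Proof. by move=> ms; exact: (measurableT_comp (measurable_stream_coord i) ms). Qed.

Lemma open_meas_scale (a : R) (f : W -> E) :
  open_meas f -> open_meas (fun w => a *: f w).
Proof. by move=> mf; apply: (@open_measZ _ _ _ _ _ (fun=> a)). Qed.

Lemma open_meas_mean_difference m (y y' : W -> E) (s : W -> stream) :
  open_meas y -> open_meas y' -> measurable_fun setT s ->
  open_meas (fun w => mean_difference tau m (y w) (y' w) (s w)).
Proof.
move=> my my' ms; apply: open_meas_scale.
apply: (@open_meas_sum _ _ _ _ sepE _ (fun i w => tau (y w) (s w i) - tau (y' w) (s w i))) => //.
by move=> i; apply: open_measB => //; apply: open_meas_tau => //;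
  exact: measurable_coord.
Qed.

Definition group_average n (x : E) (s : stream) j : E :=
  n%:R^-1 *: \sum_(i < n) tau x (s (j * n + i)%N).

Lemma momeE e dl x (s : stream) :
  mome tau e dl x s = group_average (mome_n e) x s
    (median_index (mome_q dl) (group_average (mome_n e) x s)).
Proof. by []. Qed.

Lemma open_meas_group_average n (x : W -> E) (s : W -> stream) j :
  open_meas x -> measurable_fun setT s ->
  open_meas (fun w => group_average n (x w) (s w) j).
Proof.
move=> mx ms; apply: open_meas_scale.
apply: (@open_meas_sum _ _ _ _ sepE _ (fun i w => tau (x w) (s w (j * n + i)%N))) => //.
by move=> i; apply: open_meas_tau => //; exact: measurable_coord.
Qed.

Lemma open_meas_mome e dl (x : W -> E) (s : W -> stream) :
  open_meas x -> measurable_fun setT s ->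
  open_meas (fun w => mome tau e dl (x w) (s w)).
Proof.
move=> mx ms.
have mg j := @open_meas_group_average (mome_n e) x s j mx ms.
apply: (@open_meas_select _ _ _ _ (fun w => median_index (mome_q dl)
  (group_average (mome_n e) (x w) (s w)))
  (fun j w => group_average (mome_n e) (x w) (s w) j)) => //.
exact: (measurable_median_index sepE (mome_q dl) mg).
Qed.

(** The sizes [n] and [m] are constants here; [measurable_epoch] makes them random again by
    selecting over their values. *)
Lemma open_meas_inner beta gbar k (z T0 : W -> E) n m (s : W -> stream) j :
  open_meas z -> open_meas T0 -> measurable_fun setT s ->
  open_meas (fun w => (inner tau beta gbar k (z w) (T0 w) n m (s w) j).1) /\
  open_meas (fun w => (inner tau beta gbar k (z w) (T0 w) n m (s w) j).2).
Proof.
move=> mz mT ms; elim: j => [//|j [IH1 IH2]] /=.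
pose y w := (inner tau beta gbar k (z w) (T0 w) n m (s w) j).1.
pose t w := (inner tau beta gbar k (z w) (T0 w) n m (s w) j).2.
pose y' w := lambda_ beta k *: z w + (1 - lambda_ beta k) *: t w.
have my' : open_meas y' by apply: open_measD => //; exact: open_meas_scale.
split.
  rewrite (_ : (fun w => _) = y')//.
  by apply/funext => w; rewrite /y' /t; case: inner.
rewrite (_ : (fun w => _) = (fun w => t w + n%:R^-1 *: \sum_(l < n)
  clip (gbar * `|y' w - y w|) (mean_difference tau m (y' w) (y w)
                (shift (s w) ((j * n + l) * m)%N)))); last first.
  by apply/funext => w; rewrite /y' /t /y; case: inner.
apply: open_measD => //; apply: open_meas_scale.
apply: (@open_meas_sum _ _ _ _ sepE _ (fun l w => clip (gbar * `|y' w - y w|)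
  (mean_difference tau m (y' w) (y w)
                (shift (s w) ((j * n + l) * m)%N)))) => // l.
apply: open_meas_clip => //.
  apply: measurable_funM => //; apply: measurable_norm => //.
  exact: open_measB.
by apply: open_meas_mean_difference => //; exact: measurable_shift.
Qed.

End MeasurableAlgorithm.

Section Run.
Context {R : realType} {E : completeNormedModType R}.
Context {dX : measure_display} {Xi : measurableType dX}.
Hypothesis sepE : separable_space E.
Variable tau : E -> Xi -> E.
Hypothesis mtau : jointly_measurable tau.
Local Notation stream := (stream Xi).

Lemma agree_shift n m (s s' : stream) :
  agree (n + m) s s' -> agree m (shift s n : stream) (shift s' n).
Proof. by move=> h i im; apply: h; rewrite ltn_add2l. Qed.

(** Positivity of [mome_q] guarantees that the returned group is one of those paid for by
    [mome_cost]. *)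
Lemma mome_agree e dl x (s s' : stream) : (0 < mome_q dl)%N ->
  agree (mome_cost e dl) s s' -> mome tau e dl x s = mome tau e dl x s'.
Proof.
move=> q0 ss'.
have ave j : (j < mome_q dl)%N ->
    group_average tau (mome_n e) x s j = group_average tau (mome_n e) x s' j.
  move=> jq; congr (_ *: _); apply: eq_bigr => i _; congr tau; apply: ss'.
  rewrite /mome_cost [X in (_ < X)%N]mulnC; apply: (@leq_trans (j.+1 * mome_n e)).
    by rewrite mulSnr ltn_add2l.
  by rewrite leq_mul2r jq orbT.
rewrite !momeE (eq_median_index ave) ave//.
by have [] := median_indexP (group_average tau (mome_n e) x s') q0.
Qed.

Lemma inner_agree beta gbar k (z T0 : E) n m (s s' : stream) j :
  agree (j * (n * m)) s s' ->
  inner tau beta gbar k z T0 n m s j = inner tau beta gbar k z T0 n m s' j.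
Proof.
elim: j => [//|j IH] ss' /=; rewrite IH; last first.
  by apply: (agreeS _ ss'); rewrite leq_mul2r leqnSn orbT.
case: inner => y t; congr (_, _ + _ *: _); apply: eq_bigr => l _.
congr (clip _ (_ *: _)); apply: eq_bigr => i _; rewrite /shift.
have -> // : s ((j * n + l) * m + i)%N = s' ((j * n + l) * m + i)%N.
apply: ss'; apply: (@leq_trans ((j * n + l).+1 * m)).
  by rewrite mulSnr ltn_add2l.
by rewrite mulnA leq_mul2r mulSnr -addnS leq_add2l ltn_ord orbT.
Qed.

Variables (x0 : E) (beta delta gbar : R).
Local Notation run := (vr_ghal tau x0 beta delta gbar).

Definition residual (st : @state R E) : R := `|st_T st - st_x st|.
Definition run_n (s : stream) k : nat := n_ beta delta gbar k.+1 (residual (run s k)).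
Definition run_m (s : stream) k : nat := m_ beta gbar k.+1 (residual (run s k)).

(** The point and the seed count after the inner loop but before the closing call of [mome]: that
    call is fresh relative to this intermediate time, not to the start of the epoch. *)
Definition epoch_point (s : stream) k : E :=
  (inner tau beta gbar k.+1 (st_x (run s k)) (st_T (run s k)) (run_n s k)
     (run_m s k) (shift s (st_seeds (run s k))) (J_ beta gbar k.+1)).1.
Definition epoch_seeds (s : stream) k : nat :=
  (st_seeds (run s k) + J_ beta gbar k.+1 * (run_n s k * run_m s k))%N.

Lemma runS s k : run s k.+1 =
  restart tau beta delta k.+1 (epoch_point s k) s (epoch_seeds s k)
    (st_samples (run s k) + 2 * (J_ beta gbar k.+1 * (run_n s k * run_m s k))).
Proof. by []. Qed.

Hypothesis q_gt0 : forall k, (0 < mome_q (delta_ beta delta k.+1 / 2))%N.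

Lemma epoch_agree (s s' : stream) k : run s' k = run s k ->
  agree (epoch_seeds s k) s s' ->
  epoch_point s' k = epoch_point s k /\ epoch_seeds s' k = epoch_seeds s k.
Proof.
move=> e ss'; rewrite /epoch_point /epoch_seeds /run_n /run_m e; split=> //.
by congr fst; apply/esym/inner_agree; exact: agree_shift.
Qed.

(** The stopping-time property: the seeds that a state reports as drawn determine the state,
    including that count itself. *)
Lemma run_agree (s s' : stream) k :
  agree (st_seeds (run s k)) s s' -> run s' k = run s k.
Proof.
elim: k => [|k IH] ss'.
  rewrite /= /restart; congr State.
  by apply/esym/mome_agree => //; exact: (@agree_shift 0).
have ek : run s' k = run s k.
  apply: IH; apply: (agreeS _ ss').
  by rewrite runS /= /epoch_seeds -!addnA leq_addr.
have [ep es] : epoch_point s' k = epoch_point s k /\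
    epoch_seeds s' k = epoch_seeds s k.
  by apply: epoch_agree => //; apply: (agreeS _ ss'); rewrite leq_addr.
rewrite !runS /run_n /run_m ek ep es /restart; congr State.
by apply/esym/mome_agree => //; exact: agree_shift.
Qed.

Lemma epoch_stop (s s' : stream) k : agree (epoch_seeds s k) s s' ->
  epoch_point s' k = epoch_point s k /\ epoch_seeds s' k = epoch_seeds s k.
Proof.
move=> ss'; apply: epoch_agree => //; apply: run_agree.
by apply: (agreeS _ ss'); rewrite leq_addr.
Qed.

Record measurable_state (st : stream -> @state R E) : Prop := MeasurableState {
  meas_x : open_meas (fun s => st_x (st s));
  meas_T : open_meas (fun s => st_T (st s));
  meas_seeds : measurable_fun setT (fun s => st_seeds (st s));
  meas_samples : measurable_fun setT (fun s => st_samples (st s)) }.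

Lemma measurable_fun_muln (f g : stream -> nat) :
  measurable_fun setT f -> measurable_fun setT g ->
  measurable_fun setT (fun s => (f s * g s)%N).
Proof.
move=> mf mg; apply: (measurable_fun_select (g := f) (h := fun n s => (n * g s)%N)) => // n.
have mn : measurable_fun setT (muln n) by [].
exact: (measurableT_comp mn mg).
Qed.

Lemma measurable_restart k (x : stream -> E) (a b : stream -> nat) :
  open_meas x -> measurable_fun setT a -> measurable_fun setT b ->
  measurable_state (fun s => restart tau beta delta k (x s) s (a s) (b s)).
Proof.
move=> mx ma mb; split => //=.
- apply: (open_meas_select (g := a) (h := fun n s => mome tau
    (eps_ beta k.+1 / 2) (delta_ beta delta k.+1 / 2) (x s) (shift s n))) => // n.
  by apply: open_meas_mome => //; exact: measurable_shift.
- by apply: measurable_fun_addn => //; exact: measurable_cst.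
- by apply: measurable_fun_addn => //; exact: measurable_cst.
Qed.

Lemma measurable_epoch k : measurable_state (run ^~ k) ->
  [/\ measurable_fun setT (run_n ^~ k), measurable_fun setT (run_m ^~ k),
      open_meas (epoch_point ^~ k) & measurable_fun setT (epoch_seeds ^~ k)].
Proof.
move=> [mx mT ma mb].
have mR : measurable_fun setT (fun s : stream => residual (run s k)).
  by apply: measurable_norm => //; exact: open_measB.
have mn : measurable_fun setT (run_n ^~ k).
  apply: measurable_fun_maxn; first exact: measurable_cst.
  apply: measurable_ceiln; apply: measurable_funM; last exact: measurable_cst.
  by apply: measurable_funM => //; apply: measurable_funM.
have mm : measurable_fun setT (run_m ^~ k).
  apply: measurable_ceiln; apply: measurable_funM; last exact: measurable_cst.
  by apply: measurable_funM => //; exact: measurable_funX.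
split=> //.
  (* The two sizes and the position are frozen one after the other, each taking countably many
     values. *)
  pose F n m a (s : stream) := (inner tau beta gbar k.+1 (st_x (run s k))
    (st_T (run s k)) n m (shift s a) (J_ beta gbar k.+1)).1.
  apply: (open_meas_select (g := run_n ^~ k)
    (h := fun n (s : stream) => F n (run_m s k) (st_seeds (run s k)) s)) => // n.
  apply: (open_meas_select (g := run_m ^~ k)
    (h := fun m (s : stream) => F n m (st_seeds (run s k)) s)) => // m.
  apply: (open_meas_select (g := fun s : stream => st_seeds (run s k))
    (h := fun a (s : stream) => F n m a s)) => // a.
  have [] := @open_meas_inner _ _ _ _ _ _ sepE tau mtau beta gbar k.+1
    (fun s : stream => st_x (run s k)) (fun s : stream => st_T (run s k)) n m
    (fun s : stream => shift s a) (J_ beta gbar k.+1) => //.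
  exact: measurable_shift.
apply: measurable_fun_addn => //.
by apply: measurable_fun_muln => //; exact: measurable_fun_muln.
Qed.

Lemma measurable_run k : measurable_state (run ^~ k).
Proof.
elim: k => [|k IH].
  apply: (@measurable_restart 0 (fun=> x0) (fun=> 0%N) (fun=> 0%N)) => //.
  exact: open_meas_cst.
have [mn mm mp ma] := measurable_epoch IH.
apply: (@measurable_restart k.+1 (epoch_point ^~ k) (epoch_seeds ^~ k)) => //.
apply: measurable_fun_addn; first exact: (meas_samples IH).
apply: measurable_fun_muln => //; apply: measurable_fun_muln => //.
exact: measurable_fun_muln.
Qed.

End Run.

(** * Moments of averages *)

Section WeakMean.
Context {R : realType} {E : completeNormedModType R}.
Context {d : measure_display} {Xi : measurableType d}.
Hypothesis sepE : separable_space E.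
Variable D : probability Xi R.

(** The Pettis mean. It suffices because the mean of the oracle is only ever paired with derivatives
    of the squared smooth norm, which are continuous linear functionals. *)
Definition weak_mean (f : Xi -> E) (v : E) : Prop :=
  forall phi : {linear E -> R^o}, continuous phi ->
    D.-integrable setT (fun z => (phi (f z) : R)%:E) /\
    (\int[D]_z (phi (f z) : R)%:E = (phi v : R)%:E)%E.

Lemma open_meas_simple (s : Xi -> E) : simple_function s -> open_meas s.
Proof.
move=> [fs ms] U _.
have -> : s @^-1` U = \bigcup_(v in range s `&` U) (s @^-1` [set v]).
  apply/seteqP; split => [z zU|z [v [_ vU] /= ->]//].
  by exists (s z) => //; split => //; exists z.
apply: fin_bigcup_measurable => //; exact: sub_finite_set fs.
Qed.

Lemma simple_decomp (s : Xi -> E) (phi : E -> R) (z : Xi) :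
  finite_set (range s) ->
  phi (s z) = \sum_(v <- fset_set (range s)) phi v * \1_(s @^-1` [set v]) z.
Proof.
move=> fs; have sz : s z \in fset_set (range s).
  by rewrite in_fset_set//; apply/mem_set; exists z.
rewrite (bigD1_seq (s z))//=; last exact: fset_uniq.
rewrite indicE mem_set// mulr1 big1 ?addr0// => v vs.
by rewrite indicE memNset ?mulr0//= => e; rewrite e eqxx in vs.
Qed.

Lemma simple_weak_mean (s : Xi -> E) :
  simple_function s -> weak_mean s (simple_integral D s).
Proof.
move=> [fs ms] phi cphi; set r := fset_set (range s).
pose h v := fun z => ((phi v : R) * \1_(s @^-1` [set v]) z)%:E.
have ih v : D.-integrable setT (h v).
  rewrite /h; under [X in integrable _ _ X]eq_fun do rewrite EFinM.
  by apply: integrableZl => //; exact: integrable_indic.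
have e z : (phi (s z) : R)%:E = (\sum_(v <- r) h v z)%E.
  by rewrite /h sumEFin; congr EFin; exact: (simple_decomp phi z fs).
rewrite (_ : (fun z => _) = (fun z => \sum_(v <- r) h v z)%E); last exact/funext.
split; first by apply: integrable_sum.
rewrite integral_sum// /simple_integral fsbig_finite// linear_sum/= -sumEFin.
apply: eq_bigr => v _; rewrite /h.
under eq_integral do rewrite EFinM.
rewrite integralZl//; last exact: integrable_indic.
rewrite integral_indic// setIT linearZ/= -[X in (_ * X)%E]fineK ?fin_num_measure//.
by rewrite -EFinM mulrC.
Qed.

(** A continuous functional is bounded, so it passes to the L1 limit of the simple approximations,
    on which it commutes with integration. *)
Lemma bochner_weak_mean f v : bochner_integral D f v -> weak_mean f v.
Proof.
move=> [/borelP mf [s [ss s0 sv]]] phi cphi.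
have [M M0 phiM] : exists2 M : R, 0 < M & forall x, `|phi x| <= M * `|x|.
  have /linear_boundedP : bounded_near phi (nbhs 0).
    by apply: continuous_linear_bounded; exact: cphi.
  by move=> /pinfty_ex_gt0[M M0 hM]; exists M.
have ms n : open_meas (s n) by exact: open_meas_simple.
have mphi g : open_meas g -> measurable_fun setT (fun z => phi (g z) : R).
  by move=> mg; apply/open_meas_realP; exact: open_meas_comp.
have md n : measurable_fun setT (fun z => `|f z - s n z|).
  by apply: measurable_norm => //; exact: open_measB.
pose I n := (\int[D]_z (`|f z - s n z|)%:E)%E.
have int_phi n : (\int[D]_z (`|phi (f z) - phi (s n z) : R|)%:E <= M%:E * I n)%E.
  rewrite -ge0_integralZl_EFin//; [|exact/measurable_EFinP|exact: ltW].
  apply: ge0_le_integral => //.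
  - apply/measurable_EFinP; apply: measurableT_comp => //.
    by apply: measurable_funB; exact: mphi.
  - by apply: emeasurable_funM => //; exact/measurable_EFinP.
  - by move=> z _; rewrite -EFinM lee_fin -linearB phiM.
(* The L1 distances are known to be finite only from some rank [n0] on; integrability of [phi (f z)]
   comes from the single approximation [s n0]. *)
have /fine_cvgP[] := s0.
move=> [n0 _ fin_I] fine_I.
have I_fin n : (n0 <= n)%N -> (I n < +oo)%E.
  by move=> /fin_I /=; rewrite ge0_fin_numE// integral_ge0.
have idiff n : (n0 <= n)%N ->
    D.-integrable setT (fun z => (phi (f z) - phi (s n z) : R)%:E).
  move=> n0n; apply/integrableP; split.
    by apply/measurable_EFinP; apply: measurable_funB; exact: mphi.
  apply: le_lt_trans (int_phi n) _.
  by rewrite lte_mul_pinfty ?lee_fin ?ltW// I_fin.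
have isn n := (simple_weak_mean (ss n) cphi).1.
have esn n := (simple_weak_mean (ss n) cphi).2.
have iphi : D.-integrable setT (fun z => (phi (f z) : R)%:E).
  rewrite (_ : (fun z => _) = (fun z => (phi (f z) - phi (s n0 z) : R)%:E) \+
     (fun z => (phi (s n0 z) : R)%:E))%E.
    by apply: integrableD => //; exact: idiff.
  by apply/funext => z /=; rewrite -EFinD subrK.
split=> //; set a := (\int[D]_z _)%E.
have afin : a \is a fin_num by exact: integrable_fin_num.
rewrite -(fineK afin); congr EFin.
have close n : (n0 <= n)%N ->
    `|fine a - phi (simple_integral D (s n)) : R| <= M * fine (I n).
  move=> n0n; rewrite -lee_fin EFinM fineK ?ge0_fin_numE ?I_fin//; last first.
    by apply: integral_ge0.
  apply: le_trans (int_phi n).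
  have -> : (`|fine a - phi (simple_integral D (s n)) : R|%:E =
      `| \int[D]_z (phi (f z) - phi (s n z) : R)%:E |)%E.
    rewrite (_ : (\int[D]_z _) = a - (phi (simple_integral D (s n)) : R)%:E)%E.
      by rewrite -{2}(fineK afin).
    by rewrite -esn -integralB//.
  by apply: le_abse_integral => //; exact: measurable_int (idiff _ n0n).
have cv1 : (fun n => phi (simple_integral D (s n)) : R) @ \oo --> fine a.
  apply/cvgrPdist_le => e e0.
  have /cvgrPdist_le/(_ (e / M)) := fine_I.
  rewrite divr_gt0// => /(_ isT) [n1 _ h1].
  exists (maxn n0 n1) => // n /=; rewrite geq_max => /andP[n0n n1n].
  apply: le_trans (close _ n0n) _.
  have := h1 n n1n; rewrite /= sub0r normrN ler_pdivlMr// mulrC.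
  by apply: le_trans; rewrite ler_pM2l// ler_norm.
have cv2 : (fun n => phi (simple_integral D (s n)) : R) @ \oo --> (phi v : R).
  exact: continuous_cvg (cphi v) sv.
exact: cvg_unique cv1 cv2.
Qed.

Lemma weak_meanB f g v w : weak_mean f v -> weak_mean g w ->
  weak_mean (fun z => f z - g z) (v - w).
Proof.
move=> mf mg phi cphi; have [i1 e1] := mf _ cphi; have [i2 e2] := mg _ cphi.
have e : (fun z => (phi (f z - g z) : R)%:E) =
    ((fun z => (phi (f z) : R)%:E) \- (fun z => (phi (g z) : R)%:E))%E.
  by apply/funext => z; rewrite linearB.
rewrite e; split; first exact: integrableB.
by rewrite integralB// e1 e2 linearB.
Qed.

End WeakMean.

Section Tails.
Context {d : measure_display} {T : measurableType d} {R : realType}.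
Variable P : probability T R.

Lemma markov_le (g : T -> R) (a c : R) : measurable_fun setT g ->
  (forall t, 0 <= g t) -> 0 < a -> (\int[P]_t (g t)%:E <= c%:E)%E ->
  (P [set t | (a <= g t)%R] <= (c / a)%:E)%E.
Proof.
move=> mg g0 a0 gc.
have mA : measurable [set t | a <= g t].
  rewrite (_ : mkset _ = g @^-1` `[a, +oo[).
    by rewrite -[X in measurable X]setTI; exact: mg.
  by apply/seteqP; split => t /=; rewrite in_itv/= andbT.
rewrite -[X in P X]setIT -integral_indic//.
have : (\int[P]_t (a%:E * (\1_[set t | (a <= g t)%R] t)%:E) <= c%:E)%E.
  apply: le_trans gc; apply: ge0_le_integral => //.
  - by move=> t _; rewrite mule_ge0// lee_fin// ltW.
  - by apply: emeasurable_funM => //; exact/measurable_EFinP/measurable_indic.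
  - exact/measurable_EFinP.
  - move=> t _; rewrite -EFinM lee_fin indicE.
    case: (boolP (t \in _)) => [/set_mem/= at_|_]; rewrite ?mulr0 ?mulr1//.
rewrite ge0_integralZl_EFin//; last 2 first.
  exact/measurable_EFinP/measurable_indic.
  exact: ltW.
set I := (\int[P]_t _)%E => h.
have Ifin : I \is a fin_num.
  rewrite /I integral_indic// setIT; exact: fin_num_measure.
by move: h; rewrite -(fineK Ifin) -EFinM !lee_fin ler_pdivlMr// mulrC.
Qed.

(** Jensen's inequality for the square, from g <= g^2 / (2 t) + t / 2. Taking t = u + e rather than
    [u] covers [u = 0]. *)
Lemma mean_le_root (g : T -> R) (u : R) : measurable_fun setT g ->
  (forall t, 0 <= g t) -> 0 <= u ->
  (\int[P]_t (g t ^+ 2)%:E <= (u ^+ 2)%:E)%E -> (\int[P]_t (g t)%:E <= u%:E)%E.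
Proof.
move=> mg g0 u0 gu; apply/lee_addgt0Pr => e e0; rewrite -EFinD.
set t := u + e; have t0 : 0 < t by rewrite /t ltr_wpDl.
have gt : (\int[P]_x (g x ^+ 2)%:E <= (t ^+ 2)%:E)%E.
  by apply: le_trans gu _; rewrite lee_fin ler_sqr ?nnegrE /t; lra.
have mg2 : measurable_fun setT (fun x => g x ^+ 2) by exact: measurable_funX.
apply: (@le_trans _ _
  (\int[P]_x (((2 * t)^-1)%:E * (g x ^+ 2)%:E + (t / 2)%:E))%E).
  apply: ge0_le_integral => //.
  - by move=> x _; rewrite lee_fin.
  - exact/measurable_EFinP.
  - by apply: emeasurable_funD => //; apply: emeasurable_funM => //;
      exact/measurable_EFinP.
  - move=> x _; rewrite -EFinM -EFinD lee_fin.
    have -> : (2 * t)^-1 * g x ^+ 2 + t / 2 = g x + (g x - t) ^+ 2 / (2 * t).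
      by field; rewrite gt_eqF.
    by rewrite lerDl divr_ge0 ?sqr_ge0// mulr_ge0// ltW.
rewrite ge0_integralD//; last 3 first.
  - by move=> x _; rewrite -EFinM lee_fin mulr_ge0 ?sqr_ge0// invr_ge0 mulr_ge0 ?ltW.
  - by apply: emeasurable_funM => //; exact/measurable_EFinP.
  - by move=> x _; rewrite lee_fin divr_ge0 ?ltW.
rewrite integral_cst//= probability_setT mule1 ge0_integralZl_EFin//; last 3 first.
  - by move=> x _; rewrite lee_fin sqr_ge0.
  - exact/measurable_EFinP.
  - by rewrite invr_ge0 mulr_ge0 ?ltW.
apply: (@le_trans _ _ (((2 * t)^-1)%:E * (t ^+ 2)%:E + (t / 2)%:E)%E).
  by rewrite leeD2r// lee_pmul2l// lte_fin invr_gt0 mulr_gt0.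
by rewrite -EFinM -EFinD lee_fin le_eqVlt; apply/orP; left; apply/eqP;
  field; rewrite gt_eqF.
Qed.

End Tails.

Lemma open_meas_precomp {d d'} {W : measurableType d} {W' : measurableType d'}
    {T : topologicalType} (f : W -> T) (g : W' -> W) :
  measurable_fun setT g -> open_meas f -> open_meas (fun w => f (g w)).
Proof.
move=> mg mf U oU; rewrite -[X in measurable X]setTI.
exact: (mg measurableT _ (mf U oU)).
Qed.

Section Moments.
Context {R : realType} {E : completeNormedModType R}.
Context {d : measure_display} {Xi : measurableType d}.
Hypothesis sepE : separable_space E.
Variables (D : probability Xi R) (mu : probability (stream Xi) R).
Hypothesis muD : iid_law D mu.
Variables (N : E -> R) (B C : R).
Hypothesis smoothN : smoothable_by N B C.
Variables (f : Xi -> E) (v : E) (V : R).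
Hypotheses (mf : open_meas f) (fv : weak_mean D f v).
Hypothesis fV : (\int[D]_z (`|f z - v| ^+ 2)%:E <= V%:E)%E.
Local Notation stream := (stream Xi).

Let sq : E -> R^o := fun x => N x ^+ 2.

Let N_scale (a : R) x : N (a *: x) = `|a| * N x.
Proof. by have [[]] := smoothN. Qed.

Let B_ge1 : 1 <= B. Proof. by case: smoothN. Qed.
Let C_ge1 : 1 <= C. Proof. by case: smoothN. Qed.

Let N_ge x : `|x| <= N x.
Proof. by have [_ _ _ /(_ x)/andP[]] := smoothN. Qed.

Let N_le x : N x <= C * `|x|.
Proof. by have [_ _ _ /(_ x)/andP[]] := smoothN. Qed.

Let sq_le x : sq x <= C ^+ 2 * `|x| ^+ 2.
Proof.
rewrite /sq -exprMn; apply: lerXn2r; rewrite ?nnegrE.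
- exact: le_trans (normr_ge0 x) (N_ge x).
- by rewrite mulr_ge0 ?(le_trans ler01 C_ge1).
- exact: N_le.
Qed.

Let sq_ge x : `|x| ^+ 2 <= sq x.
Proof. by apply: lerXn2r; rewrite ?nnegrE// (le_trans _ (N_ge x)). Qed.

Let sq_ge0 x : 0 <= sq x. Proof. exact: sqr_ge0. Qed.

Let dsq x : differentiable sq x.
Proof. by have [_ _ _ _ [[]]] := smoothN. Qed.

Let sq_smooth x y : sq (x + y) <= sq x + 'd sq x y + B * sq y.
Proof. by have [_ _ _ _ [_ h]] := smoothN; exact: h. Qed.

Let V_ge0 : 0 <= V.
Proof.
rewrite -lee_fin; apply: le_trans fV; apply: integral_ge0 => z _.
by rewrite lee_fin sqr_ge0.
Qed.

Let measurable_sq {d'} {W : measurableType d'} (g : W -> E) :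
  open_meas g -> measurable_fun setT (fun w => sq (g w) : R).
Proof.
move=> mg; apply/open_meas_realP.
apply: (@open_meas_comp _ _ _ _ g sq) => // x.
exact: differentiable_continuous.
Qed.

Let mfv : open_meas (fun z => f z - v).
Proof. by apply: open_measB => //; exact: open_meas_cst. Qed.

(** The derivative at [x] is applied to a centred variable and integrates to zero, so only the
    quadratic remainder survives; [C ^+ 2] is the price of passing from [N] to the norm. *)
Lemma smooth_step x :
  (\int[D]_z (sq (x + (f z - v)) : R)%:E <= (sq x + B * C ^+ 2 * V : R)%:E)%E.
Proof.
have B0 : 0 <= B by exact: le_trans B_ge1.
have isq : D.-integrable setT (fun z => (sq (f z - v) : R)%:E).
  apply/integrableP; split; first exact/measurable_EFinP/measurable_sq.
  apply: (@le_lt_trans _ _ (\int[D]_z ((C ^+ 2)%:E * (`|f z - v| ^+ 2)%:E))%E).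
    apply: ge0_le_integral => //.
    - by apply/measurable_EFinP/measurableT_comp => //; exact: measurable_sq.
    - apply: emeasurable_funM => //; apply/measurable_EFinP/measurable_funX.
      exact: measurable_norm.
    - by move=> z _; rewrite -EFinM lee_fin ger0_norm.
  rewrite ge0_integralZl_EFin ?sqr_ge0//; last first.
    by apply/measurable_EFinP/measurable_funX; exact: measurable_norm.
  apply: (@le_lt_trans _ _ ((C ^+ 2)%:E * V%:E)%E); last exact: ltry.
  by apply: lee_wpmul2l => //; rewrite lee_fin sqr_ge0.
have esq : (\int[D]_z (sq (f z - v) : R)%:E <= (C ^+ 2 * V)%:E)%E.
  apply: (@le_trans _ _ (\int[D]_z ((C ^+ 2)%:E * (`|f z - v| ^+ 2)%:E))%E).
    apply: ge0_le_integral => //.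
    - by move=> z _; rewrite lee_fin.
    - exact/measurable_EFinP/measurable_sq.
    - apply: emeasurable_funM => //; apply/measurable_EFinP/measurable_funX.
      exact: measurable_norm.
    - by move=> z _; rewrite -EFinM lee_fin.
  rewrite ge0_integralZl_EFin ?sqr_ge0//; last first.
    by apply/measurable_EFinP/measurable_funX; exact: measurable_norm.
  rewrite [X in (_ <= X)%E](EFinM (C ^+ 2) V).
  by apply: lee_wpmul2l => //; rewrite lee_fin sqr_ge0.
(* The weak mean is used with the Frechet derivative at [x] as functional. *)
have [idd ed] := fv (diff_continuous (dsq x)).
have icst (c : R) : D.-integrable setT (fun=> c%:E).
  by apply: finite_measure_integrable_cst.
pose lin (z : Xi) := ((sq x : R) - ('d sq x v : R))%:E.
have e z : (sq x + 'd sq x (f z - v) + B * sq (f z - v) : R)%:E =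
   (('d sq x (f z) : R)%:E + (lin z + B%:E * (sq (f z - v) : R)%:E))%E.
  rewrite /lin linearB -EFinM -!EFinD; congr EFin; ring.
apply: (@le_trans _ _ (\int[D]_z (('d sq x (f z) : R)%:E +
   (lin z + B%:E * (sq (f z - v) : R)%:E)))%E).
  apply: ge0_le_integral => //.
  - by move=> z _; rewrite lee_fin.
  - apply/measurable_EFinP/measurable_sq.
    by apply: open_measD => //; exact: open_meas_cst.
  - apply: emeasurable_funD; first exact: measurable_int idd.
    apply: emeasurable_funD; first exact: measurable_cst.
    apply: emeasurable_funM; first exact: measurable_cst.
    exact: measurable_int isq.
  - by move=> z _; rewrite -e lee_fin; exact: sq_smooth.
rewrite integralD//; last first.
  by apply: integrableD => //; [exact: icst|exact: integrableZl].
rewrite integralD//; [|exact: icst|exact: integrableZl].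
rewrite ed /lin integral_cst//= probability_setT mule1 integralZl//.
rewrite addeA -EFinD addrCA subrr addr0 [X in (_ <= X)%E]EFinD leeD2l//.
rewrite -mulrA EFinM; apply: lee_wpmul2l => //; by rewrite lee_fin.
Qed.

(** Smoothness replaces the orthogonality of a Hilbert space: splicing at [n] makes the last summand
    fresh, and each summand adds at most [B * C ^+ 2 * V]. *)
Lemma sum_moment n :
  (\int[mu]_s (sq (\sum_(i < n) (f (s i) - v)) : R)%:E <=
   (n%:R * (B * C ^+ 2 * V))%:E)%E.
Proof.
have msum k : open_meas (fun s : stream => \sum_(i < k) (f (s i) - v)).
  apply: (@open_meas_sum _ _ _ _ sepE _ (fun i (s : stream) => f (s i) - v)).
  by move=> i; exact: (open_meas_precomp (measurable_stream_coord i) mfv).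
have msq k : measurable_fun setT
    (fun s : stream => (sq (\sum_(i < k) (f (s i) - v)) : R)%:E).
  exact/measurable_EFinP/measurable_sq.
elim: n => [|n IH].
  have sq0 : sq 0 = 0.
    by rewrite /sq -(scale0r (0 : E)) N_scale normr0 mul0r expr0n.
  under eq_integral do rewrite big_ord0 sq0.
  by rewrite integral0 mul0r.
rewrite (integral_splice muD n)//; last by move=> s; rewrite lee_fin.
have step s : (\int[mu]_s' (sq (\sum_(i < n.+1) (f (splice n s s' i) - v)) : R)%:E
    <= (sq (\sum_(i < n) (f (s i) - v)) : R)%:E + (B * C ^+ 2 * V)%:E)%E.
  pose x := \sum_(i < n) (f (s i) - v).
  rewrite -EFinD; apply: le_trans (smooth_step x).
  rewrite -(integral_head muD (f := fun z => (sq (x + (f z - v)) : R)%:E)); last 2 first.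
  - apply/measurable_EFinP/measurable_sq.
    by apply: open_measD => //; exact: open_meas_cst.
  - by move=> z; rewrite lee_fin.
  rewrite le_eqVlt; apply/orP; left; apply/eqP; apply: eq_integral => s' _.
  rewrite big_ord_recr/=; congr (sq (_ + (f _ - _)) : R)%:E.
    by apply: eq_bigr => i _; rewrite /splice ltn_ord.
  by rewrite /splice ltnn subnn.
apply: (@le_trans _ _ (\int[mu]_s ((sq (\sum_(i < n) (f (s i) - v)) : R)%:E +
   (B * C ^+ 2 * V)%:E))%E).
  apply: ge0_le_integral => //.
  - by move=> s _; apply: integral_ge0 => s' _; rewrite lee_fin.
  - apply: (measurable_fun_fubini_tonelli_F (fun p : stream * stream =>
      (sq (\sum_(i < n.+1) (f (splice n p.1 p.2 i) - v)) : R)%:E)).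
      exact: (measurableT_comp (msq n.+1) (measurable_splice n)).
    by move=> p; rewrite lee_fin.
  - exact: emeasurable_funD.
have K0 : 0 <= B * C ^+ 2 * V.
  by rewrite !mulr_ge0 ?sqr_ge0// (le_trans ler01).
rewrite ge0_integralD//; last first.
  by move=> s _; rewrite lee_fin.
rewrite integral_cst//= probability_setT mule1 -[n.+1%:R]natr1 mulrDl mul1r.
by rewrite EFinD leeD2r.
Qed.

Lemma average_moment n : (0 < n)%N ->
  (\int[mu]_s (`|n%:R^-1 *: \sum_(i < n) f (s i) - v| ^+ 2)%:E <=
   (B * C ^+ 2 * V / n%:R)%:E)%E.
Proof.
move=> n0; have n0' : n%:R != 0 :> R by rewrite pnatr_eq0 -lt0n.
have e (s : stream) : n%:R^-1 *: \sum_(i < n) f (s i) - v =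
    n%:R^-1 *: \sum_(i < n) (f (s i) - v).
  rewrite sumrB scalerBr; congr (_ - _).
  by rewrite sumr_const card_ord -[v *+ n]scaler_nat scalerA mulVf// scale1r.
have msum : open_meas (fun s : stream => \sum_(i < n) (f (s i) - v)).
  apply: (@open_meas_sum _ _ _ _ sepE _ (fun i (s : stream) => f (s i) - v)).
  by move=> i; exact: (open_meas_precomp (measurable_stream_coord i) mfv).
apply: (@le_trans _ _ (\int[mu]_s (((n%:R^-1) ^+ 2)%:E *
   (sq (\sum_(i < n) (f (s i) - v)) : R)%:E))%E).
  apply: ge0_le_integral => //.
  - apply/measurable_EFinP/measurable_funX.
    under [X in measurable_fun _ X]eq_fun do rewrite e.
    by apply: measurable_norm => //; exact: open_meas_scale.
  - by apply: emeasurable_funM => //; exact/measurable_EFinP/measurable_sq.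
  - move=> s _; rewrite e -EFinM lee_fin normrZ exprMn ger0_norm ?invr_ge0//.
    by rewrite ler_wpM2l ?sqr_ge0.
rewrite ge0_integralZl_EFin ?sqr_ge0//; last 2 first.
- by move=> s _; rewrite lee_fin.
- exact/measurable_EFinP/measurable_sq.
apply: (@le_trans _ _ (((n%:R^-1) ^+ 2)%:E * (n%:R * (B * C ^+ 2 * V))%:E)%E).
  by apply: lee_wpmul2l; [rewrite lee_fin sqr_ge0|exact: sum_moment].
by rewrite -EFinM lee_fin le_eqVlt; apply/orP; left; apply/eqP; field.
Qed.

Lemma average_mean n u : (0 < n)%N -> 0 <= u ->
  B * C ^+ 2 * V / n%:R <= u ^+ 2 ->
  (\int[mu]_s (`|n%:R^-1 *: \sum_(i < n) f (s i) - v|)%:E <= u%:E)%E.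
Proof.
move=> n0 u0 Vu; apply: mean_le_root => //.
  apply: measurable_norm => //; apply: open_measB => //; last exact: open_meas_cst.
  apply: open_meas_scale => //.
  have mi i : open_meas (fun s : stream => f (s i)).
    exact: (open_meas_precomp (measurable_stream_coord i) mf).
  exact: (open_meas_sum sepE n mi).
by apply: le_trans (average_moment n0) _; rewrite lee_fin.
Qed.

End Moments.

(** * Tail bounds for the estimators *)

Section MedianError.
Context {R : realType} {E : completeNormedModType R}.

(** Any two good averages are within 2 r of each other, so the minimal radius is at most 2 r. The
    majority near the selected average meets the good majority, and a common member adds one more
    [r]. *)
Lemma median_error q (eta : nat -> E) (v : E) (r : R) : 0 <= r ->
  (q < 2 * count (fun j => (`|eta j - v| <= r)%R) (iota 0 q))%N ->
  `|eta (median_index q eta) - v| <= 3 * r.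
Proof.
move=> r0 maj; set good := fun j => _ in maj.
have q0 : (0 < q)%N by case: q maj.
have /hasP[j0 +] : has good (iota 0 q).
  by rewrite has_count; move: maj; case: count.
rewrite mem_iota/= add0n => j0q gj0.
have [_ /(_ j0 j0q) imin] := median_indexP eta q0.
set i := median_index q eta in imin *.
(* The slack [e] yields an actual admissible radius below 2 r + e; the infimum itself need not be
   one. *)
apply/ler_addgt0Pr => e e0.
have : median_radius q eta i < 2 * r + e.
  apply: le_lt_trans imin _; apply/median_radius_lt => //.
  exists (2 * r); last by rewrite ltrDl.
  split; first by rewrite mulr_ge0.
  apply: leq_trans maj _; rewrite leq_mul2l/=; apply: sub_count => j /= gj.
  rewrite -(subrK v (eta j)) -addrA (le_trans (ler_normD _ _))//.
  by rewrite mulr_natl mulr2n lerD// distrC.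
move=> /(median_radius_lt _ _ _ q0)[t [t0 majt] tlt].
set near := fun j => _ in majt.
have : has (predI good near) (iota 0 q).
  (* Pigeonhole: two strict majorities among [q] indices intersect. *)
  rewrite has_count -(ltn_add2l (count (predU good near) (iota 0 q))) addn0.
  rewrite count_predUI; apply: leq_ltn_trans (count_size _ _) _.
  rewrite size_iota -(ltn_pmul2l (isT : 0 < 2)%N) mulnDr mul2n -addnn.
  by rewrite -addSn leq_add// ltnW.
move=> /hasP[j _ /andP[gj nj]].
rewrite -(subrK (eta j) (eta i)) -addrA (le_trans (ler_normD _ _))//.
move: gj nj; rewrite /good /near (distrC (eta j) (eta i)) => gj nj.
by apply: le_trans (lerD nj gj) _; lra.
Qed.

End MedianError.

Section MomeTail.
Context {R : realType} {E : completeNormedModType R}.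
Context {d : measure_display} {Xi : measurableType d}.
Hypothesis sepE : separable_space E.
Variables (D : probability Xi R) (mu : probability (stream Xi) R).
Hypothesis muD : iid_law D mu.
Variables (N : E -> R) (B C : R).
Hypothesis smoothN : smoothable_by N B C.
Variable tau : E -> Xi -> E.
Hypothesis mtau : jointly_measurable tau.
Local Notation stream := (stream Xi).

Lemma open_meas_tau1 x : open_meas (tau x).
Proof. by apply: open_meas_tau => //; exact: open_meas_cst. Qed.

Lemma group_average_splice n x j (s s' : stream) :
  group_average tau n x (splice (j * n) s s') j = group_average tau n x s' 0.
Proof.
congr (_ *: _); apply: eq_bigr => i _; congr tau.
by rewrite /splice ltnNge leq_addr/= addKn mul0n add0n.
Qed.

(* Chernoff: a group average misses with probability at most 1/27, so 4 to the
   number of misses has mean at most (1 + 3/27)^q = (10/9)^q, while half of the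
   groups missing means at least 2^q. *)
Lemma exp_count_tail (q : nat) (dl : R) : 0 < dl -> 18 * ln (1 / dl) <= q%:R ->
  (10 / 9) ^+ q / 2 ^+ q <= dl.
Proof.
move=> dl0 hq; rewrite -expr_div_n (_ : 10 / 9 / 2 = 5 / 9 :> R); last by field.
apply: (@le_trans _ _ (expR (- 18^-1) ^+ q)).
  apply: lerXn2r; rewrite ?nnegrE ?expR_ge0//.
  apply: le_trans (expR_ge1Dx _); lra.
rewrite -expRM_natl -[leRHS]lnK ?posrE// ler_expR.
by move: hq; rewrite ln_div ?posrE// ln1 sub0r => hq; lra.
Qed.

(** The last hypothesis is exactly what Chebyshev needs for one group of at least 27 / e^2 samples
    to miss [v] by [r] with probability at most 1/27; the Chernoff bound then runs over the
    groups. *)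
Lemma mome_tail (x v : E) (V e dl r : R) :
  weak_mean D (tau x) v ->
  (\int[D]_z (`|tau x z - v| ^+ 2)%:E <= V%:E)%E ->
  0 < e -> 0 < dl < 1 -> 0 < r ->
  27 * (B * C ^+ 2 * V) <= 27 / e ^+ 2 * r ^+ 2 ->
  (mu [set s | (3 * r < `|mome tau e dl x s - v|)%R] <= dl%:E)%E.
Proof.
move=> mean var e0 /andP[dl0 dl1] r0 hr.
have e13 : 1 + 3 = 4 :> R by lra.
set n := mome_n e; set q := mome_q dl.
have hn : 27 / e ^+ 2 <= n%:R by rewrite -ceiln_le.
have hq : 18 * ln (1 / dl) <= q%:R by rewrite -ceiln_le.
have n0 : (0 < n)%N.
  by rewrite -(ltr0n R); apply: lt_le_trans hn; rewrite divr_gt0// exprn_gt0.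
(* [G j] is 4 to the power of the indicator of a miss, written affinely so that its mean is
   immediate. *)
pose G j (s : stream) : R :=
  1 + 3 * \1_[set s | (r <= `|group_average tau n x s j - v|)%R] s.
have mtx := open_meas_tau1 x.
have mga j : open_meas (fun s : stream => group_average tau n x s j - v).
  apply: open_measB => //; last exact: open_meas_cst.
  apply: open_meas_group_average => //; exact: open_meas_cst.
have mbad j : measurable [set s : stream | r <= `|group_average tau n x s j - v|].
  rewrite (_ : mkset _ = (fun s : stream => `|group_average tau n x s j - v|)
    @^-1` `[r, +oo[).
    by rewrite -[X in measurable X]setTI; exact: (measurable_norm (mga j)).
  by apply/seteqP; split => s /=; rewrite in_itv/= andbT.
have mG j : measurable_fun setT (G j).
  have mi : measurable_fun setT
      (\1_[set s | (r <= `|group_average tau n x s j - v|)%R] : stream -> R).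
    exact: measurable_indic.
  apply: measurable_funD; first exact: measurable_cst.
  by apply: measurable_funM; [exact: measurable_cst|exact: mi].
have G1 j s : 1 <= G j s by rewrite /G lerDl mulr_ge0// indicE.
have G0 j s : 0 <= G j s by exact: le_trans (G1 j s).
have bad0 : (mu [set s : stream | (r <= `|group_average tau n x s 0 - v|)%R]
    <= (27^-1)%:E)%E.
  rewrite (_ : mkset _ =
    [set s : stream | r ^+ 2 <= `|group_average tau n x s 0 - v| ^+ 2]); last first.
    by apply/seteqP; split => s /=; rewrite ler_sqr ?nnegrE// ltW.
  apply: le_trans (@markov_le _ _ _ _ _ _ (B * C ^+ 2 * V / n%:R) _ _ _ _) _.
  - by apply: measurable_funX; exact: measurable_norm.
  - by move=> s; rewrite exprn_ge0.
  - by rewrite exprn_gt0.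
  - apply: le_trans (average_moment sepE muD smoothN mtx mean var n0).
    rewrite le_eqVlt; apply/orP; left; apply/eqP.
    apply: eq_integral => s _; rewrite /group_average.
    by under eq_bigr do rewrite mul0n add0n.
  - rewrite lee_fin ler_pdivrMr ?exprn_gt0// ler_pdivrMr ?ltr0n//.
    have : 27 * (B * C ^+ 2 * V) <= n%:R * r ^+ 2.
      by apply: le_trans hr _; rewrite ler_wpM2r ?sqr_ge0.
    by lra.
have stepG j s : (\int[mu]_s' (G j (splice (j * n) s s'))%:E <= (10 / 9)%:E)%E.
  have eG s' : (G j (splice (j * n) s s'))%:E = (1%:E + 3%:E *
      (\1_[set s : stream | (r <= `|group_average tau n x s 0 - v|)%R] s')%:E)%E.
    rewrite -EFinM -EFinD /G; congr (_ + _ * _)%:E; rewrite !indicE.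
    by congr (nat_of_bool _)%:R; apply/idP/idP => /set_mem/= h; apply/mem_set;
      move: h; rewrite /= group_average_splice.
  under eq_integral do rewrite eG.
  have mi : measurable_fun setT (fun s' : stream =>
    (\1_[set s : stream | (r <= `|group_average tau n x s 0 - v|)%R] s' : R)%:E).
    exact/measurable_EFinP/measurable_indic.
  rewrite ge0_integralD//; last first.
    by apply: emeasurable_funM.
  rewrite integral_cst//= probability_setT mule1 ge0_integralZl_EFin//.
  rewrite integral_indic// setIT.
  apply: (@le_trans _ _ (1%:E + 3%:E * (27^-1)%:E)%E).
    by rewrite leeD2l// lee_wpmul2l// lee_fin.
  by rewrite -EFinM -EFinD lee_fin; lra.
have prodG : (\int[mu]_s (\prod_(j < q) G j s)%:E <= ((10 / 9) ^+ q)%:E)%E.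
  have := @sequential_prod _ _ _ D mu muD G (fun=> 10 / 9) n q mG G0.
  rewrite prodr_const card_ord; apply => //.
    move=> p s s' ss'; rewrite /G !indicE.
    have -> // : (s \in [set s | r <= `|group_average tau n x s p - v|]) =
      (s' \in [set s | r <= `|group_average tau n x s p - v|]).
    have eg : group_average tau n x s p = group_average tau n x s' p.
      congr (_ *: _); apply: eq_bigr => i _; congr tau; apply: ss'.
      by rewrite mulSnr ltn_add2l.
    by apply/idP/idP => /set_mem/= h; apply/mem_set; move: h => /=; rewrite eg.
have mprod : measurable_fun setT (fun s => \prod_(j < q) G j s).
  apply: (@eq_measurable_fun _ _ _ _ _ (fun s => \prod_(j <- enum 'I_q) G j s)).
    by move=> s _; rewrite big_enum.
  by apply: measurable_prod => j _; exact: mG.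
apply: (@le_trans _ _ (mu [set s : stream | (2 ^+ q <= \prod_(j < q) G j s)%R])).
  have m1 : measurable [set s : stream | 3 * r < `|mome tau e dl x s - v|].
    rewrite (_ : mkset _ = (fun s : stream => `|mome tau e dl x s - v|)
      @^-1` `]3 * r, +oo[); last first.
      by apply/seteqP; split => s /=; rewrite in_itv/= andbT.
    rewrite -[X in measurable X]setTI; apply: measurable_norm => //.
    apply: open_measB => //; last exact: open_meas_cst.
    apply: (@open_meas_mome _ _ _ _ _ stream sepE tau mtau e dl (fun=> x) id) => //.
    exact: open_meas_cst.
  have m2 : measurable [set s : stream | 2 ^+ q <= \prod_(j < q) G j s].
    rewrite (_ : mkset _ = (fun s : stream => \prod_(j < q) G j s)
      @^-1` `[2 ^+ q, +oo[); last first.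
      by apply/seteqP; split => s /=; rewrite in_itv/= andbT.
    by rewrite -[X in measurable X]setTI; exact: mprod.
  apply: le_measure; [exact: mem_set|exact: mem_set|].
  move=> s /=; rewrite ltNge => /negP nclose.
  pose bad j := r <= `|group_average tau n x s j - v|.
  have Ge : \prod_(j < q) G j s = 4 ^+ count bad (iota 0 q).
    rewrite -[RHS]/(4 ^+ _) -(big_mkord predT (fun j => G j s)) /index_iota subn0.
    elim: (iota 0 q) => [|j l IH]; first by rewrite big_nil.
    rewrite big_cons IH /= exprD; congr (_ * _); rewrite /G indicE.
    case: (boolP (bad j)) => bj; first by rewrite mem_set//= mulr1 e13.
    by rewrite memNset//= ?mulr0 ?addr0//; exact/negP.
  rewrite Ge (_ : 4 = 2 ^+ 2 :> R); last by rewrite -natrX.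
  rewrite -exprM ler_weXn2l ?ler1n// leqNgt; apply/negP => few.
  (* If fewer than half of the groups missed, the hits would form a strict majority and
     [median_error] would contradict the failure. *)
  apply: nclose; rewrite momeE -/n -/q; apply: median_error; first exact: ltW.
  have cnt : (count bad (iota 0 q) + count (predC bad) (iota 0 q))%N = q.
    by rewrite count_predC size_iota.
  have le_cnt : (count (predC bad) (iota 0 q) <= count (fun j =>
      (`|group_average tau n x s j - v| <= r)%R) (iota 0 q))%N.
    by apply: sub_count => j /=; rewrite -ltNge => /ltW.
  by clear -few cnt le_cnt; lia.
apply: (@le_trans _ _ ((10 / 9) ^+ q / 2 ^+ q)%:E); last first.
  by rewrite lee_fin; exact: exp_count_tail.
by apply: markov_le => // s; exact: prodr_ge0.
Qed.

End MomeTail.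

(** * The clipped recursive estimator *)

Section Clip.
Context {R : realType} {E : completeNormedModType R}.
Implicit Types (c : R) (x w : E).

Lemma norm_clip c x : 0 <= c -> `|clip c x| <= c.
Proof.
move=> c0; rewrite /clip normrZ.
have [->|x0] := eqVneq x 0; first by rewrite normr0 mulr0.
have nx : 0 < `|x| by rewrite normr_gt0.
have cx : 0 <= c / `|x| by rewrite divr_ge0.
rewrite ger0_norm ?le_min ?ler01//.
by rewrite -ler_pdivlMr// ge_min lexx orbT.
Qed.

(** Clipping moves [x] by its distance to the ball of radius [c], hence by at most the distance from
    [x] to [w]. The triangle inequality costs the factor 2: in a general norm, radial retraction is
    not nonexpansive. *)
Lemma clip_dist c x w : `|w| <= c -> `|clip c x - w| <= 2 * `|x - w|.
Proof.
move=> wc; have c0 : 0 <= c by exact: le_trans wc.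
suff h : `|clip c x - x| <= `|x - w|.
  rewrite -(subrK x (clip c x)) -addrA (le_trans (ler_normD _ _))//.
  by rewrite mulr_natl mulr2n lerD2r.
have [->|x0] := eqVneq x 0; first by rewrite /clip scaler0 subrr normr0.
have nx : 0 < `|x| by rewrite normr_gt0.
rewrite /clip -[X in _ *: x - X]scale1r -scalerBl normrZ.
have [xc|cx] := leP `|x| c.
  by rewrite min_l ?subrr ?normr0 ?mul0r// ler_pdivlMr// mul1r.
rewrite min_r; last by rewrite ler_pdivrMr// mul1r ltW.
rewrite distrC ger0_norm; last by rewrite subr_ge0 ler_pdivrMr// mul1r ltW.
rewrite mulrBl mul1r divfK ?gt_eqF//.
have := lerB_dist x w; lra.
Qed.

Lemma clip_dist_bound c x w : `|w| <= c -> `|clip c x - w| <= 2 * c.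
Proof.
move=> wc; have c0 : 0 <= c by exact: le_trans wc.
rewrite (le_trans (ler_normB _ _))// mulr_natl mulr2n lerD//.
exact: norm_clip.
Qed.

Lemma norm_average_le (n : nat) (h : nat -> E) (b : nat -> R) :
  (forall l, `|h l| <= b l) ->
  `|n%:R^-1 *: \sum_(l < n) h l| <= n%:R^-1 * \sum_(l < n) b l.
Proof.
move=> hb; rewrite normrZ ger0_norm ?invr_ge0// ler_wpM2l ?invr_ge0//.
by apply: le_trans (ler_norm_sum _ _ _) _; apply: ler_sum.
Qed.

Lemma average_cst (n : nat) (c : R) : (0 < n)%N ->
  n%:R^-1 * \sum_(l < n) c = c.
Proof.
move=> n0; rewrite sumr_const card_ord -[c *+ n]mulr_natl mulrA mulVf ?mul1r//.
by rewrite pnatr_eq0 -lt0n.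
Qed.

End Clip.

Section Inner.
Context {R : realType} {E : completeNormedModType R} {Xi : Type}.
Variables (tau : E -> Xi -> E) (T : E -> E) (beta gamma : R) (k : nat).
Hypothesis gamma0 : 0 <= gamma.
Hypothesis lipT : forall x y, `|T x - T y| <= gamma * `|x - y|.
Variables (z T0 : E) (n m : nat) (s : nat -> Xi).
Hypothesis n0 : (0 < n)%N.
Hypothesis lam01 : 0 <= lambda_ beta k <= 1.
Local Notation lam := (lambda_ beta k).
Local Notation rho := (rho_ beta gamma k).
Local Notation point j := (inner tau beta gamma k z T0 n m s j).1.
Local Notation est j := (inner tau beta gamma k z T0 n m s j).2.

(** The flat index [p] runs over all clipped copies of the epoch: [p %/ n] is the inner step, and
    copy [p] reads its seeds from position [p * m]. This is the order in which [sequential_prod]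
    consumes them. *)
Definition step_error (p : nat) : R :=
  `| clip (gamma * `|point (p %/ n).+1 - point (p %/ n)|)
       (mean_difference tau m (point (p %/ n).+1) (point (p %/ n))
          (shift s (p * m))) - (T (point (p %/ n).+1) - T (point (p %/ n))) |.

Lemma pointS j : point j.+1 = lam *: z + (1 - lam) *: est j.
Proof. by rewrite /=; case: inner. Qed.

Lemma estS j : est j.+1 = est j + n%:R^-1 *: \sum_(l < n)
  clip (gamma * `|point j.+1 - point j|) (mean_difference tau m (point j.+1)
    (point j) (shift s ((j * n + l) * m))).
Proof. by rewrite pointS /=; case: inner. Qed.

Lemma est_step j : `|est j.+1 - est j| <= gamma * `|point j.+1 - point j|.
Proof.
rewrite estS addrAC subrr add0r.
have h (l : nat) := @norm_clip _ E (gamma * `|point j.+1 - point j|)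
  (mean_difference tau m (point j.+1) (point j) (shift s ((j * n + l) * m)))
  (mulr_ge0 gamma0 (normr_ge0 _)).
by apply: le_trans (norm_average_le _ h) _; rewrite average_cst.
Qed.

(** A pathwise bound: clipping at level gamma makes the estimates gamma-Lipschitz along the iterates
    whatever the seeds, and averaging contributes the factor 1 - lambda. *)
Lemma point_step j :
  `|point j.+1 - point j| <= rho ^+ j * ((1 - lam) * `|T0 - z|).
Proof.
have l1 : 0 <= 1 - lam by case/andP: lam01; lra.
elim: j => [|j IH].
  rewrite pointS /= expr0 mul1r -[X in _ - X]scale1r -addrAC -scalerBl.
  have -> : (lam - 1) *: z + (1 - lam) *: T0 = (1 - lam) *: (T0 - z).
    by rewrite -opprB scaleNr scalerBr addrC.
  by rewrite normrZ ger0_norm.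
have -> : point j.+2 - point j.+1 = (1 - lam) *: (est j.+1 - est j).
  by rewrite pointS (pointS j) opprD addrACA subrr add0r -scalerBr.
rewrite normrZ ger0_norm// exprS -mulrA {1}/rho_ (mulrC gamma).
rewrite -[X in _ <= X]mulrA ler_wpM2l//.
by apply: le_trans (est_step j) _; rewrite ler_wpM2l.
Qed.

(** The error telescopes over the inner steps; each increment is an average over [n] copies, which
    gives the common factor 1 / n. *)
Lemma est_error j :
  `|est j - T (point j)| <=
  `|T0 - T z| + n%:R^-1 * \sum_(p < j * n) step_error p.
Proof.
elim: j => [|j IH]; first by rewrite big_ord0 mulr0 addr0.
have -> : est j.+1 - T (point j.+1) = (est j - T (point j)) +
    (est j.+1 - est j - (T (point j.+1) - T (point j))).
  have group4 (a b c d : E) : c - d = (a - b) + (c - a - (d - b)).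
    by rewrite [RHS]addrACA [a + _]addrC subrK -opprD [b + _]addrC subrK.
  exact: group4.
apply: le_trans (ler_normD _ _) _.
rewrite mulSnr big_split_ord/= mulrDr addrA lerD//.
have -> : est j.+1 - est j - (T (point j.+1) - T (point j)) =
    n%:R^-1 *: \sum_(l < n) (clip (gamma * `|point j.+1 - point j|)
      (mean_difference tau m (point j.+1) (point j)
         (shift s ((j * n + l) * m))) - (T (point j.+1) - T (point j))).
  rewrite sumrB scalerBr; congr (_ - _).
    by rewrite estS addrAC subrr add0r.
  rewrite sumr_const card_ord -[X in _ = _ *: X]scaler_nat scalerA.
  rewrite mulVf ?scale1r//.
  by rewrite pnatr_eq0 -lt0n.
rewrite normrZ ger0_norm ?invr_ge0// ler_wpM2l ?invr_ge0//.
apply: le_trans (ler_norm_sum _ _ _) _; apply: ler_sum => l _.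
by rewrite /step_error divnMDl// divn_small// addn0.
Qed.

Lemma step_error_ge0 p : 0 <= step_error p.
Proof. exact: normr_ge0. Qed.

Lemma step_error_le p :
  step_error p <= 2 * (gamma * (rho ^+ (p %/ n) * ((1 - lam) * `|T0 - z|))).
Proof.
apply: le_trans (clip_dist_bound _ (lipT _ _)) _.
by rewrite ler_pM2l// ler_wpM2l// point_step.
Qed.

End Inner.

(** From exp(-u) >= (1 - u/2)^2 and the identity (1 + 3u)(1 - u/2)^2 - 1 = u (1 - u) (2 - 3u/4). *)
Lemma expR_le_affine {R : realType} (u : R) : 0 <= u <= 1 -> expR u <= 1 + 3 * u.
Proof.
move=> /andP[u0 u1].
have h : (1 - u / 2) ^+ 2 <= expR (- u).
  have -> : - u = 2%:R * (- u / 2) by field.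
  rewrite expRM_natl; apply: lerXn2r; rewrite ?nnegrE ?expR_ge0//; first lra.
  by apply: le_trans (expR_ge1Dx _); lra.
have v0 : 0 < (1 - u / 2) ^+ 2 by rewrite exprn_gt0//; lra.
rewrite -[expR u]invrK -expRN.
apply: (@le_trans _ _ ((1 - u / 2) ^+ 2)^-1).
  by rewrite lef_pV2 ?posrE ?expR_gt0.
rewrite -[leLHS]mul1r ler_pdivrMr//.
suff : 0 <= u * (1 - u) * (2 - 3 / 4 * u) by lra.
by rewrite !mulr_ge0//; lra.
Qed.

Section Mgf.
Context {d : measure_display} {T : measurableType d} {R : realType}.
Variable P : probability T R.

(** Only the range and the mean enter, no variance: on [0, b] the exponential lies below an affine
    function. This is enough because the mean is itself as small as the error aimed at. *)
Lemma mgf_le (X : T -> R) (a b : R) : measurable_fun setT X ->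
  (forall t, 0 <= X t <= b) -> 0 < b -> (\int[P]_t (X t)%:E <= a%:E)%E ->
  (\int[P]_t (expR (X t / b))%:E <= (expR (3 * a / b))%:E)%E.
Proof.
move=> mX Xb b0 Xa.
have X0 t : 0 <= X t by case/andP: (Xb t).
apply: (@le_trans _ _ (\int[P]_t (1%:E + (3 / b)%:E * (X t)%:E))%E).
  apply: ge0_le_integral => //.
  - apply/measurable_EFinP; apply: measurableT_comp => //.
    exact: measurable_funM.
  - apply: emeasurable_funD => //; apply: emeasurable_funM => //.
    exact/measurable_EFinP.
  - move=> t _; rewrite -EFinM -EFinD lee_fin mulrAC -mulrA.
    apply: expR_le_affine; case/andP: (Xb t) => h1 h2.
    by rewrite divr_ge0 ?(ltW b0)//= ler_pdivrMr ?mul1r.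
rewrite ge0_integralD//; last 2 first.
- by move=> t _; rewrite -EFinM lee_fin mulr_ge0// divr_ge0// ltW.
- by apply: emeasurable_funM => //; exact/measurable_EFinP.
rewrite integral_cst//= probability_setT mule1 ge0_integralZl_EFin//; last 3 first.
- by move=> t _; rewrite lee_fin.
- exact/measurable_EFinP.
- by rewrite divr_ge0// ltW.
apply: (@le_trans _ _ (1 + 3 * a / b)%:E); last by rewrite lee_fin expR_ge1Dx.
rewrite [X in (_ <= X)%E]EFinD leeD2l// mulrAC [X in (_ <= X)%E]EFinM.
by apply: lee_wpmul2l; rewrite // lee_fin divr_ge0// ltW.
Qed.

End Mgf.

Section ClippedMean.
Context {R : realType} {E : completeNormedModType R}.
Context {d : measure_display} {Xi : measurableType d}.
Hypothesis sepE : separable_space E.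
Variables (D : probability Xi R) (mu : probability (stream Xi) R).
Hypothesis muD : iid_law D mu.
Variables (N : E -> R) (B C : R).
Hypothesis smoothN : smoothable_by N B C.
Variable tau : E -> Xi -> E.
Hypothesis mtau : jointly_measurable tau.
Variables (T : E -> E) (L gamma : R).
Hypothesis gamma0 : 0 <= gamma.
Hypothesis lipT : forall x y, `|T x - T y| <= gamma * `|x - y|.
Hypothesis meanT : forall x, weak_mean D (tau x) (T x).
Hypothesis lip2 : forall x y, (\int[D]_z (`|tau x z - tau y z| ^+ 2)%:E
   <= (L ^+ 2 * `|x - y| ^+ 2)%:E)%E.
Local Notation stream := (stream Xi).
Let kappa := B * C ^+ 2.
Let Lam2 := 2 * (L ^+ 2 + gamma ^+ 2).

(** The factor 2 in [Lam2] comes from |a - b|^2 <= 2 |a|^2 + 2 |b|^2; a general norm does not bound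
    a centred second moment by the raw one. *)
Lemma difference_variance x y :
  (\int[D]_z (`|tau x z - tau y z - (T x - T y)| ^+ 2)%:E <=
   (Lam2 * `|x - y| ^+ 2)%:E)%E.
Proof.
have mx := open_meas_tau1 mtau x; have my := open_meas_tau1 mtau y.
have mxy : open_meas (fun z => tau x z - tau y z) by exact: open_measB.
have m1 : measurable_fun setT (fun z => `|tau x z - tau y z| ^+ 2).
  by apply: measurable_funX; exact: measurable_norm.
apply: (@le_trans _ _ (\int[D]_z (2%:E * (`|tau x z - tau y z| ^+ 2)%:E +
   (2 * `|T x - T y| ^+ 2)%:E))%E).
  apply: ge0_le_integral => //.
  - apply/measurable_EFinP/measurable_funX/measurable_norm.
    by apply: open_measB => //; exact: open_meas_cst.
  - by apply: emeasurable_funD => //; apply: emeasurable_funM => //;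
      exact/measurable_EFinP.
  - move=> z _; rewrite -EFinM -EFinD lee_fin.
    set a := tau x z - tau y z; set b := T x - T y.
    have h := ler_normB a b.
    have : `|a - b| ^+ 2 <= (`|a| + `|b|) ^+ 2.
      by apply: lerXn2r; rewrite ?nnegrE ?addr_ge0.
    have := sqr_ge0 (`|a| - `|b|); lra.
rewrite ge0_integralD//; last first.
  by apply: emeasurable_funM => //; exact/measurable_EFinP.
rewrite integral_cst//= probability_setT mule1 ge0_integralZl_EFin//; last first.
  exact/measurable_EFinP.
apply: (@le_trans _ _ (2%:E * (L ^+ 2 * `|x - y| ^+ 2)%:E +
    (2 * (gamma ^+ 2 * `|x - y| ^+ 2))%:E)%E).
  apply: leeD.
    by apply: lee_wpmul2l => //; rewrite lee_fin.
  rewrite lee_fin ler_pM2l// -exprMn; apply: lerXn2r; rewrite ?nnegrE//.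
  by rewrite mulr_ge0.
by rewrite -EFinM -EFinD lee_fin /Lam2; lra.
Qed.

Definition clip_error m y' y (s : stream) : R :=
  `|clip (gamma * `|y' - y|) (mean_difference tau m y' y s) - (T y' - T y)|.

Lemma measurable_clip_error m y' y : measurable_fun setT (clip_error m y' y).
Proof.
apply: measurable_norm => //; apply: open_measB => //; last exact: open_meas_cst.
apply: open_meas_clip => //.
apply: (@open_meas_mean_difference _ _ _ _ _ stream sepE tau mtau m
  (fun=> y') (fun=> y) id) => //; exact: open_meas_cst.
Qed.

(** The bias of clipping needs no separate treatment: [clip_dist] compares the clipped average with
    the true increment at the cost of the factor 2. *)
Lemma clip_error_mean m y' y u : (0 < m)%N -> 0 <= u ->
  kappa * (Lam2 * `|y' - y| ^+ 2) / m%:R <= u ^+ 2 ->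
  (\int[mu]_s (clip_error m y' y s)%:E <= (2 * u)%:E)%E.
Proof.
move=> m0 u0 hu.
have mf : open_meas (fun z => tau y' z - tau y z).
  by apply: open_measB => //; exact: (open_meas_tau1 mtau).
have mean := weak_meanB (meanT y') (meanT y).
have := average_mean sepE muD smoothN mf mean (difference_variance y' y) m0 u0 hu.
have mm : open_meas (fun s : stream =>
    mean_difference tau m y' y s - (T y' - T y)).
  apply: open_measB => //; last exact: open_meas_cst.
  apply: (@open_meas_mean_difference _ _ _ _ _ stream sepE tau mtau m
    (fun=> y') (fun=> y) id) => //; exact: open_meas_cst.
move=> hmean.
apply: (@le_trans _ _ (\int[mu]_s (2%:E *
   (`|mean_difference tau m y' y s - (T y' - T y)|)%:E))%E).
  apply: ge0_le_integral => //.
  - by move=> s _; rewrite lee_fin normr_ge0.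
  - by apply/measurable_EFinP; exact: measurable_clip_error.
  - by apply: emeasurable_funM => //; apply/measurable_EFinP; exact: measurable_norm.
  - by move=> s _; rewrite -EFinM lee_fin; apply: clip_dist.
rewrite ge0_integralZl_EFin//; last first.
  by apply/measurable_EFinP; exact: measurable_norm.
by rewrite EFinM lee_wpmul2l// lee_fin.
Qed.

End ClippedMean.

Lemma sum_divn_geometric {R : realType} (r : R) (n J : nat) : (0 < n)%N ->
  (1 - r) * \sum_(p < J * n) r ^+ (p %/ n) = n%:R * (1 - r ^+ J).
Proof.
move=> n0; elim: J => [|J IH]; first by rewrite big_ord0 expr0 subrr !mulr0.
rewrite mulSnr big_split_ord/= mulrDr IH.
under eq_bigr => l _ do rewrite divnMDl// divn_small// addn0.
rewrite sumr_const card_ord -[_ *+ n]mulr_natr exprS; ring.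
Qed.

Section Schedule.
Context {R : realType} (beta : R).
Hypothesis beta01 : 0 < beta < 1.

Lemma eps_gt0 k : 0 < eps_ beta k.
Proof. by rewrite exprn_gt0//; case/andP: beta01. Qed.

Lemma lambda_bounds k : 0 < lambda_ beta k < 1.
Proof.
have := eps_gt0 k; rewrite /eps_ -/(lbar_ beta k) /lambda_ => l0.
by rewrite divr_gt0 ?addr_gt0//= ltr_pdivrMr ?addr_gt0// mul1r ltrDr.
Qed.

Lemma rho_bounds gamma k : 0 < gamma <= 1 -> 0 < rho_ beta gamma k < 1.
Proof.
move=> /andP[g0 g1]; have /andP[l0 l1] := lambda_bounds k.
by rewrite /rho_ mulr_gt0 ?subr_gt0//=; nra.
Qed.

End Schedule.

(** With [e] for eps_k, [h] for 1 - rho and [r] for rho^j, the first factor on the right is the mean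
    bound [u] of [epoch_tail] and the second is the quantity that [m_] rounds up: [m_] is chosen so
    that the mean error of step j decays like rho^j. *)
Lemma step_variance_identity {F : fieldType} (K r l x e h : F) :
  2%:R != 0 :> F -> x != 0 -> e != 0 -> h != 0 ->
  K ^+ 2 * (r * (l * x)) ^+ 2 =
  (K * r * l * e * h / 2) ^+ 2 * (4 * x ^+ 2 / (e ^+ 2 * h ^+ 2)).
Proof. by move=> *; field; do ?[apply/andP; split]. Qed.

Lemma product_reorder {F : comRingType} (K l e n x : F) :
  K * l * e * (n * x) = n * K * e * (l * x).
Proof. ring. Qed.

Lemma step_mean_identity {F : fieldType} (K r l e h : F) : 2%:R != 0 :> F ->
  2 * (K * r * l * e * h / 2) = K * l * e * (h * r).
Proof. by move=> ?; field. Qed.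

Section EpochTail.
Context {R : realType} {E : completeNormedModType R}.
Context {d : measure_display} {Xi : measurableType d}.
Hypothesis sepE : separable_space E.
Variables (D : probability Xi R) (mu : probability (stream Xi) R).
Hypothesis muD : iid_law D mu.
Variables (N : E -> R) (B C : R).
Hypothesis smoothN : smoothable_by N B C.
Variable tau : E -> Xi -> E.
Hypothesis mtau : jointly_measurable tau.
Variables (T : E -> E) (L gamma : R).
Hypothesis gamma01 : 0 < gamma <= 1.
Hypothesis lipT : forall x y, `|T x - T y| <= gamma * `|x - y|.
Hypothesis meanT : forall x, weak_mean D (tau x) (T x).
Hypothesis lip2 : forall x y, (\int[D]_z (`|tau x z - tau y z| ^+ 2)%:E
   <= (L ^+ 2 * `|x - y| ^+ 2)%:E)%E.
Variables (beta delta : R) (k : nat).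
Hypotheses (beta01 : 0 < beta < 1) (delta0 : 0 < delta_ beta delta k < 1).
Local Notation stream := (stream Xi).
Local Notation lam := (lambda_ beta k).
Local Notation rho := (rho_ beta gamma k).
Local Notation eps := (eps_ beta k).

(** The whole error budget of an epoch. By [est_error] and nonnegativity of the terms it controls
    the estimates of all inner steps at once, so no union over the steps is taken. *)
Definition path_error z T0 n m J (s : stream) : R :=
  n%:R^-1 * \sum_(p < J * n) step_error tau T beta gamma k z T0 n m s p.

Lemma continuous_lip : continuous T.
Proof.
have /andP[g0 g1] := gamma01.
move=> x; apply/cvgrPdist_le => e e0.
apply/nbhs_ballP; exists e => //= y; rewrite -ball_normE/= => /ltW xy.
apply: le_trans (lipT _ _) _; apply: le_trans xy.
by rewrite ler_piMl.
Qed.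

Lemma measurable_step_error {dW} {W : measurableType dW} (z T0 : W -> E) n m
    (s : W -> stream) p :
  open_meas z -> open_meas T0 -> measurable_fun setT s ->
  measurable_fun setT (fun w =>
    step_error tau T beta gamma k (z w) (T0 w) n m (s w) p).
Proof.
move=> mz mT ms.
have mp j := (open_meas_inner sepE mtau beta gamma k n m j mz mT ms).1.
have mTp j := open_meas_comp continuous_lip (mp j).
apply: measurable_norm => //; apply: open_measB => //; last exact: open_measB.
apply: open_meas_clip => //.
  apply: measurable_funM; first exact: measurable_cst.
  by apply: measurable_norm => //; exact: open_measB.
have ms' : measurable_fun setT (fun w => shift (s w) (p * m) : stream).
  exact: measurable_shift.
exact: (open_meas_mean_difference sepE mtau m (mp (p %/ n).+1%N) (mp (p %/ n)%N) ms').
Qed.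

Lemma measurable_path_error {dW} {W : measurableType dW} (z T0 : W -> E)
    (n m : W -> nat) J (s : W -> stream) :
  open_meas z -> open_meas T0 -> measurable_fun setT s ->
  measurable_fun setT n -> measurable_fun setT m ->
  measurable_fun setT (fun w => path_error (z w) (T0 w) (n w) (m w) J (s w)).
Proof.
move=> mz mT ms mn mm.
apply: (measurable_fun_select (g := n)
  (h := fun n w => path_error (z w) (T0 w) n (m w) J (s w))) => // n'.
apply: (measurable_fun_select (g := m)
  (h := fun m w => path_error (z w) (T0 w) n' m J (s w))) => // m'.
apply: measurable_funM; first exact: measurable_cst.
elim: (J * n')%N => [|q IH].
  rewrite (_ : (fun w => _) = cst 0); first exact: measurable_cst.
  by apply/funext => w; rewrite big_ord0.
rewrite (_ : (fun w => _) = (fun w =>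
    \sum_(p < q) step_error tau T beta gamma k (z w) (T0 w) n' m' (s w) p +
    step_error tau T beta gamma k (z w) (T0 w) n' m' (s w) q)).
  by apply: measurable_funD => //; exact: measurable_step_error.
by apply/funext => w; rewrite big_ord_recr.
Qed.

(** The next point is built from the current estimate, so both endpoints of an inner step are fixed
    before any seed of that step is read. *)
Lemma point_agree (z T0 : E) n m (s s' : stream) p : agree (p * m) s s' ->
  (inner tau beta gamma k z T0 n m s (p %/ n)).1 =
  (inner tau beta gamma k z T0 n m s' (p %/ n)).1 /\
  (inner tau beta gamma k z T0 n m s (p %/ n).+1).1 =
  (inner tau beta gamma k z T0 n m s' (p %/ n).+1).1.
Proof.
move=> ss'; rewrite !pointS.
have -> // : inner tau beta gamma k z T0 n m s (p %/ n) =
  inner tau beta gamma k z T0 n m s' (p %/ n).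
apply: inner_agree; apply: (agreeS _ ss').
by rewrite mulnA leq_mul2r leq_divM orbT.
Qed.

Lemma step_error_agree (z T0 : E) n m (s s' : stream) p :
  agree (p.+1 * m) s s' ->
  step_error tau T beta gamma k z T0 n m s p =
  step_error tau T beta gamma k z T0 n m s' p.
Proof.
move=> ss'; rewrite /step_error.
have [|-> ->] := @point_agree z T0 n m s s' p.
  by apply: (agreeS _ ss'); rewrite leq_mul2r leqnSn orbT.
congr (`|clip _ (_ *: _) - _|); apply: eq_bigr => i _; rewrite /shift.
have -> // : s (p * m + i)%N = s' (p * m + i)%N.
by apply: ss'; rewrite mulSnr ltn_add2l.
Qed.

(* If [X] is the sum of the [J * n] errors, [expR (X / b)] is estimated with [b]
   the largest possible error; [n_] is the number of copies that makes the tail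
   [delta_ / 2] and [m_] makes the geometric sum of the means [O(n eps_)]. *)
Lemma epoch_tail (z T0 : E) J (n := n_ beta delta gamma k `|T0 - z|)
    (m := m_ beta gamma k `|T0 - z|) :
  (mu [set s | ((3 * Num.sqrt (B * C ^+ 2 * (2 * (L ^+ 2 + gamma ^+ 2))) + 3)
     * eps < path_error z T0 n m J s)%R] <= (delta_ beta delta k / 2)%:E)%E.
Proof.
have /andP[g0 g1] := gamma01; have g0' := ltW g0.
have /andP[l0 l1] := lambda_bounds beta01 k.
have l01 : 0 <= lam <= 1 by rewrite !ltW.
have l1' : 0 <= 1 - lam by rewrite subr_ge0 ltW.
have /andP[r0 r1] := rho_bounds beta01 k gamma01.
have e0 := eps_gt0 beta01 k.
have /andP[dl0 dl1] := delta0.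
set K := Num.sqrt _; have K0 : 0 <= K by exact: sqrtr_ge0.
set Rt := `|T0 - z| in n m *.
have n0 : (0 < n)%N by rewrite /n /n_ leq_max.
have X0 s p : 0 <= step_error tau T beta gamma k z T0 n m s p.
  exact: step_error_ge0.
have Xle s p : step_error tau T beta gamma k z T0 n m s p <=
    2 * (gamma * (rho ^+ (p %/ n) * ((1 - lam) * Rt))).
  exact: step_error_le.
(* A vanishing residual makes the scale [b] zero, but then all errors of the epoch vanish too. *)
have [Rt0|Rt_neq0] := eqVneq Rt 0.
  rewrite [mkset _](_ : _ = set0).
    by rewrite measure0 lee_fin divr_ge0// ltW.
  apply/seteqP; split => // s /=; apply/negP; rewrite -leNgt.
  rewrite /path_error big1 ?mulr0.
    by rewrite mulr_ge0 ?(ltW e0)// addr_ge0// mulr_ge0.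
  move=> p _; apply/eqP; rewrite eq_le X0 andbT.
  by have := Xle s p; rewrite Rt0 !mulr0.
have Rt_gt0 : 0 < Rt by rewrite lt_def Rt_neq0 normr_ge0.
pose b := 2 * (1 - lam) * gamma * Rt.
have b0 : 0 < b by rewrite /b !mulr_gt0// subr_gt0.
have hm : 4 * Rt ^+ 2 / (eps ^+ 2 * (1 - rho) ^+ 2) <= m%:R.
  by rewrite -ceiln_le.
have r1' : 0 < 1 - rho by rewrite subr_gt0.
have m0 : (0 < m)%N.
  rewrite -(ltr0n R); apply: lt_le_trans hm.
  by rewrite divr_gt0// !mulr_gt0// ?exprn_gt0.
have hn : b * ln (4 / delta_ beta delta k) <= 3 * eps * n%:R.
  have : 2 * (1 - lam) * gamma * Rt * ln (4 / delta_ beta delta k) / (3 * eps)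
      <= n%:R.
    by rewrite -ceiln_le /n /n_ leq_max leqnn orbT.
  by rewrite ler_pdivrMr ?mulr_gt0// [n%:R * _]mulrC.
pose X p (s : stream) := step_error tau T beta gamma k z T0 n m s p.
have mX p : measurable_fun setT (X p).
  apply: (@measurable_step_error _ stream (fun=> z) (fun=> T0) n m id p) => //;
  exact: open_meas_cst.
have Xb p s : 0 <= X p s <= b.
  rewrite X0/=; apply: le_trans (Xle s p) _; rewrite /b -!mulrA ler_pM2l//.
  have rj : rho ^+ (p %/ n) <= 1 by rewrite exprn_ile1// ltW.
  rewrite [leRHS]mulrCA ler_pM2l// ler_piMl//.
  by rewrite mulr_ge0 ?subr_ge0// ltW.
(* Half of the mean error allowed to copy [p]; the other half is the factor 2 lost in
   [clip_error_mean]. The factor 1 - rho cancels the geometric sum. *)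
pose u p := K * rho ^+ (p %/ n) * (1 - lam) * eps * (1 - rho) / 2.
have u0 p : 0 <= u p.
  have rj := exprn_ge0 (p %/ n)%N (ltW r0).
  exact: (divr_ge0 (mulr_ge0 (mulr_ge0 (mulr_ge0 (mulr_ge0 K0 rj) l1') (ltW e0))
    (ltW r1')) (ler0n _ 2)).
have kap0 : 0 <= B * C ^+ 2 * (2 * (L ^+ 2 + gamma ^+ 2)).
  have [_ B1 _ _ _] := smoothN.
  apply: mulr_ge0; last by rewrite mulr_ge0// addr_ge0 ?sqr_ge0.
  by apply: mulr_ge0; [exact: le_trans ler01 B1|exact: sqr_ge0].
have step p s : (\int[mu]_s' (expR (X p (splice (p * m) s s') / b))%:E
    <= (expR (3 * (2 * u p) / b))%:E)%E.
  apply: mgf_le => //.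
    apply: (@measurable_step_error _ stream (fun=> z) (fun=> T0) n m
      (fun s' => splice (p * m) s s') p); try exact: open_meas_cst.
    exact: (measurable_fun_pair2 s (@measurable_splice _ Xi (p * m))).
  pose y := (inner tau beta gamma k z T0 n m s (p %/ n)).1.
  pose y' := (inner tau beta gamma k z T0 n m s (p %/ n).+1).1.
  have eX s' : X p (splice (p * m) s s') = clip_error tau T gamma m y' y s'.
    rewrite /X /step_error shift_splice.
    by have [<- <-] := @point_agree z T0 n m s _ p (@agree_splice _ Xi (p * m)%N s s').
  under eq_integral do rewrite eX.
  apply: (clip_error_mean sepE muD smoothN mtau g0' lipT meanT lip2) => //.
  have yd : `|y' - y| <= rho ^+ (p %/ n) * ((1 - lam) * Rt).
    exact: point_step.
  rewrite ler_pdivrMr ?ltr0n// mulrA -(sqr_sqrtr kap0) -/K.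
  have d2 : `|y' - y| ^+ 2 <= (rho ^+ (p %/ n) * ((1 - lam) * Rt)) ^+ 2.
    apply: lerXn2r; rewrite ?nnegrE//.
    by rewrite !mulr_ge0 ?exprn_ge0 ?subr_ge0// ltW.
  apply: (@le_trans _ _ (K ^+ 2 * (rho ^+ (p %/ n) * ((1 - lam) * Rt)) ^+ 2)).
    by rewrite ler_wpM2l ?sqr_ge0.
  apply: (@le_trans _ _ (u p ^+ 2 *
    (4 * Rt ^+ 2 / (eps ^+ 2 * (1 - rho) ^+ 2)))); last first.
    by rewrite ler_wpM2l ?sqr_ge0.
  rewrite /u -step_variance_identity ?lexx ?gt_eqF ?ltr0n//.
pose S (s : stream) := \sum_(p < J * n) X p s.
have tot : (\int[mu]_s (\prod_(p < J * n) expR (X p s / b))%:E <=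
    (\prod_(p < J * n) expR (3 * (2 * u p) / b))%:E)%E.
  apply: (@sequential_prod _ _ _ D mu muD (fun p (s : stream) => expR (X p s / b))
    (fun p => expR (3 * (2 * u p) / b)) m (J * n)) => //.
  - by move=> p; apply: measurableT_comp => //; exact: measurable_funM.
  - by move=> p s s' ss'; rewrite /X (step_error_agree z T0 n ss').
have eS s : \prod_(p < J * n) expR (X p s / b) = expR (S s / b).
  by rewrite -expR_sum mulr_suml.
(* The exponent left by the means: their geometric sum is at most n K eps_k. *)
pose A := 3 * (n%:R * K * eps) / b.
have leA : \prod_(p < J * n) expR (3 * (2 * u p) / b) <= expR A.
  rewrite -expR_sum ler_expR -mulr_suml -mulr_sumr ler_pM2r ?invr_gt0// ler_pM2l//.
  rewrite (_ : \sum_(i < J * n) 2 * u i = K * (1 - lam) * eps *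
    ((1 - rho) * \sum_(p < J * n) rho ^+ (p %/ n))); last first.
    rewrite !mulr_sumr; apply: eq_bigr => p _; rewrite /u.
    by rewrite step_mean_identity ?gt_eqF ?ltr0n.
  rewrite sum_divn_geometric//.
  have rJ : 0 <= rho ^+ J by rewrite exprn_ge0// ltW.
  have nKe : 0 <= n%:R * K * eps by apply: mulr_ge0 (ltW e0); exact: mulr_ge0.
  have h : (1 - lam) * (1 - rho ^+ J) <= 1.
    rewrite -[leRHS]mulr1; apply: ler_pM => //.
    - by rewrite subr_ge0 exprn_ile1// ltW.
    - by rewrite gerBl ltW.
    - by rewrite gerBl.
  have := ler_wpM2l nKe h; rewrite mulr1; apply: le_trans.
  by rewrite product_reorder.
have mS : measurable_fun setT (fun s : stream => expR (S s / b)).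
  rewrite (_ : (fun s => _) = (fun s => expR (path_error z T0 n m J s * n%:R / b))).
    apply: measurableT_comp => //; apply: measurable_funM => //.
    apply: measurable_funM => //.
    apply: (@measurable_path_error _ stream (fun=> z) (fun=> T0) (fun=> n)
      (fun=> m) J id) => //; exact: open_meas_cst.
  apply/funext => s; rewrite /path_error [n%:R^-1 * _ * n%:R]mulrAC mulVf ?mul1r//.
  by rewrite pnatr_eq0 -lt0n.
(* Exceeding the exponent [A] by ln (2 / delta_k) has probability at most delta_k / 2 by Markov. *)
have mk := @markov_le _ _ _ mu (fun s : stream => expR (S s / b))
  (expR (A + ln (2 / delta_ beta delta k))) (expR A) mS
  (fun s => expR_ge0 _) (expR_gt0 _).
apply: (@le_trans _ _ (expR A / expR (A + ln (2 / delta_ beta delta k)))%:E);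
  last first.
  rewrite lee_fin expRD lnK ?posrE ?divr_gt0// invfM mulrA divff ?gt_eqF ?expR_gt0//.
  by rewrite mul1r invf_div.
apply: le_trans (mk _); last first.
  by under eq_integral do rewrite -eS; apply: le_trans tot _; rewrite lee_fin.
have mpe : measurable_fun setT (path_error z T0 n m J).
  apply: (@measurable_path_error _ stream (fun=> z) (fun=> T0) (fun=> n)
      (fun=> m) J id) => //; exact: open_meas_cst.
apply: le_measure.
- apply: mem_set; rewrite (_ : mkset _ = path_error z T0 n m J
    @^-1` `](3 * K + 3) * eps, +oo[); last first.
    by apply/seteqP; split => s /=; rewrite in_itv/= andbT.
  by rewrite -[X in measurable X]setTI; exact: mpe.
- apply: mem_set; rewrite (_ : mkset _ = (fun s : stream => expR (S s / b))
    @^-1` `[expR (A + ln (2 / delta_ beta delta k)), +oo[); last first.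
    by apply/seteqP; split => s /=; rewrite in_itv/= andbT.
  by rewrite -[X in measurable X]setTI; exact: mS.
(* Multiplied by [b], the threshold is 3 n K eps_k + b ln (2 / delta_k), and the choice of [n_]
   bounds the last term by 3 n eps_k; hence the level 3 K + 3. *)
move=> s /= big; rewrite ler_expR ler_pdivlMr// mulrDl /A divfK ?gt_eqF//.
have n0' : 0 < n%:R :> R by rewrite ltr0n.
have SE : S s = n%:R * path_error z T0 n m J s.
  by rewrite /path_error mulrA divff ?mul1r// gt_eqF.
have ln24 : ln (2 / delta_ beta delta k) <= ln (4 / delta_ beta delta k).
  by rewrite ler_ln ?posrE ?divr_gt0// ler_pM2r ?invr_gt0// ler_nat.
have h1 := ler_wpM2l (ltW b0) ln24.
have h2 : n%:R * ((3 * K + 3) * eps) <= S s.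
  by rewrite SE ler_pM2l// ltW.
rewrite [_ * b]mulrC; clear -h1 h2 hn; lra.
Qed.

End EpochTail.

(** * Contraction of the residual *)

Lemma ceiln_leD1 {R : realType} (x : R) : 0 <= x -> (ceiln x)%:R <= x + 1.
Proof.
move=> x0; have c0 : 0 <= Num.ceil x by rewrite ceil_ge0 (lt_le_trans _ x0).
rewrite /ceiln max_r// pmulrn gez0_abs// -lerBlDr.
by have := ceilB1_lt x; rewrite intrB => /ltW.
Qed.

Section EpochLength.
Context {R : realType} (beta gamma : R) (k : nat).
Hypotheses (beta01 : 0 < beta < 1) (gamma01 : 0 < gamma <= 1).
Local Notation rho := (rho_ beta gamma k).

Lemma J_E : J_ beta gamma k = ceiln (ln beta / ln rho).
Proof. by rewrite /J_ /rho_ [gamma * _]mulrC. Qed.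

Lemma J_gt0 : (0 < J_ beta gamma k)%N.
Proof.
have /andP[r0 r1] := rho_bounds beta01 k gamma01.
have /andP[b0 b1] := beta01.
rewrite ltnNge J_E ceiln_le -ltNge.
by rewrite nmulr_rgt0 ?invr_lt0 ln_lt0 ?r0 ?b0.
Qed.

Lemma rho_J : rho ^+ J_ beta gamma k <= beta.
Proof.
have /andP[r0 r1] := rho_bounds beta01 k gamma01.
have /andP[b0 b1] := beta01.
rewrite -ler_ln ?posrE ?exprn_gt0// lnXn// -[leLHS]mulr_natl.
have lr : ln rho < 0 by rewrite ln_lt0 ?r0.
have : ln beta / ln rho <= (J_ beta gamma k)%:R by rewrite -ceiln_le J_E.
by rewrite ler_ndivrMr.
Qed.

(** From -ln rho >= 1 - rho, with 1 added for rounding. As lambda_k > 0, rho < 1 even for gamma =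
    1. *)
Lemma J_le : (J_ beta gamma k)%:R <= 1 + ln (1 / beta) / (1 - rho).
Proof.
have /andP[r0 r1] := rho_bounds beta01 k gamma01.
have /andP[b0 b1] := beta01.
have lb : 0 < ln (1 / beta) by rewrite ln_gt0// ltr_pdivlMr ?mul1r.
have lr : 1 - rho <= - ln rho.
  rewrite lerNr opprB -[rho in ln rho](subrK 1) addrC.
  by rewrite le_ln1Dx// ltrBrDr addNr.
have lr0 : 0 < - ln rho by apply: lt_le_trans lr; rewrite subr_gt0.
have e : ln beta / ln rho = ln (1 / beta) / - ln rho.
  by rewrite ln_div ?posrE// ln1 sub0r invrN mulrNN.
rewrite J_E addrC; apply: le_trans (ceiln_leD1 _) _.
  by rewrite e divr_ge0// ltW.
by rewrite lerD2r e ler_pM2l// lef_pV2 ?posrE// subr_gt0.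
Qed.

(** [lbar_] and [eps_] are the same power of beta; this coincidence balances averaging against the
    error level in the next section. *)
Lemma one_sub_lambda : (1 - lambda_ beta k) / lambda_ beta k = (eps_ beta k)^-1.
Proof.
have e0 := eps_gt0 beta01 k; rewrite /lambda_ /lbar_ -/(eps_ beta k).
by field; rewrite !gt_eqF// addr_gt0.
Qed.

Lemma lambda_le_eps : lambda_ beta k <= eps_ beta k.
Proof.
have e0 := eps_gt0 beta01 k; rewrite /lambda_ /lbar_ -/(eps_ beta k).
by rewrite ler_pdivrMr ?addr_gt0// ler_peMr ?lerDl// ltW.
Qed.

End EpochLength.

Section EpochContraction.
Context {R : realType} {E : completeNormedModType R} {Xi : Type}.
Variables (tau : E -> Xi -> E) (T : E -> E) (beta gamma : R) (k : nat).
Hypotheses (beta01 : 0 < beta < 1) (gamma01 : 0 < gamma <= 1).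
Hypothesis lipT : forall x y, `|T x - T y| <= gamma * `|x - y|.
Variable xstar : E.
Hypothesis fixT : T xstar = xstar.
Variables (z T0 : E) (n m : nat) (s : nat -> Xi) (e : R) (J : nat).
Hypothesis n0 : (0 < n)%N.
Hypothesis J0 : (0 < J)%N.
Local Notation lam := (lambda_ beta k).
Local Notation rho := (rho_ beta gamma k).
Local Notation point j := (inner tau beta gamma k z T0 n m s j).1.
Local Notation est j := (inner tau beta gamma k z T0 n m s j).2.
Hypothesis est_close : forall j, (j <= J)%N -> `|est j - T (point j)| <= e.

Lemma dist_to_fixpoint x : `|T x - xstar| <= `|x - xstar|.
Proof.
have /andP[g0 g1] := gamma01.
by rewrite -{1}fixT (le_trans (lipT _ _))// ler_piMl.
Qed.

Lemma est_dist j : (j <= J)%N -> `|est j - xstar| <= e + `|point j - xstar|.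
Proof.
move=> jJ; rewrite -(subrK (T (point j)) (est j)) -addrA.
apply: le_trans (ler_normD _ _) _; apply: lerD; first exact: est_close.
exact: dist_to_fixpoint.
Qed.

Lemma e_ge0 : 0 <= e.
Proof. exact: le_trans (normr_ge0 _) (est_close (leq0n J)). Qed.

(** The recursion a -> lam |z - x_*| + (1 - lam)(e + a) has the fixed point |z - x_*| + e (1 - lam)
    / lam, and (1 - lam) / lam = 1 / eps_k. Averaging with the anchor [z] keeps the errors from
    accumulating even when [T] is merely nonexpansive. *)
Lemma point_dist j : (j <= J)%N ->
  `|point j - xstar| <= `|z - xstar| + e / eps_ beta k.
Proof.
have /andP[l0 l1] := lambda_bounds beta01 k.
have eps0 := eps_gt0 beta01 k.
have l1' : 0 <= 1 - lam by rewrite subr_ge0 ltW.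
elim: j => [_|j IH jJ]; first by rewrite /= lerDl divr_ge0 ?e_ge0// ltW.
have -> : point j.+1 - xstar = lam *: (z - xstar) + (1 - lam) *: (est j - xstar).
  rewrite pointS !scalerBr addrACA -opprD -scalerDl.
  by rewrite addrCA subrr addr0 scale1r.
apply: le_trans (ler_normD _ _) _; rewrite (normrZ lam) (normrZ (1 - lam)) (ger0_norm (ltW l0)) (ger0_norm l1').
have h := le_trans (est_dist (ltnW jJ)) (lerD (lexx e) (IH (ltnW jJ))).
apply: le_trans (lerD (lexx _) (ler_wpM2l l1' h)) _.
rewrite -(one_sub_lambda k beta01).
by rewrite le_eqVlt; apply/orP; left; apply/eqP; field; rewrite gt_eqF.
Qed.

(** With t the estimate at step J - 1, y_J = t - lam (t - z). The residual splits into T y_J - T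
    y_{J-1}, which has decayed like rho^J, the error of t, and lam (t - z), controlled by the
    distances to x_*. *)
Lemma residual_contraction :
  `|T (point J) - point J| <=
  2 * eps_ beta k * `|z - xstar| + 2 * e + rho ^+ J * `|T0 - z|.
Proof.
have /andP[l0 l1] := lambda_bounds beta01 k.
have /andP[g0 g1] := gamma01.
have l01 : 0 <= lam <= 1 by rewrite !ltW.
case: J J0 est_close point_dist est_dist => // i _ close pdist edist.
have iS : (i <= i.+1)%N by [].
have -> : T (point i.+1) - point i.+1 = (T (point i.+1) - T (point i)) +
    ((T (point i) - est i) + lam *: (est i - z)).
  have -> : point i.+1 = est i - lam *: (est i - z).
    by rewrite pointS scalerBl scale1r scalerBr opprB addrCA.
  have group5 (a b c f : E) : a - (c - f) = (a - b) + ((b - c) + f).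
    rewrite opprB [RHS]addrA [a - b + _]addrA subrK -addrA.
    by congr (_ + _); exact: addrC.
  exact: group5.
apply: le_trans (ler_normD _ _) _; rewrite addrC; apply: lerD; last first.
  apply: le_trans (lipT _ _) _.
  have ps : `|point i.+1 - point i| <= rho ^+ i * ((1 - lam) * `|T0 - z|).
    by apply: point_step => //; exact: ltW.
  apply: le_trans (ler_wpM2l (ltW g0) ps) _.
  by rewrite exprSr /rho_ -!mulrA [_ * (gamma * _)]mulrCA.
apply: le_trans (ler_normD _ _) _.
rewrite [2 * e]mulr_natl mulr2n addrA [leRHS]addrC; apply: lerD.
  by rewrite distrC close.
rewrite normrZ (ger0_norm (ltW l0)).
have h : `|est i - z| <= 2 * `|z - xstar| + e + e / eps_ beta k.
  rewrite -(subrK xstar (est i)) -addrA; apply: le_trans (ler_normD _ _) _.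
  have h1 := edist i iS; have h2 := pdist i iS.
  by rewrite (distrC xstar); lra.
apply: le_trans (ler_wpM2l (ltW l0) h) _.
(* Since lam (1 + 1 / eps_k) = 1, the large term e / eps_k costs only one more [e]. *)
have -> : lam * (2 * `|z - xstar| + e + e / eps_ beta k) =
    2 * lam * `|z - xstar| + e.
  by rewrite -(one_sub_lambda k beta01); field; rewrite gt_eqF.
by rewrite lerD2r ler_wpM2r// ler_pM2l// lambda_le_eps.
Qed.

End EpochContraction.

Lemma ler_sum_widen {R : realType} (F : nat -> R) (a b : nat) :
  (forall i, 0 <= F i) -> (a <= b)%N -> \sum_(i < a) F i <= \sum_(i < b) F i.
Proof.
move=> F0 ab; rewrite -(subnKC ab) big_split_ord/= lerDl.
by apply: sumr_ge0 => i _; exact: F0.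
Qed.

(** The distance to x_* grows linearly in k, so the residual in units of eps_k grows quadratically;
    3 (D0 + M) is large enough for the increment 2 k + 3 of the square to pay for each step. *)
Lemma residual_step {R : realType} (k : nat) (D0 M : R) : 0 <= D0 -> 0 <= M ->
  2 * (D0 + k%:R * M) + 3 * M + k.+1%:R ^+ 2 * (3 * (D0 + M)) <=
  k.+2%:R ^+ 2 * (3 * (D0 + M)).
Proof.
move=> D00 M0; have k0 : 0 <= k%:R :> R by rewrite ler0n.
have h1 := mulr_ge0 k0 D00; have h2 := mulr_ge0 k0 M0.
rewrite -[k.+2%:R]natr1 -[k.+1%:R]natr1; lra.
Qed.

Lemma residual_combine {R : realType} (a1 a2 r e A Y M b q q2 : R) :
  a1 <= b -> a2 <= 2 * e * A + 2 * (M * e) + r -> r <= e * q ->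
  b <= M * e -> e * A <= e * Y -> e * (2 * Y + 3 * M + q) <= e * q2 ->
  a1 + a2 <= e * q2.
Proof. by move=> *; lra. Qed.

Section RunBound.
Context {R : realType} {E : completeNormedModType R}.
Context {dX : measure_display} {Xi : measurableType dX}.
Variables (tau : E -> Xi -> E) (T : E -> E) (x0 xstar : E).
Variables (beta delta gamma Mm Me : R).
Hypotheses (beta01 : 0 < beta < 1) (gamma01 : 0 < gamma <= 1).
Hypothesis lipT : forall x y, `|T x - T y| <= gamma * `|x - y|.
Hypothesis fixT : T xstar = xstar.
Hypotheses (Mm0 : 0 <= Mm) (Me0 : 0 <= Me).
Local Notation run := (vr_ghal tau x0 beta delta gamma).
Local Notation stream := (stream Xi).

Definition mome_ok (s : stream) k :=
  `|st_T (run s k) - T (st_x (run s k))| <= Mm * eps_ beta k.+1.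

Definition epoch_ok (s : stream) k :=
  path_error tau T gamma beta k.+1 (st_x (run s k)) (st_T (run s k))
    (run_n tau x0 beta delta gamma s k) (run_m tau x0 beta delta gamma s k)
    (J_ beta gamma k.+1) (shift s (st_seeds (run s k)))
  <= Me * eps_ beta k.+1.

Let M := Mm + Me.
Let D0 := `|x0 - xstar|.

(** A deterministic induction. [mome_ok k] and [epoch_ok k] control all estimates of epoch k + 1;
    [mome_ok] at k + 1 passes from the true residual at the new point to the estimated one, which
    the sample sizes see. *)
Lemma run_bound s k :
  (forall i, (i <= k)%N -> mome_ok s i) ->
  (forall i, (i < k)%N -> epoch_ok s i) ->
  `|st_x (run s k) - xstar| <= D0 + k%:R * M /\
  residual (run s k) <= eps_ beta k * (k.+1%:R ^+ 2 * (3 * (D0 + M))).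
Proof.
have /andP[b0 b1] := beta01; have /andP[g0 g1] := gamma01.
have M0 : 0 <= M by exact: addr_ge0.
have D00 : 0 <= D0 by exact: normr_ge0.
elim: k => [|k IH] hm he.
  split; first by rewrite /= mul0r addr0.
  rewrite /residual {1}/eps_ expr0 mul1r expr1n mul1r.
  rewrite -(subrK (T x0) (st_T _)) -addrA; apply: le_trans (ler_normD _ _) _.
  have h0 := hm 0%N (leqnn _); rewrite /mome_ok /= in h0.
  have eps1 : eps_ beta 1 <= 1 by rewrite /eps_ expr1 ltW.
  have hM : Mm * eps_ beta 1 <= Mm by rewrite ler_piMr.
  have hT : `|T x0 - x0| <= 2 * D0.
    rewrite -(subrK xstar (T x0)) -addrA; apply: le_trans (ler_normD _ _) _.
    rewrite (distrC xstar) mulr_natl mulr2n lerD2r.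
    exact: (dist_to_fixpoint gamma01 lipT fixT).
  have MmM : Mm <= M by rewrite lerDl.
  rewrite /=; move: h0 hM hT MmM D00 M0; set u := `|_|; set v := `|_|.
  by move=> *; lra.
have [IH1 IH2] := IH (fun i ik => hm i (leqW ik)) (fun i ik => he i (ltnW ik)).
have hmk := hm k (leqnSn k); have hek := he k (ltnSn k).
have hmS := hm k.+1 (leqnn _).
rewrite /mome_ok in hmk; rewrite /epoch_ok in hek.
have e0 := eps_gt0 beta01 k.+1.
have n0 : (0 < run_n tau x0 beta delta gamma s k)%N by rewrite leq_max.
have J0 := J_gt0 k.+1 beta01 gamma01.
set z := st_x (run s k) in IH1 hmk hek.
set T0 := st_T (run s k) in hmk hek.
set n := run_n _ _ _ _ _ _ _ in hek n0.
set m := run_m tau x0 beta delta gamma s k in hek.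
set J := J_ beta gamma k.+1 in hek J0.
set s' := shift s (st_seeds (run s k)) in hek.
have close j : (j <= J)%N ->
    `|(inner tau beta gamma k.+1 z T0 n m s' j).2 -
      T (inner tau beta gamma k.+1 z T0 n m s' j).1| <= M * eps_ beta k.+1.
  move=> jJ; apply: le_trans (est_error _ _ _ _ _ _ _ _ _ n0 j) _.
  rewrite /M mulrDl; apply: lerD; first exact: hmk.
  apply: le_trans hek; rewrite /path_error ler_wpM2l ?invr_ge0//.
  apply: ler_sum_widen; last by rewrite leq_mul2r jJ orbT.
  by move=> i; exact: step_error_ge0.
have l01 : 0 <= lambda_ beta k.+1 <= 1.
  by have /andP[? ?] := lambda_bounds beta01 k.+1; rewrite !ltW.
have xE : st_x (run s k.+1) = (inner tau beta gamma k.+1 z T0 n m s' J).1 by [].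
split.
  rewrite xE; apply: le_trans (point_dist beta01 gamma01 lipT fixT close (leqnn J)) _.
  (* The error level is M times eps_, so the drift e / eps_ is exactly [M] per epoch. *)
  rewrite mulfK ?gt_eqF// (_ : D0 + k.+1%:R * M = D0 + k%:R * M + M).
    by apply: lerD.
  by rewrite -natr1 mulrDl mul1r addrA.
have res := residual_contraction beta01 gamma01 lipT fixT n0 J0 close.
rewrite -xE in res.
have rT : rho_ beta gamma k.+1 ^+ J * `|T0 - z| <=
    eps_ beta k.+1 * (k.+1%:R ^+ 2 * (3 * (D0 + M))).
  rewrite -[eps_ beta k.+1]/(beta ^+ k.+1) (exprS beta k) -mulrA.
  have /andP[r0 _] := rho_bounds beta01 k.+1 gamma01.
  apply: ler_pM; [exact: exprn_ge0 (ltW r0)|exact: normr_ge0| |exact: IH2].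
  exact: rho_J.
rewrite /residual -(subrK (T (st_x (run s k.+1))) (st_T _)) -addrA.
apply: le_trans (ler_normD _ _) _.
have ee : eps_ beta k.+2 <= eps_ beta k.+1.
  by rewrite /eps_ [leLHS]exprS ler_piMl ?ltW// exprn_ge0// ltW.
have h1 : Mm * eps_ beta k.+2 <= M * eps_ beta k.+1.
  by apply: ler_pM => //; [rewrite ltW// (eps_gt0 beta01)|rewrite lerDl].
have h2 := ler_wpM2l (ltW e0) IH1.
have h3 := ler_wpM2l (ltW e0) (residual_step k D00 M0).
exact: (residual_combine hmS res rT h1 h2 h3).
Qed.

End RunBound.

(** * Probability of a good run *)

Lemma measurable_gt {d} {W : measurableType d} {R : realType} (f : W -> R) c :
  measurable_fun setT f -> measurable [set w | c < f w].
Proof.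
move=> mf; rewrite (_ : mkset _ = f @^-1` `]c, +oo[); last first.
  by apply/seteqP; split => w /=; rewrite in_itv/= andbT.
by rewrite -[X in measurable X]setTI; exact: mf.
Qed.

Section GoodRun.
Context {R : realType} {E : completeNormedModType R}.
Context {d : measure_display} {Xi : measurableType d}.
Hypothesis sepE : separable_space E.
Variables (D : probability Xi R) (mu : probability (stream Xi) R).
Hypothesis muD : iid_law D mu.
Variables (N : E -> R) (B C : R).
Hypothesis smoothN : smoothable_by N B C.
Variable tau : E -> Xi -> E.
Hypothesis mtau : jointly_measurable tau.
Variables (T : E -> E) (L sigma gamma : R).
Hypothesis gamma01 : 0 < gamma <= 1.
Hypothesis lipT : forall x y, `|T x - T y| <= gamma * `|x - y|.
Hypothesis meanT : forall x, weak_mean D (tau x) (T x).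
Hypothesis varT : forall x,
  (\int[D]_z (`|tau x z - T x| ^+ 2)%:E <= (sigma ^+ 2)%:E)%E.
Hypothesis lip2 : forall x y, (\int[D]_z (`|tau x z - tau y z| ^+ 2)%:E
   <= (L ^+ 2 * `|x - y| ^+ 2)%:E)%E.
Variables (x0 : E) (beta delta DL : R).
Hypotheses (beta01 : 0 < beta < 1).
Hypothesis delta01 : forall k, 0 < delta_ beta delta k.+1 < 1.
Hypotheses (sigma0 : 0 <= sigma) (DL0 : 0 < DL) (sigma_DL : sigma <= DL).
Local Notation stream := (stream Xi).
Local Notation run := (vr_ghal tau x0 beta delta gamma).

Let kappa := B * C ^+ 2.

(** Three times the radius of [mome_tail], which is (eps_ / 2) sqrt kappa D_L; D_L replaces sigma
    because that radius has to be positive. *)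
Definition mome_level := 3 / 2 * (Num.sqrt kappa * DL).
Definition epoch_level :=
  3 * Num.sqrt (B * C ^+ 2 * (2 * (L ^+ 2 + gamma ^+ 2))) + 3.

Local Notation mome_good := (mome_ok tau T x0 beta delta gamma mome_level).
Local Notation epoch_good := (epoch_ok tau T x0 beta delta gamma epoch_level).

Lemma mome_q_gt0 k : (0 < mome_q (delta_ beta delta k.+1 / 2))%N.
Proof.
have /andP[d0 d1] := delta01 k.
rewrite ltnNge /mome_q ceiln_le -ltNge mulr_gt0// ln_gt0//.
by rewrite ltr_pdivlMr ?divr_gt0// mul1r ltr_pdivrMr//; lra.
Qed.

Lemma kappa_ge1 : 1 <= kappa.
Proof.
have [_ B1 C1 _ _] := smoothN.
by rewrite -[X in X <= _]mulr1; apply: ler_pM => //; exact: exprn_ege1.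
Qed.

(** [X] is the query point and [Nn] the number of seeds read before it is known; the tail bound for
    a fixed point carries over because the call reads later seeds only. *)
Lemma mome_failure (X : stream -> borel E) (Nn : stream -> nat) k :
  measurable_fun setT X -> measurable_fun setT Nn ->
  (forall s s', agree (Nn s) s s' -> X s' = X s /\ Nn s' = Nn s) ->
  (mu [set s | (mome_level * eps_ beta k.+1 <
     `|mome tau (eps_ beta k.+1 / 2) (delta_ beta delta k.+1 / 2) (X s : E)
        (shift s (Nn s)) - T (X s)|)%R] <= (delta_ beta delta k.+1 / 2)%:E)%E.
Proof.
move=> mX mN stop; have /andP[d0 d1] := delta01 k.
have e0 := eps_gt0 beta01 k.+1.
set e := eps_ beta k.+1 / 2; set dl := delta_ beta delta k.+1 / 2.
pose bad : set (borel E * stream) :=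
  [set p | mome_level * eps_ beta k.+1 < `|mome tau e dl (p.1 : E) p.2 - T p.1|].
have mfst : open_meas (fun p : borel E * stream => p.1 : E).
  by apply/borelP; exact: measurable_fst.
apply: (strong_markov muD (B := bad) mX mN stop).
  apply: measurable_gt; apply: measurable_norm => //; apply: open_measB => //.
    exact: (@open_meas_mome _ _ _ _ _ _ sepE tau mtau e dl
      (fun p : borel E * stream => p.1) snd).
  exact: (open_meas_comp (continuous_lip gamma01 lipT) mfst).
move=> x; have sk0 : 0 < Num.sqrt kappa.
  by rewrite sqrtr_gt0 (lt_le_trans ltr01 kappa_ge1).
have := mome_tail sepE muD smoothN mtau (x := x) (v := T x) (V := sigma ^+ 2)
  (e := e) (dl := dl) (r := e * (Num.sqrt kappa * DL)) (meanT x) (varT x).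
have e_gt0 : 0 < e by rewrite divr_gt0.
rewrite e_gt0 => /(_ isT); rewrite divr_gt0//= => h.
have -> : xsection bad x = [set s | (3 * (e * (Num.sqrt kappa * DL)) <
    `|mome tau e dl x s - T x|)%R].
  rewrite xsectionE; apply/seteqP; split => s; rewrite /= /bad/=;
  rewrite (_ : 3 * (e * (Num.sqrt kappa * DL)) = mome_level * eps_ beta k.+1)//;
  by rewrite /mome_level /e; ring.
apply: h.
- by rewrite ltr_pdivrMr//; lra.
- by rewrite !mulr_gt0.
- rewrite -[27 / _ * _]mulrA ler_pM2l// (exprMn _ e) mulKf ?expf_neq0 ?gt_eqF//.
  rewrite exprMn sqr_sqrtr ?(le_trans ler01 kappa_ge1)//.
  by rewrite ler_wpM2l ?(le_trans ler01 kappa_ge1)// lerXn2r ?nnegrE// ltW.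
Qed.

Lemma mome_bad k :
  (mu [set s | ~ mome_good s k] <= (delta_ beta delta k.+1 / 2)%:E)%E.
Proof.
have -> : [set s | ~ mome_good s k] =
    [set s | (mome_level * eps_ beta k.+1 <
      `|st_T (run s k) - T (st_x (run s k))|)%R].
  by apply/seteqP; split => s /=; rewrite /mome_ok ltNge => /negP.
case: k => [|k].
  by apply: (@mome_failure (fun=> x0) (fun=> 0%N) 0).
have [_ _ mp ms] := measurable_epoch sepE mtau (measurable_run sepE mtau x0 beta delta gamma k).
apply: (@mome_failure (fun s => epoch_point tau x0 beta delta gamma s k : borel E)
  (fun s => epoch_seeds tau x0 beta delta gamma s k) k.+1) => //.
  exact/borelP.
by move=> s s'; apply: epoch_stop => i; exact: mome_q_gt0.
Qed.

(** The strong Markov property at the start of the epoch, with the pair of point and estimate as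
    state: the sample sizes are functions of this pair, so each section of [bad] is covered by
    [epoch_tail]. *)
Lemma epoch_bad k :
  (mu [set s | ~ epoch_good s k] <= (delta_ beta delta k.+1 / 2)%:E)%E.
Proof.
have mr := measurable_run sepE mtau x0 beta delta gamma k.
pose X (s : stream) : borel E * borel E := (st_x (run s k), st_T (run s k)).
pose err (p : (borel E * borel E) * stream) : R :=
  path_error tau T gamma beta k.+1 (p.1.1 : E) (p.1.2 : E)
    (n_ beta delta gamma k.+1 `|(p.1.2 : E) - (p.1.1 : E)|)
    (m_ beta gamma k.+1 `|(p.1.2 : E) - (p.1.1 : E)|) (J_ beta gamma k.+1) p.2.
pose bad := [set p | epoch_level * eps_ beta k.+1 < err p].
have -> : [set s | ~ epoch_good s k] =
    [set s | bad (X s, shift s (st_seeds (run s k)))].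
  by apply/seteqP; split => s /=; rewrite /epoch_ok /bad/= ltNge => /negP.
apply: (strong_markov muD).
- by apply: measurable_fun_pair; apply/borelP; [exact: (meas_x mr)|exact: (meas_T mr)].
- exact: (meas_seeds mr).
- move=> s s' ss'.
  by rewrite /X (run_agree (fun i => mome_q_gt0 i) ss').
- have m11 : open_meas (fun p : borel E * borel E * stream => p.1.1 : E).
    apply/borelP.
    exact: (measurableT_comp measurable_fst measurable_fst).
  have m12 : open_meas (fun p : borel E * borel E * stream => p.1.2 : E).
    apply/borelP.
    exact: (measurableT_comp measurable_snd measurable_fst).
  have mR : measurable_fun setT (fun p : borel E * borel E * stream =>
      `|(p.1.2 : E) - (p.1.1 : E)|).
    by apply: measurable_norm => //; exact: open_measB.
  apply: measurable_gt; apply: (measurable_path_error sepE mtau gamma01 lipT) => //.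
    apply: measurable_fun_maxn; first exact: measurable_cst.
    apply: measurable_ceiln; apply: measurable_funM; last exact: measurable_cst.
    apply: measurable_funM; last exact: measurable_cst.
    by apply: measurable_funM => //; exact: measurable_cst.
  apply: measurable_ceiln; apply: measurable_funM; last exact: measurable_cst.
  apply: measurable_funM; first exact: measurable_cst.
  exact: measurable_funX.
- move=> [z T0]; rewrite xsectionE /=.
  have := epoch_tail sepE muD smoothN mtau gamma01 lipT meanT lip2 beta01
    (delta01 k) z T0 (J_ beta gamma k.+1).
  exact.
Qed.

Lemma measurable_mome_bad k : measurable [set s | ~ mome_good s k].
Proof.
have [mx mT _ _] := measurable_run sepE mtau x0 beta delta gamma k.
have -> : [set s | ~ mome_good s k] =
    [set s | (mome_level * eps_ beta k.+1 <
      `|st_T (run s k) - T (st_x (run s k))|)%R].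
  by apply/seteqP; split => s /=; rewrite /mome_ok ltNge => /negP.
apply: measurable_gt; apply: measurable_norm => //; apply: open_measB => //.
exact: (open_meas_comp (continuous_lip gamma01 lipT) mx).
Qed.

Lemma measurable_epoch_bad k : measurable [set s | ~ epoch_good s k].
Proof.
have mr := measurable_run sepE mtau x0 beta delta gamma k.
have [mx mT ms _] := mr; have [mn mm _ _] := measurable_epoch sepE mtau mr.
have -> : [set s | ~ epoch_good s k] = [set s | epoch_level * eps_ beta k.+1 <
  path_error tau T gamma beta k.+1 (st_x (run s k)) (st_T (run s k))
    (run_n tau x0 beta delta gamma s k) (run_m tau x0 beta delta gamma s k)
    (J_ beta gamma k.+1) (shift s (st_seeds (run s k)))].
  by apply/seteqP; split => s /=; rewrite /epoch_ok ltNge => /negP.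
apply: measurable_gt; apply: (measurable_path_error sepE mtau gamma01 lipT) => //.
apply: (measurable_fun_select (g := fun s : stream => st_seeds (run s k))
  (h := fun n s => shift s n : stream)) => // n.
exact: measurable_shift.
Qed.

(** Union bound; indices below [K] suffice since state i fixes the sample sizes of epoch i + 1. *)
Lemma good_run K :
  let bad := \big[setU/set0]_(i < K)
     ([set s | ~ mome_good s i] `|` [set s | ~ epoch_good s i]) in
  measurable bad /\ (mu bad <= (\sum_(i < K) delta_ beta delta i.+1)%:E)%E.
Proof.
have mb i : measurable ([set s | ~ mome_good s i] `|` [set s | ~ epoch_good s i]).
  by apply: measurableU; [exact: measurable_mome_bad|exact: measurable_epoch_bad].
split; first exact: bigsetU_measurable.
pose F i := [set s | ~ mome_good s i] `|` [set s | ~ epoch_good s i].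
have hB : (mu (\big[setU/set0]_(i < K) F i) <= \sum_(i < K) mu (F i))%E.
  by apply: Boole_inequality => i _; exact: mb.
apply: le_trans hB _.
rewrite -sumEFin; apply: lee_sum => i _.
have hU : (mu ([set s | ~ mome_good s i] `|` [set s | ~ epoch_good s i]) <=
    mu [set s | ~ mome_good s i] + mu [set s | ~ epoch_good s i])%E.
  by apply: measureU2; [exact: measurable_mome_bad|exact: measurable_epoch_bad].
apply: le_trans hU _.
apply: le_trans (leeD (mome_bad i) (epoch_bad i)) _.
by rewrite -EFinD lee_fin -splitr.
Qed.

End GoodRun.

(** * Number of epochs and cost *)

Section Logs.
Context {R : realType}.
Implicit Types x y : R.

Lemma ln2_bounds : 2^-1 <= ln (2 : R) <= 1.
Proof.
apply/andP; split; last first.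
  by rewrite (_ : 2 = 1 + 1 :> R); [apply: le_ln1Dx; lra|lra].
rewrite -ler_expR lnK ?posrE//.
have h : expR (- 2^-1 : R) >= 2^-1.
  by apply: le_trans (expR_ge1Dx _); lra.
rewrite -[expR _]invrK -expRN -[leRHS]invrK lef_pV2 ?posrE ?invr_gt0//.
Qed.

Lemma sqrt_le1D x : 0 <= x -> Num.sqrt x <= 1 + x.
Proof.
move=> x0; rewrite -[leRHS]ger0_norm ?addr_ge0// -sqrtr_sqr ler_sqrt ?sqr_ge0//.
by nra.
Qed.

Lemma ln_le_self x : 0 < x -> ln x <= x.
Proof. by move=> x0; exact: ltW (ln_sublinear x0). Qed.

Lemma logb_half x : logb 2^-1 x = ln x / ln 2.
Proof. by rewrite /logb div1r invrK. Qed.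

Lemma ln2_gt0 : 0 < ln (2 : R).
Proof. by have /andP[h _] := ln2_bounds; apply: lt_le_trans h; rewrite invr_gt0. Qed.

Lemma log2_le x : 1 <= x -> ln x / ln 2 <= 2 * ln x.
Proof.
move=> x1; have /andP[l2 _] := ln2_bounds.
rewrite ler_pdivrMr ?ln2_gt0//; have := ln_ge0 x1; nra.
Qed.

Lemma exp_log2 x : 0 < x -> expR (ln x / ln 2 * ln 2) = x.
Proof.
by move=> x0; rewrite divfK ?lnK ?posrE// gt_eqF// ln2_gt0.
Qed.

End Logs.

Section EpochCount.
Context {R : realType}.
Variables (cbeta eps x : R).

Definition log_level : R := ln x / ln 2.

Hypothesis x2 : 2 <= x.

Lemma log_level_ge1 : 1 <= log_level.
Proof.
have x0 : 0 < x by exact: lt_le_trans x2.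
by rewrite /log_level ler_pdivlMr ?ln2_gt0// mul1r ler_ln ?posrE.
Qed.

Lemma epochs_L_le A : 0 < eps -> 0 <= A -> 8 * A / eps <= x ->
  1 <= epochs_L 2^-1 eps A <= log_level.
Proof.
move=> e0 A0 Ax; rewrite /epochs_L le_max lexx/= ge_max log_level_ge1/=.
rewrite logb_half /log_level.
rewrite ler_pM2r ?invr_gt0 ?ln2_gt0//.
have [->|An0] := eqVneq A 0.
  by rewrite mulr0 mul0r ln0// ln_ge0// (le_trans _ x2)// ler1n.
have x0 : 0 < x by exact: lt_le_trans x2.
have A8 : 0 < 8 * A / eps by rewrite divr_gt0// mulr_gt0// lt_def An0.
by rewrite ler_ln ?posrE.
Qed.

Lemma epochs_term_le p A : 0 <= p <= 3 -> 0 < eps -> 0 <= A -> 8 * A / eps <= x ->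
  epochs_term 2^-1 cbeta eps p A <=
  log_level + 3 * (ln log_level / ln 2) + `|cbeta|.
Proof.
move=> /andP[p0 p3] e0 A0 Ax; have /andP[L1 Lx] := epochs_L_le e0 A0 Ax.
rewrite /epochs_term logb_half.
have l20 := @ln2_gt0 R.
have E0 : 0 < epochs_L 2^-1 eps A by exact: lt_le_trans L1.
have L0 : 0 < log_level by exact: lt_le_trans Lx.
have h1 : ln (epochs_L 2^-1 eps A) / ln 2 <= ln log_level / ln 2.
  by rewrite ler_pM2r ?invr_gt0// ler_ln ?posrE.
have h0 : 0 <= ln (epochs_L 2^-1 eps A) / ln 2.
  by rewrite divr_ge0 ?(ln_ge0 L1) ?(ltW l20).
apply: lerD; last exact: ler_norm.
by apply: lerD => //; apply: ler_pM.
Qed.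

(** In the first bound 3 log2 is at most 6 times the level, whence 8 = 1 + 6 + 1. In the second,
    exponentiating turns 3 log2 of the level into its cube and the rounding into the factor 2. *)
Lemma count_bounds (K : nat) :
  K%:R <= log_level + 3 * (ln log_level / ln 2) + `|cbeta| + 1 ->
  K%:R <= (8 + `|cbeta|) * log_level /\
  2 ^+ K <= 2 * expR `|cbeta| * x * log_level ^+ 3.
Proof.
move=> hK; have L1 := log_level_ge1.
have /andP[l2 l2'] := @ln2_bounds R.
have l20 := @ln2_gt0 R.
have L0 : 0 < log_level by exact: lt_le_trans L1.
split.
  have h1 := log2_le L1; have h2 := ln_le_self L0.
  have h3 : 0 <= `|cbeta| * (log_level - 1) by rewrite mulr_ge0// subr_ge0.
  apply: le_trans hK _; rewrite mulrDl.
  by move: h1 h2 h3 L1; set u := ln log_level / ln 2; set v := ln log_level; lra.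
have x0 : 0 < x by exact: lt_le_trans x2.
rewrite -[2 ^+ K]lnK ?posrE ?exprn_gt0// lnXn// -[ln 2 *+ K]mulr_natl.
apply: le_trans (_ : _ <= expR ((log_level + 3%:R * (ln log_level / ln 2) +
    `|cbeta| + 1) * ln 2)) _.
  by rewrite ler_expR ler_pM2r.
rewrite 3!mulrDl mul1r 3!expRD lnK ?posrE// -[3%:R * _ * _]mulrA expRM_natl.
rewrite exp_log2// [log_level in expR (log_level * _)]/log_level exp_log2//.
have e1 : expR (`|cbeta| * ln 2) <= expR `|cbeta| :> R.
  by rewrite ler_expR ler_piMr.
have p0 : 0 <= x * log_level ^+ 3 * 2.
  exact: (mulr_ge0 (mulr_ge0 (ltW x0) (exprn_ge0 3 (ltW L0))) (ler0n _ 2)).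
have := ler_wpM2l p0 e1; move: (expR _) (expR _) (log_level ^+ 3) => a b l3.
lra.
Qed.

End EpochCount.

Lemma sqrt_le_self {R : realType} (x : R) : 1 <= x -> Num.sqrt x <= x.
Proof.
move=> x1; have s1 : 1 <= Num.sqrt x by rewrite -[X in X <= _]sqrtr1 ler_wsqrtr.
have x0 : 0 <= x by exact: le_trans x1.
by rewrite -[leRHS]sqr_sqrtr// expr2 ler_peMr// (le_trans ler01).
Qed.

Lemma ceiln_mono {R : realType} (x y : R) : x <= y -> (ceiln x <= ceiln y)%N.
Proof.
by move=> xy; rewrite ceiln_le; apply: le_trans xy _; rewrite -ceiln_le.
Qed.

Lemma delta_half {R : realType} (delta : R) k :
  delta_ 2^-1 delta k = delta * 2^-1 ^+ k.
Proof.
rewrite /delta_ (_ : (1 - 2^-1) * delta / 2^-1 = delta) 1?mulrC//.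
by field.
Qed.

Section EpochCountBound.
Context {R : realType}.
Variables (cbeta delta epsilon gamma L sigma B C res0 dist0 c D : R).
Let kappa : R := B * C ^+ 2.
Let l : R := ln (1 / delta).
Hypotheses (B1 : 1 <= B) (C1 : 1 <= C) (delta01 : 0 < delta < 1).
Hypotheses (c0 : 0 < c) (cD : c <= D) (eps0 : 0 < epsilon).
Hypotheses (sigma0 : 0 <= sigma) (dist00 : 0 <= dist0) (res00 : 0 <= res0).
Hypotheses (sigmaD : sigma <= D) (distD : dist0 <= D) (resD : res0 <= 2 * D).
Hypothesis (SD : Num.sqrt (L ^+ 2 + gamma ^+ 2) <= D).

(* [alpha * D] dominates [A_0], [A_1], [A_2] and [A_{5/2}]. *)
Definition alpha (kap l c : R) : R :=
  10 * kap + kap / c + kap * (1 + 9 * kap * (4 + l)) + c^-1.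

Let kap1 : 1 <= kappa.
Proof. by rewrite -[X in X <= _]mulr1; apply: ler_pM => //; exact: exprn_ege1. Qed.

Let kap0 : 0 <= kappa. Proof. exact: le_trans kap1. Qed.

Let D0 : 0 < D. Proof. exact: lt_le_trans cD. Qed.

Let l0 : 0 <= l.
Proof.
have /andP[d0 d1] := delta01.
by rewrite /l ln_ge0// ler_pdivlMr// mul1r ltW.
Qed.

Let skap : Num.sqrt kappa <= kappa. Proof. exact: sqrt_le_self. Qed.

Let skapsig : Num.sqrt kappa * sigma <= kappa * D.
Proof. by apply: ler_pM; rewrite // sqrtr_ge0. Qed.

Let DkapD : D <= kappa * D.
Proof. by rewrite ler_peMl// ltW. Qed.

Let alphaE : alpha kappa l c * D = 10 * (kappa * D) + kappa * (D / c) +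
  D * kappa * (1 + 9 * kappa * (4 + l)) + D / c.
Proof. by rewrite /alpha; field; rewrite gt_eqF. Qed.

(** This absorbs dimensionless summands, such as [C] in [A2], into multiples of [D]. *)
Let Dc : 1 <= D / c. Proof. by rewrite ler_pdivlMr// mul1r. Qed.

Let a0part : 0 <= D * kappa * (1 + 9 * kappa * (4 + l)).
Proof.
apply: mulr_ge0; first by apply: mulr_ge0 => //; exact: ltW.
apply: addr_ge0 => //; apply: mulr_ge0; last exact: addr_ge0.
exact: mulr_ge0.
Qed.

Lemma A0_bound : 0 <= A0 2^-1 sigma B C res0 <= alpha kappa l c * D.
Proof.
rewrite alphaE /A0 -/kappa; have k1 := mulr_ge0 kap0 (le_trans ler01 Dc).
have s0 := mulr_ge0 (sqrtr_ge0 kappa) sigma0.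
move: s0 skapsig DkapD resD res00 k1 Dc a0part.
rewrite -[2^-1 * _ * _]mulrA.
move: (Num.sqrt kappa * sigma) (kappa * D) (kappa * (D / c)) (D / c).
by move: (D * _ * _) => a b e f g *; apply/andP; split; lra.
Qed.

Lemma A1_bound : 0 <= A1 2^-1 sigma B C dist0 <= alpha kappa l c * D.
Proof.
rewrite alphaE /A1 -/kappa; have k1 := mulr_ge0 kap0 (le_trans ler01 Dc).
have s0 := mulr_ge0 (sqrtr_ge0 kappa) sigma0.
move: s0 skapsig DkapD distD dist00 k1 Dc a0part.
rewrite -[2^-1 * _ * _]mulrA.
move: (Num.sqrt kappa * sigma) (kappa * D) (kappa * (D / c)) (D / c).
by move: (D * _ * _) => a b e f g *; apply/andP; split; lra.
Qed.

(** For beta = 1/2 the inner logarithm is ln (8 / delta) <= 3 + l; sqrt t <= 1 + t makes it 4 + l,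
    and sqrt (2 kappa) <= 3 kappa turns the coefficient 3 into 9 kappa. *)
Lemma a0_bound :
  0 <= a0 2^-1 delta gamma L B C <= D * kappa * (1 + 9 * kappa * (4 + l)).
Proof.
have /andP[d0 d1] := delta01.
rewrite /a0 -/kappa (_ : 4 / ((1 - 2^-1) * delta) = 2 ^+ 3 * (1 / delta)); last first.
  by field; rewrite gt_eqF.
rewrite lnM ?posrE ?divr_gt0 ?exprn_gt0// lnXn// -/l.
have /andP[_ l2] := @ln2_bounds R; have l2' := @ln2_gt0 R.
set t := ln 2 *+ 3 + l.
have t0 : 0 <= t by rewrite addr_ge0// mulrn_wge0// ltW.
have tl : t <= 3 + l by rewrite /t lerD2r -[ln 2 *+ 3]mulr_natl ler_piMr.
have st : Num.sqrt t <= 4 + l.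
  by apply: le_trans (sqrt_le1D t0) _; move: tl; lra.
have s2k : Num.sqrt (2 * kappa) <= 3 * kappa.
  apply: le_trans (sqrt_le1D _) _; first exact: mulr_ge0.
  by move: kap1; lra.
have h0 : 0 <= 3 * Num.sqrt (2 * kappa) * Num.sqrt t.
  by rewrite !mulr_ge0 ?sqrtr_ge0.
apply/andP; split.
  by rewrite mulr_ge0 ?addr_ge0// mulr_ge0 ?sqrtr_ge0.
apply: ler_pM; [by rewrite mulr_ge0 ?sqrtr_ge0|by rewrite addr_ge0| |].
  by apply: ler_pM; rewrite ?sqrtr_ge0.
rewrite lerD2l; apply: ler_pM; [by rewrite mulr_ge0 ?sqrtr_ge0|exact: sqrtr_ge0| |done].
by move: s2k; lra.
Qed.

Lemma A2_bound : 0 <= A2 2^-1 delta gamma L sigma B C <= alpha kappa l c * D.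
Proof.
have /andP[h1 h2] := a0_bound.
have s0 := mulr_ge0 (sqrtr_ge0 kappa) sigma0.
have Ck : C <= kappa.
  rewrite /kappa expr2 mulrA ler_peMl ?(le_trans ler01)//.
  by rewrite -[X in X <= _]mulr1; apply: ler_pM.
have kDc : kappa <= kappa * (D / c) by rewrite ler_peMr.
rewrite alphaE /A2 -/kappa.
have C0 : 0 <= C by exact: le_trans C1.
have kD0 : 0 <= kappa * D by rewrite mulr_ge0// ltW.
move: h1 h2 s0 Ck kDc C0 kD0 skapsig Dc.
move: (a0 _ _ _ _ _ _) (D * kappa * _) (Num.sqrt kappa * sigma) (kappa * D)
  (kappa * (D / c)) (D / c).
by move=> *; apply/andP; split; lra.
Qed.

Lemma A52_bound : 0 <= A52 2^-1 gamma L B C <= alpha kappa l c * D.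
Proof.
have /andP[_ l2] := @ln2_bounds R; have l2' := @ln2_gt0 R.
rewrite /A52 /a1 -/kappa div1r invrK.
set S2 := L ^+ 2 + gamma ^+ 2; have S20 : 0 <= S2 by rewrite addr_ge0 ?sqr_ge0.
have h : Num.sqrt (2 * S2 * ln 2) <= Num.sqrt 2 * Num.sqrt S2.
  rewrite -sqrtrM// ler_wsqrtr// ler_piMr// mulr_ge0//.
have hD : Num.sqrt (2 * S2 * ln 2) <= Num.sqrt 2 * D.
  by apply: le_trans h _; rewrite ler_wpM2l.
apply/andP; split.
  apply: mulr_ge0; first by rewrite divr_ge0// mulr_ge0.
  by apply: mulr_ge0; [exact: mulr_ge0|exact: sqrtr_ge0].
apply: (@le_trans _ _ (4 * Num.sqrt 2 / 5 * (3 * kappa * (Num.sqrt 2 * D)))).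
  rewrite ler_wpM2l ?divr_ge0 ?mulr_ge0//.
  by apply: ler_wpM2l => //; exact: mulr_ge0.
have -> : 4 * Num.sqrt 2 / 5 * (3 * kappa * (Num.sqrt 2 * D)) =
    12 / 5 * Num.sqrt 2 ^+ 2 * (kappa * D) by field.
rewrite sqr_sqrtr// alphaE.
have k1 := mulr_ge0 kap0 (le_trans ler01 Dc).
have kD0 : 0 <= kappa * D by rewrite mulr_ge0// ltW.
move: k1 kD0 a0part Dc.
move: (D * kappa * _) (kappa * D) (kappa * (D / c)) (D / c).
by move=> *; lra.
Qed.

Let x := 8 * (alpha kappa l c * D) / epsilon.

Hypothesis x2 : 2 <= x.

Lemma num_epochs_le :
  (num_epochs 2^-1 cbeta delta epsilon gamma L sigma B C res0 dist0)%:R <=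
  log_level x + 3 * (ln (log_level x) / ln 2) + `|cbeta| + 1.
Proof.
set Y := _ + `|cbeta|.
have L1 := log_level_ge1 x2.
have Y0 : 0 <= Y.
  apply: addr_ge0 => //; apply: addr_ge0; first exact: le_trans L1.
  by apply: mulr_ge0 => //; rewrite divr_ge0 ?(ln_ge0 L1) ?(ltW (@ln2_gt0 R)).
have tle p A : 0 <= p <= 3 -> 0 <= A <= alpha kappa l c * D ->
    epochs_term 2^-1 cbeta epsilon p A <= Y.
  move=> hp /andP[hA hA']; apply: epochs_term_le => //.
  by rewrite /x ler_pM2r ?invr_gt0// ler_pM2l.
have mxY : forall a b e f : R, a <= Y -> b <= Y -> e <= Y -> f <= Y ->
    Num.max (Num.max a b) (Num.max e f) <= Y.
  by move=> a b e f *; rewrite !ge_max; apply/andP; split; apply/andP.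
rewrite /num_epochs -/kappa natr_max// ge_max; apply/andP; split.
  by rewrite lerDr.
apply: le_trans (ceiln_leD1 Y0).
rewrite ler_nat; apply: ceiln_mono; apply: mxY; apply: tle.
- by rewrite lexx/= ler0n.
- exact: A0_bound.
- by rewrite ler01/= ler1n.
- exact: A1_bound.
- by rewrite ler0n/= ler_nat.
- exact: A2_bound.
- by apply/andP; split; lra.
- exact: A52_bound.
Qed.

End EpochCountBound.

Lemma half01 {R : realType} : 0 < (2^-1 : R) < 1.
Proof. by apply/andP; split; lra. Qed.

Lemma delta_half_bounds {R : realType} (delta : R) k : 0 < delta < 1 ->
  0 < delta_ 2^-1 delta k < 1.
Proof.
move=> /andP[d0 d1]; have /andP[h0 h1] := @half01 R.
rewrite delta_half mulr_gt0 ?exprn_gt0//=; apply: le_lt_trans d1.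
by rewrite ler_piMr ?(ltW d0)// exprn_ile1// ltW.
Qed.

(** The summand 2 / c absorbs the rounding and the maximum with 1; the rest comes from Rt / eps_k <=
    2 k^2 q D and a logarithm of at most k (3 + l). In [m_coef] below, 16 q^2 is 4 (2 q)^2, and the
    inverse square of [c] again absorbs the rounding. *)
Definition n_coef {R : realType} (c q l : R) : R := 2 / c + 2 * q * (3 + l).

Definition m_coef {R : realType} (c q : R) : R := c^-1 ^+ 2 + 16 * q ^+ 2.

Section EpochCost.
Context {R : realType}.
Variables (delta gamma c D q : R).
Let l : R := ln (1 / delta).
Hypotheses (delta01 : 0 < delta < 1) (gamma01 : 0 < gamma <= 1).
Hypotheses (c0 : 0 < c) (cD : c <= D) (q0 : 0 <= q).

Let D0 : 0 < D. Proof. exact: lt_le_trans cD. Qed.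

Let l0 : 0 <= l.
Proof.
have /andP[d0 d1] := delta01.
by rewrite /l ln_ge0// ler_pdivlMr// mul1r ltW.
Qed.

Lemma eps_half k : (eps_ (2^-1 : R) k)^-1 = 2 ^+ k.
Proof. by rewrite /eps_ exprVn invrK. Qed.

Lemma ln_div_delta (j k : nat) :
  ln (2 ^+ j / delta_ 2^-1 delta k) <= (j + k)%:R + l.
Proof.
have /andP[d0 d1] := delta01.
have -> : 2 ^+ j / delta_ 2^-1 delta k = 2 ^+ (j + k) * (1 / delta).
  rewrite delta_half invfM exprVn invrK exprD div1r -!mulrA; congr (_ * _).
  exact: mulrC.
rewrite lnM ?posrE ?divr_gt0 ?exprn_gt0// lnXn// lerD2r.
have /andP[_ l2] := @ln2_bounds R.
by rewrite -[ln 2 *+ _]mulr_natl ler_piMr.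
Qed.

Section Level.
Variables (k : nat) (Rt : R).
Hypotheses (k0 : (0 < k)%N) (Rt0 : 0 <= Rt).
Hypothesis RtD : Rt <= 2 * eps_ 2^-1 k * (k%:R ^+ 2 * (q * D)).
Local Notation rho := (rho_ 2^-1 gamma k).
Let w : R := (1 - rho)^-1.

Let k1 : 1 <= k%:R :> R. Proof. by rewrite ler1n. Qed.

Let y := Rt / eps_ 2^-1 k.

Let y_le : 0 <= y <= 2 * (k%:R ^+ 2 * (q * D)).
Proof.
have e0 := eps_gt0 (@half01 R) k.
by rewrite /y divr_ge0 ?(ltW e0)//= ler_pdivrMr// mulrAC.
Qed.

Let w1 : 1 <= w.
Proof.
have /andP[r0 r1] := rho_bounds (@half01 R) k gamma01.
by rewrite /w -[X in X <= _]invr1 lef_pV2 ?posrE ?subr_gt0// gerBl ltW.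
Qed.

Lemma n_bound : (n_ 2^-1 delta gamma k Rt)%:R <= D * k%:R ^+ 3 * n_coef c q l.
Proof.
have /andP[g0 g1] := gamma01; have /andP[y0 yle] := y_le.
have /andP[lam0 lam1] := lambda_bounds (@half01 R) k.
have e0 := eps_gt0 (@half01 R) k.
set lt := ln (4 / delta_ 2^-1 delta k).
have lt_le : lt <= k%:R * (3 + l).
  have := ln_div_delta 2 k; rewrite -natrX -/lt natrD => h; apply: le_trans h _.
  have := mulr_ge0 (_ : 0 <= k%:R - 1) l0; rewrite subr_ge0 => /(_ k1).
  by move: k1; lra.
have lt0 : 0 <= lt.
  have /andP[dk0 dk1] := delta_half_bounds k delta01.
  by rewrite /lt ln_ge0// ler_pdivlMr// mul1r; lra.
have cst0 : 0 <= (1 - lambda_ 2^-1 k) * gamma <= 1.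
  have a0 : 0 <= 1 - lambda_ (2^-1 : R) k by rewrite subr_ge0 ltW.
  rewrite mulr_ge0 ?(ltW g0)//= mulr_ile1 ?(ltW g0)//.
  by rewrite gerBl ltW.
set x := 2 * (1 - lambda_ 2^-1 k) * gamma * Rt * lt / (3 * eps_ 2^-1 k).
have xE : x = 2 / 3 * ((1 - lambda_ 2^-1 k) * gamma) * (y * lt).
  by rewrite /x /y; field; rewrite gt_eqF.
have x0 : 0 <= x.
  rewrite xE; apply: mulr_ge0; last exact: mulr_ge0.
  by apply: mulr_ge0; [lra|case/andP: cst0].
have yl : y * lt <= 2 * (k%:R ^+ 2 * (q * D)) * (k%:R * (3 + l)).
  exact: ler_pM.
have xle : x <= 2 / 3 * (2 * (k%:R ^+ 2 * (q * D)) * (k%:R * (3 + l))).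
  rewrite xE -mulrA ler_pM2l; last lra.
  apply: le_trans yl; rewrite ler_piMl//; first exact: mulr_ge0.
  by case/andP: cst0.
have nle : (n_ 2^-1 delta gamma k Rt)%:R <= x + 2.
  rewrite /n_ -/lt -/x natr_max ge_max; apply/andP; split; first by lra.
  by apply: le_trans (ceiln_leD1 x0) _; lra.
apply: le_trans nle _.
have Dc : 1 <= D / c by rewrite ler_pdivlMr// mul1r.
have k3 : 1 <= k%:R ^+ 3 :> R by exact: exprn_ege1.
have h2 : 1 <= D / c * k%:R ^+ 3.
  by rewrite -[X in X <= _]mulr1; apply: ler_pM.
have -> : D * k%:R ^+ 3 * n_coef c q l = 2 * (D / c * k%:R ^+ 3) +
   (k%:R ^+ 2 * (q * D)) * (k%:R * (3 + l)) * 2.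
  by rewrite /n_coef; field; rewrite gt_eqF.
have p0 : 0 <= (k%:R ^+ 2 * (q * D)) * (k%:R * (3 + l)).
  have h3 : 0 <= q * D by rewrite mulr_ge0// ltW.
  apply: mulr_ge0; first by apply: mulr_ge0 => //; exact: exprn_ge0.
  by apply: mulr_ge0 => //; exact: addr_ge0.
have xle' : x <= 4 / 3 * (k%:R ^+ 2 * (q * D) * (k%:R * (3 + l))).
  by apply: le_trans xle _; rewrite le_eqVlt; apply/orP; left; apply/eqP; field.
clear xle; move: xle' h2 p0.
by move: (_ * _ * (_ * _)) (D / c * k%:R ^+ 3) => u v *; lra.
Qed.

Lemma m_bound : (m_ 2^-1 gamma k Rt)%:R <= m_coef c q * k%:R ^+ 4 * D ^+ 2 * w ^+ 2.
Proof.
have /andP[r0 r1] := rho_bounds (@half01 R) k gamma01.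
have e0 := eps_gt0 (@half01 R) k.
have /andP[y0 yle] := y_le.
have r1' : 0 < 1 - rho by rewrite subr_gt0.
rewrite /m_ (_ : 4 * Rt ^+ 2 / (eps_ 2^-1 k ^+ 2 * (1 - rho) ^+ 2) =
  4 * y ^+ 2 * w ^+ 2); last first.
  by rewrite /y /w; field; rewrite !gt_eqF.
have w2 : 1 <= w ^+ 2 by exact: exprn_ege1.
apply: le_trans (ceiln_leD1 _) _.
  by apply: mulr_ge0; [apply: mulr_ge0 => //; exact: sqr_ge0|exact: sqr_ge0].
have y2 : y ^+ 2 <= (2 * (k%:R ^+ 2 * (q * D))) ^+ 2.
  by apply: lerXn2r; rewrite ?nnegrE//; exact: le_trans yle.
have Dc : 1 <= (D / c) ^+ 2 by apply: exprn_ege1; rewrite ler_pdivlMr// mul1r.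
have k4 : 1 <= k%:R ^+ 4 :> R by exact: exprn_ege1.
have h1 : 1 <= k%:R ^+ 4 * (D / c) ^+ 2 * w ^+ 2.
  rewrite -[X in X <= _]mulr1; apply: ler_pM => //.
  by rewrite -[X in X <= _]mulr1; apply: ler_pM.
have h2 : 4 * y ^+ 2 * w ^+ 2 <= 4 * (2 * (k%:R ^+ 2 * (q * D))) ^+ 2 * w ^+ 2.
  by rewrite ler_wpM2r ?sqr_ge0// ler_pM2l.
apply: le_trans (lerD h2 h1) _; rewrite le_eqVlt; apply/orP; left; apply/eqP.
by rewrite /m_coef; field; rewrite gt_eqF.
Qed.

Lemma J_bound : (J_ 2^-1 gamma k)%:R <= 2 * w.
Proof.
apply: le_trans (J_le k (@half01 R) gamma01) _.
have /andP[_ l2] := @ln2_bounds R.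
rewrite div1r invrK -/w mulr_natl mulr2n; apply: lerD => //.
by rewrite ler_piMl// (le_trans ler01).
Qed.

(** Of the cube of 1 / (1 - rho), one factor comes from [J_] and two from [m_]; k^7 is k^3 from [n_]
    times k^4 from [m_]. *)
Lemma epoch_cost :
  (J_ 2^-1 gamma k * (n_ 2^-1 delta gamma k Rt * m_ 2^-1 gamma k Rt))%:R <=
  2 * n_coef c q l * m_coef c q * k%:R ^+ 7 * D ^+ 3 * w ^+ 3.
Proof.
rewrite !natrM.
have h := ler_pM (ler0n _ _) (mulr_ge0 (ler0n _ _) (ler0n _ _)) J_bound
  (ler_pM (ler0n _ _) (ler0n _ _) n_bound m_bound).
apply: le_trans h _; rewrite le_eqVlt; apply/orP; left; apply/eqP; ring.
Qed.

(** 1 - rho >= lambda_k >= eps_k / 2, the first because gamma <= 1: averaging alone provides a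
    gap. *)
Lemma w_le_pow : w <= 2 * 2 ^+ k.
Proof.
have /andP[r0 r1] := rho_bounds (@half01 R) k gamma01.
have /andP[g0 g1] := gamma01.
have /andP[lam0 lam1] := lambda_bounds (@half01 R) k.
have e0 := eps_gt0 (@half01 R) k.
rewrite /w -[leRHS]invrK lef_pV2 ?posrE ?subr_gt0 ?invr_gt0 ?mulr_gt0 ?exprn_gt0//.
have e1 : eps_ (2^-1 : R) k <= 1 by rewrite /eps_ exprn_ile1//; lra.
have h1 : 2^-1 * eps_ (2^-1 : R) k <= lambda_ 2^-1 k.
  rewrite /lambda_ /lbar_ -/(eps_ 2^-1 k) mulrC ler_pM2l// lef_pV2 ?posrE ?addr_gt0//.
  lra.
have h2 : lambda_ 2^-1 k <= 1 - rho.
  rewrite /rho_; have := ler_piMl (_ : 0 <= 1 - lambda_ (2^-1 : R) k) g1.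
  by rewrite subr_ge0 => /(_ (ltW lam1)); lra.
rewrite invfM -eps_half invrK; exact: le_trans h1 h2.
Qed.

Lemma w_le_gap : gamma < 1 -> w <= (1 - gamma)^-1.
Proof.
move=> g1; have /andP[r0 r1] := rho_bounds (@half01 R) k gamma01.
have /andP[g0 _] := gamma01.
have /andP[lam0 lam1] := lambda_bounds (@half01 R) k.
rewrite /w lef_pV2 ?posrE ?subr_gt0// lerD2l lerN2 /rho_ ler_piMr ?(ltW g0)//.
by rewrite gerBl ltW.
Qed.

End Level.

(** A group has 108 * 4^(i+1) <= 432 * 4^K samples before rounding, and there are at most 18 (K + 2
    + l) + 1 <= K (55 + 18 l) groups. *)
Lemma mome_cost_bound (K i : nat) : (0 < K)%N -> (i <= K)%N ->
  (mome_cost (eps_ 2^-1 i.+1 / 2) (delta_ 2^-1 delta i.+1 / 2))%:R <=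
  436 * 4 ^+ K * (K%:R * (55 + 18 * l)).
Proof.
move=> K0 iK; have /andP[d0 d1] := delta01.
have K1 : 1 <= K%:R :> R by rewrite ler1n.
have p4 : 1 <= 4 ^+ K :> R by rewrite exprn_ege1// ler1n.
rewrite /mome_cost natrM; apply: ler_pM => //.
  have e : 27 / (eps_ 2^-1 i.+1 / 2) ^+ 2 = 108 * 4 ^+ i.+1 :> R.
    rewrite -[eps_ _ _]invrK eps_half.
    have -> : 4 ^+ i.+1 = (2 ^+ i.+1) ^+ 2 :> R.
      by rewrite exprAC (_ : 2 ^+ 2 = 4 :> R)//; lra.
    by field; rewrite gt_eqF// exprn_gt0.
  rewrite /mome_n e; apply: le_trans (ceiln_leD1 _) _.
    by rewrite mulr_ge0 ?exprn_ge0.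
  have h : 4 ^+ i.+1 <= 4 * 4 ^+ K :> R.
    by rewrite -exprS ler_weXn2l ?ler1n.
  by move: h p4; lra.
rewrite /mome_q; set t := ln _.
have -> : t = ln (2 ^+ 1 / delta_ 2^-1 delta i.+1).
  by rewrite /t expr1 div1r invf_div.
have tle := ln_div_delta 1 i.+1.
have t0 : 0 <= ln (2 ^+ 1 / delta_ 2^-1 delta i.+1).
  have /andP[dk0 dk1] := delta_half_bounds i.+1 delta01.
  by rewrite ln_ge0// ler_pdivlMr// mul1r expr1; lra.
apply: le_trans (ceiln_leD1 _) _; first exact: mulr_ge0.
have iK' : (1 + i.+1)%:R <= K%:R + 2 :> R.
  by rewrite -natrD ler_nat addnS addSn add0n addn2 !ltnS.
have Kl : l <= K%:R * l by rewrite ler_peMl.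
by move: tle iK' Kl K1; lra.
Qed.

End EpochCost.

(** The law of the random stream is the image of [P]; independence over finite index sets is exactly
    its product form on boxes. *)
Lemma stream_law {R : realType} {d d'} {Xi : measurableType d}
    {Omega : measurableType d'} (P : probability Omega R) (D : probability Xi R)
    (xi : nat -> Omega -> Xi) : iid_seeds P D xi ->
  exists2 mu : probability (stream Xi) R, iid_law D mu &
    forall A : set (stream Xi), mu A = P [set w | A (xi ^~ w)].
Proof.
move=> [mxi lawxi ind].
pose f (w : Omega) : stream Xi := xi ^~ w.
have mf : measurable_fun setT f by apply: measurable_fun_stream => i; exact: mxi.
pose X : {mfun Omega >-> stream Xi} := HB.pack f (isMeasurableFun.Build _ _ _ _ f mf).
exists [the probability (stream Xi) R of distribution P X] => // N A mA.
rewrite /= /distribution /pushforward.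
have -> : X @^-1` box N A = \bigcap_(i in [set` iota 0 N]) (xi i @^-1` A i).
  apply/seteqP; split => w h i.
    by rewrite /= mem_iota add0n => /h.
  by move=> iN; apply: (h i); rewrite /= mem_iota add0n.
rewrite ind ?iota_uniq//.
rewrite -(big_mkord predT (fun i => D (A i))) /index_iota subn0.
by apply: eq_bigr => i _; rewrite lawxi.
Qed.

(** * Total number of samples and its rate *)

Section TotalCost.
Context {R : realType} {E : completeNormedModType R}.
Context {d : measure_display} {Xi : measurableType d}.
Variables (tau : E -> Xi -> E) (x0 : E) (delta gamma c D q W : R) (K : nat).
Let l : R := ln (1 / delta).
Hypotheses (delta01 : 0 < delta < 1) (gamma01 : 0 < gamma <= 1).
Hypotheses (c0 : 0 < c) (cD : c <= D) (q0 : 0 <= q) (K0 : (0 < K)%N).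
Hypothesis W_ge : forall k, (0 < k)%N -> (k <= K)%N ->
  (1 - rho_ 2^-1 gamma k)^-1 <= W.
Local Notation run := (vr_ghal tau x0 2^-1 delta gamma).
Local Notation a := (n_coef c q l).
Local Notation b := (m_coef c q).

(** Uniform bounds for one call of [mome] and for one epoch, with k replaced by [K]. The outer 2 in
    [epoch_part] counts two queries per seed. *)
Let mome_part := 436 * 4 ^+ K * (K%:R * (55 + 18 * l)).
Let epoch_part := 2 * (2 * a * b * K%:R ^+ 7 * D ^+ 3 * W ^+ 3).

Let l0 : 0 <= l.
Proof.
have /andP[d0 d1] := delta01.
by rewrite /l ln_ge0// ler_pdivlMr// mul1r ltW.
Qed.

Let D0 : 0 < D. Proof. exact: lt_le_trans cD. Qed.

Let a0 : 0 <= a.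
Proof.
rewrite /n_coef; apply: addr_ge0; first by rewrite divr_ge0// ltW.
by apply: mulr_ge0; [exact: mulr_ge0|exact: addr_ge0].
Qed.

Let b0 : 0 <= b.
Proof.
rewrite /m_coef; apply: addr_ge0; first exact: sqr_ge0.
by apply: mulr_ge0 => //; exact: sqr_ge0.
Qed.

Lemma samples_prefix s j : (j <= K)%N ->
  (forall i, (i < j)%N -> residual (run s i) <=
     eps_ 2^-1 i * (i.+1%:R ^+ 2 * (q * D))) ->
  (st_samples (run s j))%:R <= j.+1%:R * mome_part + j%:R * epoch_part.
Proof.
elim: j => [|j IH] jK res.
  rewrite mul0r addr0 mul1r /= add0n; exact: (@mome_cost_bound R delta).
have IHj := IH (ltnW jK) (fun i ij => res i (ltnW ij)).
have cost1 := mome_cost_bound delta01 K0 jK.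
have Rt0 : 0 <= residual (run s j) by exact: normr_ge0.
have RtD : residual (run s j) <= 2 * eps_ 2^-1 j.+1 * (j.+1%:R ^+ 2 * (q * D)).
  apply: le_trans (res j (ltnSn j)) _.
  suff -> : 2 * eps_ 2^-1 j.+1 = eps_ 2^-1 j :> R by [].
  by rewrite /eps_ exprS mulVKf.
have cost2 := epoch_cost delta01 gamma01 c0 cD q0 (ltn0Sn j) Rt0 RtD.
rewrite runS /= -/(run_n tau x0 2^-1 delta gamma s j).
rewrite -/(run_m tau x0 2^-1 delta gamma s j) natrD natrD [(2 * _)%:R]natrM.
have hw : 2 * a * b * j.+1%:R ^+ 7 * D ^+ 3 * (1 - rho_ 2^-1 gamma j.+1)^-1 ^+ 3 <=
    2 * a * b * K%:R ^+ 7 * D ^+ 3 * W ^+ 3.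
  have /andP[r0 r1] := rho_bounds (@half01 R) j.+1 gamma01.
  have w0 : 0 <= (1 - rho_ 2^-1 gamma j.+1)^-1 by rewrite invr_ge0 subr_ge0 ltW.
  have ab0 : 0 <= 2 * a * b by apply: mulr_ge0 => //; exact: mulr_ge0.
  have D3 : 0 <= D ^+ 3 by apply: exprn_ge0; exact: ltW.
  apply: ler_pM.
  - by apply: mulr_ge0 => //; apply: mulr_ge0 => //; exact: exprn_ge0.
  - exact: exprn_ge0.
  - apply: ler_wpM2r => //; apply: ler_wpM2l => //.
    by apply: lerXn2r; rewrite ?nnegrE// ler_nat.
  - have hW := W_ge (ltn0Sn j) jK.
    by apply: lerXn2r; rewrite ?nnegrE// (le_trans w0).
have e1 : j.+2%:R * mome_part + j.+1%:R * epoch_part =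
    (j.+1%:R * mome_part + j%:R * epoch_part) + epoch_part + mome_part.
  by rewrite -[j.+2%:R]natr1 -[j.+1%:R in X in _ + X]natr1; ring.
rewrite e1; apply: lerD; last exact: cost1.
apply: lerD; first exact: IHj.
by rewrite /epoch_part ler_pM2l//; apply: le_trans hw.
Qed.

(** There are K + 1 <= 2 K calls of [mome], hence 872 = 2 * 436, and 4^K is written as a square so
    that the bound on 2^K applies. K^8 is K^7 per epoch, over [K] epochs. *)
Lemma samples_total s :
  (forall i, (i < K)%N -> residual (run s i) <=
     eps_ 2^-1 i * (i.+1%:R ^+ 2 * (q * D))) ->
  (st_samples (run s K))%:R <=
  872 * (55 + 18 * l) * (K%:R * 2 ^+ K) ^+ 2 +
  4 * a * b * K%:R ^+ 8 * (D ^+ 3 * W ^+ 3).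
Proof.
move=> res; apply: le_trans (samples_prefix (leqnn K) res) _.
have mp0 : 0 <= mome_part.
  apply: mulr_ge0.
    by apply: mulr_ge0; [exact: ler0n|apply: exprn_ge0; exact: ler0n].
  apply: mulr_ge0; first exact: ler0n.
  by apply: addr_ge0; [exact: ler0n|apply: mulr_ge0; [exact: ler0n|exact: l0]].
have hK : K.+1%:R <= 2 * K%:R :> R.
  by rewrite -natrM ler_nat mul2n -addnn -addn1 leq_add2l.
have h := ler_wpM2r mp0 hK.
apply: le_trans (lerD h (lexx _)) _.
have e4 : 4 ^+ K = (2 ^+ K) ^+ 2 :> R.
  by rewrite exprAC (_ : 2 ^+ 2 = 4 :> R)// expr2 -natrM.
have e872 : 872 = 2 * 436 :> R by rewrite -natrM.
rewrite /mome_part /epoch_part e4 e872; move: (436 : R) (55 + 18 * l) => u v.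
move: (2 ^+ K) (K%:R) (a) (b) D W => t k a' b' D' W'.
rewrite le_eqVlt; apply/orP; left; apply/eqP; ring.
Qed.

End TotalCost.

Section Rate.
Context {R : realType}.
Variables (gamma D eps W Lam g0 k0 e1 ab : R) (K : nat).
Hypotheses (D0 : 0 < D) (eps0 : 0 < eps) (Lam1 : 1 <= Lam) (gamma1 : gamma <= 1).
Hypotheses (g00 : 0 <= g0) (k00 : 0 <= k0) (e10 : 0 <= e1) (ab0 : 0 <= ab).
Hypotheses (W0 : 0 <= W) (W_pow : W <= 2 * 2 ^+ K).
Hypothesis W_gap : gamma < 1 -> W <= (1 - gamma)^-1.
Hypotheses (hK : K%:R <= k0 * Lam) (hg : 2 ^+ K <= g0 * (D / eps) * Lam ^+ 3).

Let Lam0 : 0 <= Lam. Proof. exact: le_trans Lam1. Qed.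
Let t0 : 0 <= D / eps. Proof. by rewrite divr_ge0// ltW. Qed.

Let gap_term : R := if gamma == 1 then D ^+ 6 / eps ^+ 3
  else Num.min (D ^+ 6 / eps ^+ 3) (D ^+ 3 / (1 - gamma) ^+ 3).

Let gap_term0 : 0 <= gap_term.
Proof.
have p3 := exprn_ge0 3 (ltW D0); have p6 := exprn_ge0 6 (ltW D0).
have e3 := exprn_ge0 3 (ltW eps0).
rewrite /gap_term; case: ifP => _; first exact: divr_ge0.
rewrite le_min divr_ge0//= divr_ge0//.
by rewrite exprn_ge0// subr_ge0.
Qed.

(** The bound of [W] through 2^K gives the first term of the minimum, the spectral gap the second; 8
    g0^3 + 1 dominates both coefficients. *)
Lemma gap_bound : D ^+ 3 * W ^+ 3 <= (8 * g0 ^+ 3 + 1) * Lam ^+ 9 * gap_term.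
Proof.
have p3 := exprn_ge0 3 (ltW D0).
have L9 : 1 <= Lam ^+ 9 by exact: exprn_ege1.
have g3 : 0 <= 8 * g0 ^+ 3 by rewrite mulr_ge0// exprn_ge0.
have h1 : D ^+ 3 * W ^+ 3 <= (8 * g0 ^+ 3) * Lam ^+ 9 * (D ^+ 6 / eps ^+ 3).
  have hW : W <= 2 * (g0 * (D / eps) * Lam ^+ 3).
    by apply: le_trans W_pow _; rewrite ler_pM2l.
  apply: (@le_trans _ _ (D ^+ 3 * (2 * (g0 * (D / eps) * Lam ^+ 3)) ^+ 3)).
    by apply: ler_wpM2l => //; apply: lerXn2r; rewrite ?nnegrE// (le_trans W0).
  rewrite le_eqVlt; apply/orP; left; apply/eqP; field; exact: lt0r_neq0.
have h6 : 0 <= D ^+ 6 / eps ^+ 3 by rewrite divr_ge0// exprn_ge0// ltW.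
have c1 : 8 * g0 ^+ 3 * Lam ^+ 9 <= (8 * g0 ^+ 3 + 1) * Lam ^+ 9.
  by apply: ler_wpM2r; [exact: le_trans L9|rewrite lerDl].
have h1' : D ^+ 3 * W ^+ 3 <= (8 * g0 ^+ 3 + 1) * Lam ^+ 9 * (D ^+ 6 / eps ^+ 3).
  by apply: le_trans h1 _; exact: ler_wpM2r.
rewrite /gap_term; have [//|g_neq1] := eqVneq gamma 1.
have g_lt1 : gamma < 1 by rewrite lt_neqAle g_neq1.
have [_|_] := leP (D ^+ 6 / eps ^+ 3); first exact: h1'.
have h2 : D ^+ 3 * W ^+ 3 <= D ^+ 3 / (1 - gamma) ^+ 3.
  rewrite -exprVn; apply: ler_wpM2l => //; apply: lerXn2r; rewrite ?nnegrE//.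
    by rewrite invr_ge0 subr_ge0.
  exact: W_gap.
apply: le_trans h2 _; rewrite ler_peMl//.
  by rewrite divr_ge0// exprn_ge0// subr_ge0.
rewrite -[X in X <= _]mulr1; apply: ler_pM => //.
by rewrite lerDr.
Qed.

(** Each K costs one [Lam] and each 2^K three: the median part has exponent 2 (1 + 3) = 8, the epoch
    part 8 + 9 = 17. *)
Lemma rate_bound :
  e1 * (K%:R * 2 ^+ K) ^+ 2 + ab * K%:R ^+ 8 * (D ^+ 3 * W ^+ 3) <=
  (e1 * k0 ^+ 2 * g0 ^+ 2 + ab * k0 ^+ 8 * (8 * g0 ^+ 3 + 1)) *
  sample_rate D eps gamma * Lam ^+ 17.
Proof.
have k0L : 0 <= k0 * Lam by exact: mulr_ge0.
have gtL : 0 <= g0 * (D / eps) * Lam ^+ 3.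
  by apply: mulr_ge0; [exact: mulr_ge0|exact: exprn_ge0].
have h1 : e1 * (K%:R * 2 ^+ K) ^+ 2 <=
    e1 * (k0 * Lam * (g0 * (D / eps) * Lam ^+ 3)) ^+ 2.
  apply: ler_wpM2l => //.
  apply: lerXn2r; rewrite ?nnegrE.
  - by rewrite mulr_ge0// exprn_ge0.
  - exact: mulr_ge0.
  - by apply: ler_pM => //; exact: exprn_ge0.
have g3 : 0 <= 8 * g0 ^+ 3 + 1 by rewrite addr_ge0// mulr_ge0// exprn_ge0.
have D3W : 0 <= D ^+ 3 * W ^+ 3 by rewrite mulr_ge0// exprn_ge0// ltW.
have h2 : ab * K%:R ^+ 8 * (D ^+ 3 * W ^+ 3) <=
    ab * (k0 * Lam) ^+ 8 * ((8 * g0 ^+ 3 + 1) * Lam ^+ 9 * gap_term).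
  apply: ler_pM => //; last exact: gap_bound.
    by apply: mulr_ge0 => //; exact: exprn_ge0.
  apply: ler_wpM2l => //.
  by apply: lerXn2r; rewrite ?nnegrE.
apply: le_trans (lerD h1 h2) _.
have L17 : Lam ^+ 8 <= Lam ^+ 17 by rewrite ler_weXn2l.
set A := e1 * k0 ^+ 2 * g0 ^+ 2.
have A0 : 0 <= A.
  by apply: mulr_ge0; [apply: mulr_ge0 => //|]; exact: exprn_ge0.
set B := ab * k0 ^+ 8 * (8 * g0 ^+ 3 + 1).
have B0 : 0 <= B.
  by apply: mulr_ge0 => //; apply: mulr_ge0 => //; exact: exprn_ge0.
have e1' : e1 * (k0 * Lam * (g0 * (D / eps) * Lam ^+ 3)) ^+ 2 =
    A * (D ^+ 2 / eps ^+ 2) * Lam ^+ 8.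
  by rewrite /A; field; exact: lt0r_neq0.
have e2 : ab * (k0 * Lam) ^+ 8 * ((8 * g0 ^+ 3 + 1) * Lam ^+ 9 * gap_term) =
    B * gap_term * Lam ^+ 17 by rewrite /B; ring.
have sq0 : 0 <= D ^+ 2 / eps ^+ 2 by rewrite divr_ge0// sqr_ge0.
rewrite e1' e2 /sample_rate -/gap_term.
have L0 : 0 <= Lam ^+ 17 by exact: exprn_ge0.
apply: (@le_trans _ _ ((A * (D ^+ 2 / eps ^+ 2) + B * gap_term) * Lam ^+ 17)).
  by rewrite mulrDl lerD2r ler_wpM2l// mulr_ge0.
apply: ler_wpM2r => //; rewrite mulrDl mulrDr mulrDr -addrA lerD2l.
apply: le_trans (_ : B * gap_term <= _).
  by [].
have := mulr_ge0 A0 gap_term0; have := mulr_ge0 B0 sq0.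
by move: (A * gap_term) (B * gap_term) (B * _) => *; lra.
Qed.

End Rate.

(** With sqrt 2 <= 3/2 and sqrt kappa <= kappa, the terms add up to (1 + 3/2 + 9/2) kappa D + 3 D /
    c, and the factor 3 of [run_bound] gives 21 and 9. *)
Lemma error_level_le {R : realType} (B C c L gamma dist D : R) :
  1 <= B * C ^+ 2 -> 0 < c -> c <= D -> dist <= D ->
  Num.sqrt (L ^+ 2 + gamma ^+ 2) <= D ->
  3 * (dist + (mome_level B C D + epoch_level B C L gamma)) <=
  (21 * (B * C ^+ 2) + 9 / c) * D.
Proof.
move=> k1 c0 cD distD SD; rewrite /mome_level /epoch_level.
move: (B * C ^+ 2) k1 => kap k1.
have D0 : 0 <= D by rewrite ltW// (lt_le_trans c0).
have kap0 : 0 <= kap by exact: le_trans k1.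
have sk := sqrt_le_self k1.
have s2 : Num.sqrt 2 <= 3 / 2 :> R.
  rewrite -(@ler_pXn2r _ 2) ?nnegrE// ?sqrtr_ge0// sqr_sqrtr//; lra.
have h1 : Num.sqrt kap * D <= kap * D by exact: ler_wpM2r.
have h2 : Num.sqrt (kap * (2 * (L ^+ 2 + gamma ^+ 2))) <= 3 / 2 * (kap * D).
  rewrite sqrtrM// sqrtrM//.
  apply: (@le_trans _ _ (kap * (3 / 2 * D))); last by rewrite mulrCA.
  apply: ler_pM => //; rewrite ?mulr_ge0 ?sqrtr_ge0//.
  by apply: ler_pM; rewrite ?sqrtr_ge0.
have h3 : 1 <= D / c by rewrite ler_pdivlMr// mul1r.
have h4 : D <= kap * D by exact: ler_peMl.
have -> : (21 * kap + 9 / c) * D = 21 * (kap * D) + 9 * (D / c) by ring.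
move: h1 h2 h3 h4 distD; clear.
move: (Num.sqrt kap * D) (Num.sqrt _) (D / c) (kap * D) => u v w z *; lra.
Qed.

Definition log_rate {R : realType} (rate : R) : R := 1 + ln (1 + rate).

Definition level_coef {R : realType} (a : R) : R := 2 * `|ln (8 * a)| + 2.

(** With t = D_L / epsilon, t <= 1 + t^2 <= 1 + rate makes the number of epochs logarithmic in the
    rate itself; log2 <= 2 ln accounts for the twos in [level_coef]. *)
Lemma log_level_le {R : realType} (a t rate : R) :
  0 < a -> 0 < t -> 1 <= 8 * (a * t) -> t ^+ 2 <= rate ->
  log_level (8 * (a * t)) <= level_coef a * log_rate rate.
Proof.
move=> a0 t0 x1 tr.
have r0 : 0 <= rate by rewrite (le_trans _ tr)// sqr_ge0.
have lr0 : 0 <= ln (1 + rate) by rewrite ln_ge0// lerDl.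
have lt : ln t <= ln (1 + rate).
  rewrite ler_ln ?posrE//; last by rewrite ltr_pwDl.
  apply: le_trans (_ : 1 + t ^+ 2 <= _); last by rewrite lerD2l.
  by have := sqr_ge0 (t - 1); rewrite sqrrB1; move: (t ^+ 2) => ?; lra.
apply: le_trans (log2_le x1) _.
rewrite mulrA lnM ?posrE ?mulr_gt0//.
have hn := ler_norm (ln (8 * a)); have n0 := normr_ge0 (ln (8 * a)).
rewrite /level_coef /log_rate.
have := mulr_ge0 n0 lr0.
move: lt hn n0 lr0; clear.
move: (ln (8 * a)) (ln t) (ln (1 + rate)) => u v w *; nra.
Qed.

Section Prefactor.
Context {R : realType}.
Variables (cbeta c : R).

Definition residual_coef (kap : R) : R := 21 * kap + 9 / c.

Definition epochs_coef (a : R) : R := (8 + `|cbeta|) * level_coef a.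

Definition growth_coef (a : R) : R :=
  16 * a * expR `|cbeta| * level_coef a ^+ 3.

(** The constants of [samples_total] and [rate_bound] combined. They depend on [cbeta], [c], [kap]
    and [l] alone, so this serves as [h] in the theorem. *)
Definition prefactor (kap l : R) : R :=
  let q := residual_coef kap in
  let k0 := epochs_coef (alpha kap l c) in
  let g0 := growth_coef (alpha kap l c) in
  872 * (55 + 18 * l) * k0 ^+ 2 * g0 ^+ 2 +
  4 * n_coef c q l * m_coef c q * k0 ^+ 8 * (8 * g0 ^+ 3 + 1).

End Prefactor.

Section Problem.
Context {R : realType}.
Variables (cbeta c delta epsilon gamma L sigma B C res0 dist0 D : R).
Hypotheses (B1 : 1 <= B) (C1 : 1 <= C) (delta01 : 0 < delta < 1).
Hypotheses (gamma01 : 0 < gamma <= 1) (c0 : 0 < c) (cD : c <= D).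
Hypotheses (eps0 : 0 < epsilon) (cDe : c <= D / epsilon).
Hypotheses (sigma0 : 0 <= sigma) (dist00 : 0 <= dist0) (res00 : 0 <= res0).
Hypotheses (sigmaD : sigma <= D) (distD : dist0 <= D) (resD : res0 <= 2 * D).
Hypothesis SD : Num.sqrt (L ^+ 2 + gamma ^+ 2) <= D.

Let kappa : R := B * C ^+ 2.
Let l : R := ln (1 / delta).
Let K := num_epochs 2^-1 cbeta delta epsilon gamma L sigma B C res0 dist0.
Let rate := sample_rate D epsilon gamma.
Let al := alpha kappa l c.

Let D0 : 0 < D. Proof. exact: lt_le_trans cD. Qed.
Let t0 : 0 < D / epsilon. Proof. exact: divr_gt0. Qed.

Let kappa1 : 1 <= kappa.
Proof. by rewrite /kappa -[1]mulr1 ler_pM// exprn_ege1. Qed.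

Let l0 : 0 <= l.
Proof.
have /andP[d0 d1] := delta01.
by rewrite /l ln_ge0// ler_pdivlMr// mul1r ltW.
Qed.

Let alpha_ge : c^-1 <= al.
Proof.
have kap0 : 0 <= kappa by exact: le_trans kappa1.
rewrite /al /alpha lerDr; apply: addr_ge0; first apply: addr_ge0.
- exact: mulr_ge0.
- by apply: divr_ge0 => //; exact: ltW.
- apply: mulr_ge0 => //; apply: addr_ge0 => //; apply: mulr_ge0.
    exact: mulr_ge0.
  by rewrite addr_ge0.
Qed.

Let al0 : 0 < al. Proof. by apply: lt_le_trans alpha_ge; rewrite invr_gt0. Qed.

(** Here D_L / epsilon >= c enters, through the summand c^-1 of [alpha]: the argument of the
    logarithm must be at least 2 for [log_level] to be at least 1. *)
Let x_ge8 : 8 <= 8 * (al * (D / epsilon)).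
Proof.
rewrite ler_peMr//.
have ci0 : 0 <= c^-1 by rewrite invr_ge0 ltW.
have -> : 1 = c^-1 * c :> R by rewrite mulVf// gt_eqF.
by apply: ler_pM => //; exact: ltW.
Qed.

Let rate_ge : (D / epsilon) ^+ 2 <= rate.
Proof.
rewrite /rate /sample_rate expr_div_n lerDl.
have p3 := exprn_ge0 3 (ltW D0); have p6 := exprn_ge0 6 (ltW D0).
have e3 := exprn_ge0 3 (ltW eps0).
case: ifP => _; first exact: divr_ge0.
rewrite le_min divr_ge0//= divr_ge0//.
by have /andP[_ g1] := gamma01; rewrite exprn_ge0// subr_ge0.
Qed.

Lemma log_rate_ge1 : 1 <= log_rate rate.
Proof.
have r0 : 0 <= rate by rewrite (le_trans _ rate_ge)// sqr_ge0.
by rewrite /log_rate lerDl ln_ge0// lerDl.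
Qed.

Lemma epochs_bounds :
  K%:R <= epochs_coef cbeta al * log_rate rate /\
  2 ^+ K <= growth_coef cbeta al * (D / epsilon) * log_rate rate ^+ 3.
Proof.
have x2 : 2 <= 8 * (al * (D / epsilon)).
  by apply: le_trans x_ge8; rewrite ler_nat.
have x1 : 1 <= 8 * (al * (D / epsilon)) by apply: le_trans x2; rewrite ler1n.
have ex : 8 * (al * (D / epsilon)) = 8 * (al * D) / epsilon by rewrite -!mulrA.
have hK : K%:R <= log_level (8 * (al * (D / epsilon))) +
    3 * (ln (log_level (8 * (al * (D / epsilon)))) / ln 2) + `|cbeta| + 1.
  by rewrite ex; apply: num_epochs_le => //; rewrite -/kappa -/l -/al -ex.
have [h1 h2] := count_bounds x2 hK.
have hl := log_level_le al0 t0 x1 rate_ge.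
have l1 := log_level_ge1 x2.
split.
  apply: le_trans h1 _; rewrite /epochs_coef -mulrA.
  by apply: ler_wpM2l => //; exact: addr_ge0.
apply: le_trans h2 _; rewrite /growth_coef.
move: hl l1; move: (log_level (8 * _)) (log_rate rate) (level_coef al) => y Lm v yv y1.
have -> : 16 * al * expR `|cbeta| * v ^+ 3 * (D / epsilon) * Lm ^+ 3 =
    2 * expR `|cbeta| * (8 * (al * (D / epsilon))) * (v * Lm) ^+ 3.
  have -> : 16 = 2 * 8 :> R by rewrite -natrM.
  rewrite exprMn; move: (D / epsilon) (expR _) => t e; ring.
apply: ler_wpM2l.
  by apply: mulr_ge0; [exact: mulr_ge0 (ltW (expR_gt0 _))|exact: le_trans x1].
have y0 : 0 <= y by exact: le_trans y1.
by apply: lerXn2r; rewrite ?nnegrE// (le_trans y0).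
Qed.

Lemma total_samples_le {E : completeNormedModType R} {d : measure_display}
    {Xi : measurableType d} (tau : E -> Xi -> E) (x0 : E) s :
  (forall i, (i < K)%N -> residual (vr_ghal tau x0 2^-1 delta gamma s i) <=
     eps_ 2^-1 i * (i.+1%:R ^+ 2 * (residual_coef c kappa * D))) ->
  (st_samples (vr_ghal tau x0 2^-1 delta gamma s K))%:R <=
  prefactor cbeta c kappa l * rate * log_rate rate ^+ 17.
Proof.
move=> res.
have /andP[g0 g1] := gamma01.
have q0 : 0 <= residual_coef c kappa.
  apply: addr_ge0; last by rewrite divr_ge0// ltW.
  by apply: mulr_ge0 => //; exact: le_trans kappa1.
have K0 : (0 < K)%N by rewrite /K /num_epochs leq_max.
(* The case split is needed because the inverse of 1 - gamma is 0 at gamma = 1. *)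
pose W : R := if gamma == 1 then 2 * 2 ^+ K else Num.min (2 * 2 ^+ K) (1 - gamma)^-1.
have W_ge k : (0 < k)%N -> (k <= K)%N -> (1 - rho_ 2^-1 gamma k)^-1 <= W.
  move=> _ kK.
  have h1 : (1 - rho_ 2^-1 gamma k)^-1 <= 2 * 2 ^+ K.
    apply: le_trans (w_le_pow gamma01 k) _; apply: ler_wpM2l => //.
    by apply: ler_weXn2l => //; rewrite ler1n.
  rewrite /W; have [//|gn1] := eqVneq gamma 1.
  by rewrite le_min h1 w_le_gap// lt_neqAle gn1.
have W0 : 0 <= W.
  have p0 : 0 <= 2 * 2 ^+ K :> R by rewrite mulr_ge0// exprn_ge0.
  rewrite /W; case: ifP => // _.
  by rewrite le_min p0 invr_ge0 subr_ge0.
have W_pow : W <= 2 * 2 ^+ K.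
  by rewrite /W; case: ifP => // _; rewrite ge_min lexx.
have W_gap : gamma < 1 -> W <= (1 - gamma)^-1.
  by move=> gl; rewrite /W lt_eqF// ge_min lexx orbT.
apply: le_trans (samples_total delta01 gamma01 c0 cD q0 K0 W_ge res) _.
have [hK hg] := epochs_bounds.
have lc0 : 0 <= level_coef al by rewrite addr_ge0// mulr_ge0.
have k00 : 0 <= epochs_coef cbeta al by apply: mulr_ge0 => //; exact: addr_ge0.
have g00 : 0 <= growth_coef cbeta al.
  apply: mulr_ge0; last exact: exprn_ge0.
  by apply: mulr_ge0; [exact: mulr_ge0 (ltW al0)|exact: ltW (expR_gt0 _)].
have e10 : 0 <= 872 * (55 + 18 * l).
  apply: mulr_ge0; first exact: ler0n.
  by apply: addr_ge0; [exact: ler0n|apply: mulr_ge0; [exact: ler0n|exact: l0]].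
have n0 : 0 <= n_coef c (residual_coef c kappa) l.
  apply: addr_ge0; first by rewrite divr_ge0// ltW.
  by apply: mulr_ge0; [exact: mulr_ge0|exact: addr_ge0].
have m0 : 0 <= m_coef c (residual_coef c kappa).
  by apply: addr_ge0; [exact: sqr_ge0|apply: mulr_ge0 => //; exact: sqr_ge0].
have ab0 : 0 <= 4 * n_coef c (residual_coef c kappa) l *
    m_coef c (residual_coef c kappa).
  by apply: mulr_ge0 => //; exact: mulr_ge0.
exact: rate_bound D0 eps0 log_rate_ge1 g1 g00 k00 e10 ab0 W0 W_pow W_gap hK hg.
Qed.

End Problem.

Lemma sum_delta_half {R : realType} (delta : R) K : 0 <= delta ->
  \sum_(i < K) delta_ 2^-1 delta i.+1 <= delta.
Proof.
move=> d0; suff -> : \sum_(i < K) delta_ 2^-1 delta i.+1 = delta * (1 - 2^-1 ^+ K).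
  by rewrite ler_piMr// gerBl exprn_ge0.
elim: K => [|K IH]; first by rewrite big_ord0 subrr mulr0.
rewrite big_ord_recr /= IH delta_half -mulrDr exprS; congr (_ * _).
by move: (2^-1 ^+ K) => u; lra.
Qed.

(** The hidden factors are rendered by the quantifiers: for fixed [cbeta], the power [p] is chosen
    before [c], and [h] receives only kappa and ln (1 / delta). The lower bound [c] excludes the
    degenerate regime: with D_L fixed and epsilon growing, the rate tends to 0 while samples are
    still drawn. *)
Theorem corollary2 (R : realType) (cbeta : R) :
  sufficient_epochs_constant (2^-1) cbeta ->
  exists p : nat, forall c : R, 0 < c -> exists h : R -> R -> R,
  forall (E : completeNormedModType R) (N : E -> R) (B C : R)
    (d : measure_display) (Xi : measurableType d) (D : probability Xi R)
    (T : E -> E) (tau : E -> Xi -> E) (x0 xstar : E)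
    (gamma sigma L epsilon delta : R)
    (d' : measure_display) (Omega : measurableType d') (P : probability Omega R)
    (xi : nat -> Omega -> Xi),
  separable_space E -> smoothable_by N B C ->
  0 < gamma <= 1 -> gamma.-lipschitz T -> T xstar = xstar ->
  0 <= sigma -> 0 < L -> stochastic_oracle D tau T sigma L ->
  0 < epsilon -> 0 < delta < 1 ->
  iid_seeds P D xi ->
  let DL := `|xstar - x0| + sigma + Num.sqrt (L ^+ 2 + gamma ^+ 2) in
  c <= DL -> c <= DL / epsilon ->
  let K := num_epochs (2^-1) cbeta delta epsilon gamma L sigma B C
             `|T x0 - x0| `|xstar - x0| in
  let samples w :=
    st_samples (vr_ghal tau x0 (2^-1) delta gamma (xi ^~ w) K) in
  let rate := sample_rate DL epsilon gamma in
  ((1 - delta)%:E <=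
   P [set w | ((samples w)%:R <=
               h (B * C ^+ 2) (ln (1 / delta)) * rate * (1 + ln (1 + rate)) ^+ p)%R])%E.
Proof.
move=> _; exists 17%N => c c0; exists (prefactor cbeta c).
move=> E N B C d Xi D T tau x0 xstar gamma sigma L epsilon delta d' Omega P xi.
move=> sepE smoothN gamma01 lipT fixT sigma0 L0 [mtau meanT varT lip2] eps0.
move=> delta01 iid DL cDL cDe.
set K := num_epochs _ _ _ _ _ _ _ _ _ _ _; cbv zeta.
set rate := sample_rate _ _ _.
have [mu muD muP] := stream_law iid.
have lip x y : `|T x - T y| <= gamma * `|x - y| by exact: (lipT (x, y)).
have mean x : weak_mean D (tau x) (T x) by exact: bochner_weak_mean.
have DL0 : 0 < DL by exact: lt_le_trans cDL.
have distD : `|xstar - x0| <= DL by rewrite /DL -addrA lerDl addr_ge0.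
have sigmaD : sigma <= DL by rewrite /DL addrAC lerDr addr_ge0.
have SD : Num.sqrt (L ^+ 2 + gamma ^+ 2) <= DL by rewrite /DL lerDr addr_ge0.
have resD : `|T x0 - x0| <= 2 * DL.
  have -> : T x0 - x0 = (T x0 - T xstar) + (xstar - x0) by rewrite fixT addrA subrK.
  apply: le_trans (ler_normD _ _) _; rewrite mulr_natl mulr2n; apply: lerD => //.
  apply: le_trans (lip _ _) _; apply: le_trans distD; rewrite (distrC x0).
  by apply: ler_piMl => //; have /andP[] := gamma01.
have [_ B1 C1 _ _] := smoothN.
have kap1 := kappa_ge1 smoothN.
have Mm0 : 0 <= mome_level B C DL.
  by apply: mulr_ge0 => //; apply: mulr_ge0; [exact: sqrtr_ge0|exact: ltW].
have Me0 : 0 <= epoch_level B C L gamma.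
  by apply: addr_ge0 => //; apply: mulr_ge0 => //; exact: sqrtr_ge0.
have [mbad bad_le] := good_run sepE muD smoothN mtau gamma01 lip mean varT lip2
  x0 (@half01 R) (fun k => delta_half_bounds k.+1 delta01) sigma0 DL0 sigmaD K.
set bad := \big[setU/set0]_(i < K) _ in mbad bad_le.
set bound := prefactor _ _ _ _ * _ * _.
pose ok := [set s : stream Xi |
  (st_samples (vr_ghal tau x0 2^-1 delta gamma s K))%:R <= bound].
have mok : measurable ok.
  have [_ _ _ ms] := measurable_run sepE mtau x0 2^-1 delta gamma K.
  have := ms measurableT [set n : nat | n%:R <= bound] I.
  by rewrite setTI.
(* Outside [bad] the residual bounds of [run_bound] hold for all i < K, and they determine every
   sample size that is counted. *)
have sub : ~` bad `<=` ok.
  move=> s nb; apply: total_samples_le => // i iK.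
  have good j : (j < K)%N ->
      mome_ok tau T x0 2^-1 delta gamma (mome_level B C DL) s j /\
      epoch_ok tau T x0 2^-1 delta gamma (epoch_level B C L gamma) s j.
    move=> jK; split; apply: contrapT => h; apply: nb.
      rewrite /bad (bigD1 (Ordinal jK))//=; left; left; exact: h.
    rewrite /bad (bigD1 (Ordinal jK))//=; left; right; exact: h.
  have [_ res] := run_bound (@half01 R) gamma01 lip fixT Mm0 Me0
    (fun j ji => (good j (leq_ltn_trans ji iK)).1)
    (fun j ji => (good j (ltn_trans ji iK)).2).
  apply: le_trans res _; apply: ler_wpM2l; first by apply: ltW; exact: eps_gt0 (@half01 R) _.
  apply: ler_wpM2l; first exact: sqr_ge0.
  by apply: error_level_le => //; rewrite distrC.
have -> : P [set w | (st_samples (vr_ghal tau x0 2^-1 delta gamma (xi ^~ w) K))%:R <= bound] = mu ok by rewrite muP.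
have badd : (mu bad <= delta%:E)%E.
  have /andP[d0 _] := delta01.
  by apply: le_trans bad_le _; rewrite lee_fin sum_delta_half// ltW.
apply: le_trans (_ : mu (~` bad) <= _)%E; last first.
  by apply: le_measure; [apply: mem_set; exact: measurableC|exact: mem_set|exact: sub].
by rewrite probability_setC// EFinB leeB.
Qed.
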